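(* Let $T>0$, $H\in(0,2)$, let $\{N_s,s\ge0\}$ be a standard Poisson process and let $\theta\in(0,\pi)\cup(\pi,2\pi)$. For $\varepsilon>0$ define $$X^H_\varepsilon=\left\{\frac{2}{\varepsilon}\int_0^\infty(1-e^{-st})s^{-\frac{1+H}{2}}\cos\left(\theta N_{\frac{2s}{\varepsilon^2}}\right)\mathrm{d}s,\ t\in[0,T]\right\},$$ $$\tilde X^H_\varepsilon=\left\{\frac{2}{\varepsilon}\int_0^\infty(1-e^{-st})s^{-\frac{1+H}{2}}\sin\left(\theta N_{\frac{2s}{\varepsilon^2}}\right)\mathrm{d}s,\ t\in[0,T]\right\}.$$ Then, as $\varepsilon\to0$, the processes $X^H_\varepsilon$ and $\tilde X^H_\varepsilon$ converge (jointly) in law in $\mathcal{C}([0,T])$ towards two independent processes, each with the same law as the process $X^H=\{X^H_t,t\in[0,T]\}$ defined by $$X^H_t=\int_0^\infty(1-e^{-rt})r^{-\frac{1+H}{2}}\,\mathrm{d}W_r,$$ where $W$ is a standard Brownian motion.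
   Context: A standard Poisson process is a Poisson process of intensity $1$ with $N_0=0$. $\mathcal{C}([0,T])$ is the space of continuous real functions on $[0,T]$ with the uniform topology. For each $t$, the integrals over $[0,\infty)$ defining $X^H_\varepsilon(t)$ and $\tilde X^H_\varepsilon(t)$ are understood as limits in $L^2(\Omega)$, as $R\to\infty$, of the corresponding integrals over $[0,R]$ (ordinary integrals when the kernel is integrable), and $X^H_\varepsilon$, $\tilde X^H_\varepsilon$, $X^H$ are taken in their versions with continuous trajectories. *)

(* Defs.v *)
From HB Require Import structures.
From mathcomp Require Import all_boot all_order all_algebra.
From mathcomp Require Import all_classical all_reals all_analysis.
Import Order.TTheory GRing.Theory Num.Theory.
Import numFieldNormedType.Exports.

Set Implicit Arguments.
Unset Strict Implicit.
Unset Printing Implicit Defensive.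

Local Open Scope classical_set_scope.
Local Open Scope ring_scope.

(* [contT T] is C([0,T]): `[0, T] carries the subspace topology of R, and the
   topology on the functions is that of uniform convergence (not the pointwise
   or compact-open one that other library modules can put on continuousType). *)
Definition contT (R : realType) (T : R) : Type :=
  continuousType (set_type `[0, T]) R.

Definition contT_fun (R : realType) (T : R) (f : contT T) :
  arrow_uniform_type (set_type `[0, T]) R := f.

HB.instance Definition _ (R : realType) (T : R) := Choice.on (contT T).

HB.instance Definition _ (R : realType) (T : R) :=
  Uniform.copy (contT T) (initial_topology (@contT_fun R T)).

HB.instance Definition _ (R : realType) (T : R) :=
  PseudoMetric.copy (contT T) (initial_topology (@contT_fun R T)).

Definition borel (S : topologicalType) : set (set S) := <<s @open S >>.

Section Laws.
Context (R : realType) (S : topologicalType).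

Definition random_element d (Omega : measurableType d) (X : Omega -> S) :=
  forall A, borel A -> measurable (X @^-1` A).

Definition same_law d1 (O1 : measurableType d1) (P1 : probability O1 R)
    (X : O1 -> S) d2 (O2 : measurableType d2) (P2 : probability O2 R)
    (Y : O2 -> S) :=
  forall A, borel A -> P1 (X @^-1` A) = P2 (Y @^-1` A).

Definition independent_elements d (Omega : measurableType d)
    (P : probability Omega R) (X Y : Omega -> S) :=
  forall A B, borel A -> borel B ->
    P (X @^-1` A `&` Y @^-1` B) = (P (X @^-1` A) * P (Y @^-1` B))%E.

Definition cvg_in_law (I : Type) (F : set_system I)
    d1 (O1 : measurableType d1) (P1 : probability O1 R) (X : I -> O1 -> S)
    d2 (O2 : measurableType d2) (P2 : probability O2 R) (Y : O2 -> S) :=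
  forall f : S -> R, continuous f -> (exists M, forall z, `|f z| <= M) ->
    ('E_P1[f \o X i])%E @[i --> F] --> ('E_P2[f \o Y])%E.

End Laws.

(* Mutual independence: since some of the B i may be the full space, the product
   rule for the whole family contains the one for every subfamily. *)
Definition independent_family (R : realType) d (Omega : measurableType d)
    (P : probability Omega R) d' (S : measurableType d') (n : nat)
    (Y : 'I_n -> Omega -> S) :=
  forall B : 'I_n -> set S, (forall i, measurable (B i)) ->
    fine (P (\bigcap_i (Y i @^-1` B i))) = \prod_(i < n) fine (P (Y i @^-1` B i)).

Section Processes.
Context (R : realType) d (Omega : measurableType d) (P : probability Omega R).

(* Only the values at times >= 0 are constrained. In [poisson_law] the strict
   inequality matters: poisson_pmf 0 is not a probability mass function. *)
Record poisson_process (lambda : R) (N : R -> {RV P >-> nat}) : Prop := {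
  poisson_nondecreasing : forall omega s t, 0 <= s -> s <= t ->
    (N s omega <= N t omega)%N ;
  poisson_right_continuous : forall omega t, 0 <= t ->
    \forall s \near t^'+, N s omega = N t omega ;
  poisson_indep_increments : forall n (t : nat -> R), 0 <= t 0%N ->
    {homo t : i j / (i <= j)%N >-> i <= j} ->
    independent_family P
      (fun (i : 'I_n) omega => (N (t i.+1) omega - N (t i) omega)%N) ;
  poisson_law : forall s t k, 0 <= s -> s < t ->
    P [set omega | (N t omega - N s omega)%N = k] =
    (poisson_pmf (lambda * (t - s)) k)%:E }.

Definition standard_poisson_process (N : R -> {RV P >-> nat}) :=
  poisson_process 1 N /\ forall omega, N 0 omega = 0%N.

Record standard_brownian_motion (W : R -> {RV P >-> R}) : Prop := {
  brownian0 : forall omega, W 0 omega = 0 ;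
  brownian_continuous : forall omega,
    {within `[0, +oo[, continuous (fun t => W t omega)} ;
  brownian_indep_increments : forall n (t : nat -> R), 0 <= t 0%N ->
    {homo t : i j / (i <= j)%N >-> i <= j} ->
    independent_family P
      (fun (i : 'I_n) omega => W (t i.+1) omega - W (t i) omega) ;
  brownian_law : forall s t B, 0 <= s -> s < t -> measurable B ->
    P [set omega | B (W t omega - W s omega)] =
    normal_prob 0 (Num.sqrt (t - s)) B }.

End Processes.

Definition L2_cvg (R : realType) d (S : measurableType d)
    (mu : {measure set S -> \bar R}) (D : set S) (I : Type) (F : set_system I)
    (u : I -> S -> R) (v : S -> R) :=
  (\int[mu]_(x in D) ((u i x - v x) ^+ 2)%:E)%E @[i --> F] --> 0%E.

Section WienerIntegral.
Context (R : realType) d (Omega : measurableType d) (P : probability Omega R).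

Definition step_fun (n : nat) (s c : nat -> R) (x : R) : R :=
  \sum_(i < n) c i * \1_(`]s i, s i.+1]) x.

Definition step_integral (W : R -> {RV P >-> R}) (n : nat) (s c : nat -> R)
    (omega : Omega) : R :=
  \sum_(i < n) c i * (W (s i.+1) omega - W (s i) omega).

(* J is (a version of) the Wiener integral of f over [0, +oo[: the L2 limit of
   the elementary integrals of step functions converging to f in L2([0, +oo[).
   By the Ito isometry J does not depend, up to a null set, on the sequence. *)
Definition wiener_integral (W : R -> {RV P >-> R}) (f : R -> R)
    (J : Omega -> R) :=
  measurable_fun setT J /\
  exists (n : nat -> nat) (s c : nat -> nat -> R),
    [/\ forall m, 0 <= s m 0%N /\ {homo s m : i j / (i <= j)%N >-> i <= j},
        L2_cvg (@lebesgue_measure R) `[0, +oo[ \oo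
          (fun m => step_fun (n m) (s m) (c m)) f &
        L2_cvg P setT \oo (fun m => step_integral W (n m) (s m) (c m)) J].

End WienerIntegral.

Definition laplace_kernel (R : realType) (H t s : R) : R :=
  (1 - expR (- (s * t))) * s `^ (- ((1 + H) / 2)).

Section LimitTheorem.
Context (R : realType) d (Omega : measurableType d) (P : probability Omega R).

(* g is cos or sin. *)
Definition truncated_integral (g : R -> R) (H theta : R)
    (N : R -> {RV P >-> nat}) (eps t r : R) (omega : Omega) : R :=
  2 / eps * \int[@lebesgue_measure R]_(s in `[0, r])
    (laplace_kernel H t s * g (theta * (N (2 * s / eps ^+ 2) omega)%:R)).

Definition poisson_version (g : R -> R) (H theta T : R)
    (N : R -> {RV P >-> nat}) (eps : R) (X : Omega -> contT T) :=
  forall t : set_type `[0, T],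
    measurable_fun setT (fun omega => X omega t) /\
    L2_cvg P setT +oo (truncated_integral g H theta N eps (\val t))
      (fun omega => X omega t).

Definition wiener_version (H T : R) (W : R -> {RV P >-> R})
    (X : Omega -> contT T) :=
  forall t : set_type `[0, T],
    wiener_integral W (laplace_kernel H (\val t)) (fun omega => X omega t).

End LimitTheorem.

(* Main.v *)
From mathcomp Require Import all_boot all_order all_algebra.
From mathcomp Require Import all_classical all_reals all_analysis.
From mathcomp Require Import ring lra measurable_realfun.
Require Import Defs.
Import Order.TTheory GRing.Theory Num.Theory.
Import numFieldNormedType.Exports.
Set Implicit Arguments.
Unset Strict Implicit.
Unset Printing Implicit Defensive.
Local Open Scope classical_set_scope.
Local Open Scope ring_scope.

(** The two processes integrate the kernels
    K_t(s) = (1 - exp(-st)) s^(-(1+H)/2) against the oscillating noises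
    (2/eps) cos(theta N) ds and (2/eps) sin(theta N) ds, where N is read at time
    2s/eps^2. As eps tends to 0 these become two independent white noises. Two
    estimates turn this into the theorem.

    Piecewise constant integrands. Let the argument A of a cosine grow in
    proportion to a cos x + b sin x, where x is the phase theta N. The expectation
    of cos A is followed in time with the method of perturbed test functions:
    cos A is replaced by cos A - e sin A g1(x) + e^2 cos A g2(x), where the
    correctors g1 and g2 are chosen so that a jump of the phase compensates the
    growth of A to the order e^2 ([generator], [Psi_step]). They are trigonometric
    polynomials because cos theta and cos(2 theta) differ from 1, that is, because
    theta is not a multiple of pi. What remains is the factor exp(-(a^2+b^2) l/2)
    over a segment of length l, up to O(eps) ([segment_limit], [steps_limit]):
    this is the characteristic function of two Brownian increments, and the
    absence of a term in ab is their independence.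

    Square bound. For f square integrable, the integral of f against either noise
    has second moment at most a constant times the integral of f^2, uniformly in
    eps ([discrete_L2], [poisson_int_L2], [poisson_L2]), because the
    characteristic function of N at theta decays exponentially. One consequence:
    the kernels may be replaced by the step functions that define their Wiener
    integrals, which gives the convergence of the joint characteristic functions
    of the marginals ([fdd_cos]). Another: the squared increments of the kernels
    over a partition of mesh delta sum to at most delta^(H/2) times a fixed
    integrable function ([kernel_increments]), so the largest increment of the
    paths over the dyadic grid of level n has expectation at most C 2^(-nH/4),
    uniformly in eps ([incr_bound_int]). This plays the role of tightness.

    From characteristic functions to functionals. No compactness is invoked; test
    functions are approximated instead. A bounded Lipschitz function of finitely
    many coordinates is approximated by trigonometric sums, one coordinate at a
    time, with errors controlled by the second moments ([lipschitz_conv]). A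
    bounded Lipschitz functional of the two paths is compared with its value at
    their dyadic interpolations, by chaining over the levels ([lipschitz_cvg]). A
    bounded continuous functional is the limit from below of Lipschitz ones;
    applied to f and to -f, this gives both halves of the convergence
    ([continuous_cvg_expectation]). The limit is realized by the two coordinates
    of the square of the space that carries the Brownian motion. *)

(** * Integrable functions *)

Section Integrability.
Context d (T : measurableType d) (R : realType) (m : {measure set T -> \bar R}).
Implicit Types (f g : T -> R) (D : set T).

Lemma integrable_scale D (c : R) f : measurable D -> m.-integrable D (EFin \o f) ->
  m.-integrable D (EFin \o (fun x => c * f x)).
Proof.
move=> mD i; rewrite (_ : EFin \o _ = (fun x => c%:E * (f x)%:E)%E)//.
exact: integrableZl.
Qed.

Lemma integrable_add D f g : measurable D -> m.-integrable D (EFin \o f) ->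
  m.-integrable D (EFin \o g) -> m.-integrable D (EFin \o (fun x => f x + g x)).
Proof.
move=> mD i j; rewrite (_ : EFin \o _ = (EFin \o f) \+ (EFin \o g))//.
exact: integrableD.
Qed.

Lemma integrable_sub D f g : measurable D -> m.-integrable D (EFin \o f) ->
  m.-integrable D (EFin \o g) -> m.-integrable D (EFin \o (fun x => f x - g x)).
Proof.
move=> mD i j; rewrite (_ : EFin \o _ = ((EFin \o f) \- (EFin \o g))%E)//.
exact: integrableB.
Qed.

Lemma integrable_abs D f : measurable D -> m.-integrable D (EFin \o f) ->
  m.-integrable D (EFin \o (fun x => `|f x|)).
Proof. by move=> mD i; exact: integrable_norm. Qed.

Lemma integrable_bounded_by D f g : measurable D -> measurable_fun D f ->
  (forall x, D x -> `|f x| <= g x) -> m.-integrable D (EFin \o g) ->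
  m.-integrable D (EFin \o f).
Proof.
move=> mD mf fg i; apply: (le_integrable mD) i; first exact/measurable_EFinP.
by move=> x Dx /=; rewrite lee_fin; apply: le_trans (fg x Dx) _; exact: ler_norm.
Qed.

Lemma integrable_measurable D f : m.-integrable D (EFin \o f) -> measurable_fun D f.
Proof. by case/integrableP => /measurable_EFinP. Qed.

Lemma Rintegral_dominated_cvg D (f_ : nat -> T -> R) f g : measurable D ->
  (forall n, measurable_fun D (f_ n)) ->
  (forall x, D x -> f_ n x @[n --> \oo] --> f x) ->
  m.-integrable D (EFin \o g) -> (forall n x, D x -> `|f_ n x| <= g x) ->
  m.-integrable D (EFin \o f) /\
  \int[m]_(x in D) f_ n x @[n --> \oo] --> \int[m]_(x in D) f x.
Proof.
move=> mD mf cf ig fg.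
have fi : m.-integrable D (EFin \o f).
  apply: (integrable_bounded_by mD _ _ ig); first exact: measurable_fun_cvg mf cf.
  move=> x Dx; apply: ler_cvg_to (cvg_norm (cf x Dx)) (@cvg_cst _ _ _ _ _) _.
  by apply: nearW => n; exact: fg.
split=> //; apply: fine_cvg; rewrite fineK; last exact: integrable_fin_num.
apply: (@dominated_cvg _ _ _ m D mD _ _ (fun x => (g x)%:E)) => //=.
- by move=> n; exact/measurable_EFinP.
- by move=> x Dx; apply: cvg_EFin; [exact: nearW|exact: cf].
Qed.

End Integrability.

(** * Bounded random variables and independence *)

Section Expectation.
Context d (T : measurableType d) (R : realType) (P : probability T R).
Implicit Types F G : T -> R.

(** Bounded measurable functions: a class stable under the algebraic
    operations, on which expectations are linear without integrability side
    conditions. *)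
Definition bmf F := measurable_fun setT F /\ exists M, forall w, `|F w| <= M.

Lemma bmf_integrable F : bmf F -> P.-integrable setT (EFin \o F).
Proof.
move=> [mF [M FM]]; apply: measurable_bounded_integrable => //.
  exact: le_lt_trans (probability_le1 _ _) (ltry _).
exists M; split; first exact: num_real.
by move=> x Mx w _; exact: le_trans (FM w) (ltW Mx).
Qed.

Lemma bmf_cst (c : R) : bmf (cst c).
Proof. by split=> //; exists `|c|. Qed.

Lemma bmfD F G : bmf F -> bmf G -> bmf (fun w => F w + G w).
Proof.
move=> [mF [M FM]] [mG [N GN]]; split; first exact: measurable_funD.
by exists (M + N) => w; apply: le_trans (ler_normD _ _) _; exact: lerD.
Qed.

Lemma bmfM F G : bmf F -> bmf G -> bmf (fun w => F w * G w).
Proof.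
move=> [mF [M FM]] [mG [N GN]]; split; first exact: measurable_funM.
by exists (M * N) => w; rewrite normrM; apply: ler_pM.
Qed.

Lemma bmfN F : bmf F -> bmf (fun w => - F w).
Proof.
move=> [mF [M FM]]; split; first exact: measurable_funN.
by exists M => w; rewrite normrN.
Qed.

Lemma bmfB F G : bmf F -> bmf G -> bmf (fun w => F w - G w).
Proof. by move=> bF bG; apply: bmfD => //; exact: bmfN. Qed.

Lemma bmfZ (c : R) F : bmf F -> bmf (fun w => c * F w).
Proof. by move=> bF; apply: bmfM => //; exact: bmf_cst. Qed.

Lemma bmf_abs F : bmf F -> bmf (fun w => `|F w|).
Proof.
move=> [mF [M FM]]; split; first exact: measurableT_comp.
by exists M => w; rewrite normr_id.
Qed.

Lemma continuous_measurableT (g : R -> R) F :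
  continuous g -> measurable_fun setT F -> measurable_fun setT (fun w => g (F w)).
Proof.
by move=> cg mF; apply: measurableT_comp => //; exact: continuous_measurable_fun.
Qed.

Lemma bmf_cos F : measurable_fun setT F -> bmf (fun w => cos (F w)).
Proof.
move=> mF; split; first exact: continuous_measurableT (@continuous_cos R) mF.
by exists 1 => w; exact: cos_max.
Qed.

Lemma bmf_sin F : measurable_fun setT F -> bmf (fun w => sin (F w)).
Proof.
move=> mF; split; first exact: continuous_measurableT (@continuous_sin R) mF.
by exists 1 => w; exact: sin_max.
Qed.

Lemma bmf_indic (A : set T) : measurable A -> bmf (\1_A : T -> R).
Proof.
move=> mA; split; first exact: measurable_indic.
by exists 1 => w; rewrite indicE; case: (_ \in _); rewrite ?normr1 ?normr0.
Qed.

Lemma ExD F G : bmf F -> bmf G ->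
  \int[P]_w (F w + G w) = \int[P]_w F w + \int[P]_w G w.
Proof. by move=> bF bG; rewrite RintegralD//; exact: bmf_integrable. Qed.

Lemma ExB F G : bmf F -> bmf G ->
  \int[P]_w (F w - G w) = \int[P]_w F w - \int[P]_w G w.
Proof. by move=> bF bG; rewrite RintegralB//; exact: bmf_integrable. Qed.

Lemma ExZ (c : R) F : bmf F -> \int[P]_w (c * F w) = c * \int[P]_w F w.
Proof. by move=> bF; rewrite RintegralZl//; exact: bmf_integrable. Qed.

Lemma Ex_cst (c : R) : \int[P]_w c = c.
Proof. rewrite Rintegral_cst// [X in fine X](_ : _ = 1%E) ?mulr1//; exact: probability_setT. Qed.

Lemma le_Ex F G : bmf F -> bmf G -> (forall w, F w <= G w) ->
  \int[P]_w F w <= \int[P]_w G w.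
Proof. by move=> bF bG FG; apply: le_Rintegral => //; exact: bmf_integrable. Qed.

Lemma le_norm_Ex F (M : R) : bmf F -> (forall w, `|F w| <= M) -> `|\int[P]_w F w| <= M.
Proof.
move=> bF FM; apply: le_trans (le_normr_Rintegral _ (bmf_integrable bF)) _ => //.
by rewrite -[leRHS]Ex_cst; apply: le_Ex => //; [exact: bmf_abs|exact: bmf_cst].
Qed.

Lemma Ex_indic (A : set T) : measurable A -> \int[P]_w (\1_A w : R) = fine (P A).
Proof. by move=> mA; rewrite /Rintegral integral_indic// setIT. Qed.

Lemma Ex_bounded_cvg (F_ : nat -> T -> R) F (M : R) :
  (forall n, measurable_fun setT (F_ n)) -> (forall n w, `|F_ n w| <= M) ->
  (forall w, F_ n w @[n --> \oo] --> F w) ->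
  bmf F /\ \int[P]_w F_ n w @[n --> \oo] --> \int[P]_w F w.
Proof.
move=> mF FM cF.
have mF0 : measurable_fun setT F by apply: (measurable_fun_cvg mF) => w _; exact: cF.
have bF : bmf F.
  split => //; exists M => w.
  have /(@cvg_lim _) <- // : `|F_ n w| @[n --> \oo] --> `|F w|.
    by apply: cvg_norm; exact: cF.
  apply: limr_le; first by apply: is_cvg_norm; apply/cvg_ex; exists (F w).
  by apply: nearW => n; exact: FM.
split=> //; rewrite /Rintegral.
apply: fine_cvg; rewrite fineK; last first.
  by apply: integrable_fin_num => //; exact: bmf_integrable.
apply: (@dominated_cvg _ _ _ P setT _ _ _ (fun=> M%:E)) => //=.
- by move=> n; exact/measurable_EFinP.
- by move=> w _; apply: cvg_EFin; [exact: nearW|exact: cF].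
- by apply: (bmf_integrable (bmf_cst M)).
- by move=> n w _; rewrite lee_fin.
Qed.

End Expectation.

Section Independence.
Context d (T : measurableType d) (R : realType) (P : probability T R).

Definition indep_sets (A B : set T) := P (A `&` B) = (P A * P B)%E.

(** The events independent of [E] form a Dynkin system, so that the pi-lambda
    theorem extends independence from a generating pi-system. *)
Lemma indep_sigma (G : set (set T)) (E : set T) :
  setI_closed G -> G `<=` measurable -> measurable E ->
  (forall A, G A -> indep_sets A E) -> forall A, <<s G >> A -> indep_sets A E.
Proof.
move=> GI Gm mE GE A GA.
have sm : <<s G >> `<=` (@measurable _ T).
  apply: smallest_sub => //; exact: sigma_algebra_measurable.
suff : [set A | measurable A /\ indep_sets A E] A by case.
apply: (lambda_system_subset GI _ _ _ GA) => //.
- apply/dynkin_lambda_system; split.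
  + by split=> //; rewrite /indep_sets setTI probability_setT mul1e.
  + move=> B [mB iB]; split; first exact: measurableC.
    rewrite /indep_sets probability_setC// muleBl ?mul1e ?fin_num_measure//.
    rewrite -iB setIC -setDE measureD//; last by rewrite ltey_eq fin_num_measure.
    by rewrite (setIC E B).
  + move=> F tF FE; split; first by apply: bigcupT_measurable => n; case: (FE n).
    rewrite /indep_sets setI_bigcupl.
    rewrite measure_bigcup//; last 2 first.
    * by move=> n _; apply: measurableI => //; case: (FE n).
    * exact: trivIset_setIr.
    rewrite measure_bigcup//; last by move=> n _; case: (FE n).
    rewrite -(fineK (fin_num_measure P E mE)) muleC -nneseriesZl//.
    apply: eq_eseriesr => n _; rewrite muleC fineK ?fin_num_measure//.
    by case: (FE n).
- by move=> B GB; split; [exact: Gm|exact: GE].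
Qed.

(** Independence means that the law of the pair is the product of the laws,
    for which the integral of [x * y] factors by Fubini's theorem. *)
Lemma indep_ExM (U V : T -> R) : bmf U -> bmf V ->
  (forall B C, measurable B -> measurable C -> indep_sets (U @^-1` B) (V @^-1` C)) ->
  \int[P]_w (U w * V w) = \int[P]_w U w * \int[P]_w V w.
Proof.
move=> bU bV iUV.
have [mU _] := bU; have [mV _] := bV.
pose U' : {mfun T >-> R} := mfun_Sub (mem_set mU).
pose V' : {mfun T >-> R} := mfun_Sub (mem_set mV).
have mUV : measurable_fun setT (fun w => (U w, V w)) by exact: measurable_fun_pair.
pose UV : {mfun T >-> (R * R)%type} := mfun_Sub (mem_set mUV).
pose m1 : probability _ R := distribution P U'.
pose m2 : probability _ R := distribution P V'.
pose m12 : probability _ R := distribution P UV.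
have E12 : forall X, measurable X -> (m1 \x m2)%E X = m12 X.
  apply: product_measure_unique => A B mA mB.
  exact: iUV.
pose f (z : R * R) : \bar R := (z.1 * z.2)%:E.
have mf : measurable_fun setT f.
  apply/measurable_EFinP; apply: measurable_funM; [exact: measurable_fst|exact: measurable_snd].
have fUV : f \o UV = EFin \o (fun w => U w * V w) by [].
have iUVf : P.-integrable setT (f \o UV).
  by rewrite fUV; exact: (bmf_integrable P (bmfM bU bV)).
have i12 : m12.-integrable setT f.
  apply/integrableP; split => //.
  rewrite ge0_integral_distribution//; first by case/integrableP : iUVf.
  by apply: measurableT_comp.
have i12' : (m1 \x m2)%E.-integrable setT f.
  apply/integrableP; split => //.
  rewrite (eq_measure_integral m12); first by case/integrableP : i12.
  by move=> A mA _; exact: E12.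
have := integral12_prod_meas1 i12'.
rewrite [RHS](eq_measure_integral m12); last by move=> A mA _; exact: E12.
rewrite (integral_distribution mf iUVf) fUV => h.
rewrite {1}/Rintegral -[X in fine X]h.
have iV : m2.-integrable setT (fun y => y%:E).
  apply/integrableP; split; first by apply/measurable_EFinP.
  rewrite ge0_integral_distribution//; last by apply: measurableT_comp => //; apply/measurable_EFinP.
  by case/integrableP : (bmf_integrable P bV).
have -> : fubini_F m2 f = fun x => (x%:E * (\int[P]_w V w)%:E)%E.
  apply/funext => x; rewrite /fubini_F /f /=.
  under eq_integral do rewrite EFinM.
  rewrite integralZl// (integral_distribution (X:=V'))//; last exact: (bmf_integrable P bV).
  rewrite fineK//; apply: integrable_fin_num => //; exact: (bmf_integrable P bV).
have mM : measurable_fun setT (fun x : R => (x%:E * (\int[P]_w V w)%:E)%E).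
  by apply/measurable_EFinP; apply: measurable_funM.
have UE : (fun x : R => (x%:E * (\int[P]_w V w)%:E)%E) \o U' = EFin \o (fun w => U w * \int[P]_w V w) by [].
have iU := bmf_integrable P (bmfM bU (bmf_cst T (\int[P]_w V w))).
rewrite -UE in iU.
rewrite (integral_distribution mM iU) UE.
rewrite -[fine _]/(\int[P]_w (U w * \int[P]_w V w)).
by under eq_Rintegral do rewrite mulrC; rewrite ExZ// mulrC.
Qed.
End Independence.

(** * The past of a Poisson process *)

Lemma measurable_fun_nat_comp d (T : measurableType d) d' (S : measurableType d')
  (F : nat -> T -> S) (x : T -> nat) :
  (forall k, measurable_fun setT (F k)) -> measurable_fun setT x ->
  measurable_fun setT (fun w => F (x w) w).
Proof.
move=> mF mx _ B mB; rewrite setTI.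
rewrite (_ : _ @^-1` B = \bigcup_k (x @^-1` [set k] `&` F k @^-1` B)).
  apply: bigcupT_measurable => k; apply: measurableI.
    by rewrite -[X in measurable X]setTI; exact: mx.
  by rewrite -[X in measurable X]setTI; exact: mF.
apply/seteqP; split => w /=; first by move=> Bw; exists (x w).
by move=> [k _ [<-]].
Qed.

Section PoissonPast.
Context (R : realType) d (Omega : measurableType d) (P : probability Omega R).
Variable N : R -> {RV P >-> nat}.
Hypothesis hN : standard_poisson_process N.

Definition observation (l : seq (R * nat)) : set Omega :=
  [set w | all (fun p => N p.1 w == p.2) l].

(** The observation times include [t] itself: they then cut [0, t] into
    intervals up to exactly [t], and an event of the past bears on the
    increments over these intervals. *)
Definition past_gen (t : R) : set (set Omega) :=
  [set A | exists l, [/\ all (fun p => 0 <= p.1 <= t) l, t \in map fst l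
    & A = observation l]].

Lemma past_genI t : setI_closed (past_gen t).
Proof.
move=> A B [l [al tl ->]] [l' [al' tl' ->]]; exists (l ++ l'); split.
- by rewrite all_cat al.
- by rewrite map_cat mem_cat tl.
- by apply/seteqP; split => w /=; rewrite /observation /= all_cat => /andP.
Qed.

Lemma measurable_eqN (s : R) k : measurable [set w | N s w == k].
Proof.
rewrite (_ : [set _ | _] = N s @^-1` [set k]).
  by rewrite -[X in measurable X]setTI; exact: measurable_funPT.
by apply/seteqP; split => w /= /eqP.
Qed.

Lemma measurable_observation l : measurable (observation l).
Proof.
elim: l => [|[s k] l IH].
  by rewrite (_ : observation _ = setT)//; apply/seteqP; split.
rewrite (_ : observation _ = [set w | N s w == k] `&` observation l).
  by apply: measurableI => //; exact: measurable_eqN.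
by apply/seteqP; split => w /=; rewrite /observation /= => /andP.
Qed.

Lemma past_gen_measurable t : past_gen t `<=` measurable.
Proof. by move=> A [l [_ _ ->]]; exact: measurable_observation. Qed.

Lemma N_incr s t w : 0 <= s -> s <= t ->
  N t w = (N s w + (N t w - N s w))%N.
Proof. by move=> s0 st; rewrite subnKC//; apply: hN.1.(poisson_nondecreasing). Qed.

Definition jumps (t u : R) (k : nat) : set Omega :=
  [set w | (N u w - N t w)%N = k].

Lemma measurable_jumps (t u : R) k : measurable (jumps t u k).
Proof.
have mf : measurable_fun setT (fun w => (N u w - N t w)%N) by exact: measurable_fun_subn.
rewrite (_ : jumps t u k = (fun w => (N u w - N t w)%N) @^-1` [set k])//.
by rewrite -[X in measurable X]setTI; exact: mf.
Qed.

(** Sorted together with 0, the observation times form a grid from 0 to [t],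
    and the event prescribes the increments over its intervals. Adding [u] to
    the grid gives one more increment, independent of the others. *)
Lemma past_gen_indep (t u : R) k A : 0 <= t -> t <= u -> past_gen t A ->
  indep_sets P A (jumps t u k).
Proof.
move=> t0 tu [l [al tl AE]].
have mA : measurable A by rewrite AE; exact: measurable_observation.
have [->|/set0P[w0 Aw0]] := eqVneq A set0.
  by rewrite /indep_sets set0I !measure0 mul0e.
pose tau := sort <=%R (0 :: map fst l).
have mem_tau x : (x \in tau) = (x \in 0 :: map fst l) by rewrite mem_sort.
have tau_le x : x \in tau -> 0 <= x <= t.
  rewrite mem_tau inE => /orP[/eqP ->|/mapP[p pl ->]]; first by rewrite lexx.
  exact: (allP al).
have taut : t \in tau by rewrite mem_tau inE tl orbT.
have stau : sorted <=%R tau by apply: sort_sorted; exact: le_total.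
have [m sm] : exists m, size tau = m.+1.
  by exists (size l); rewrite size_sort /= size_map.
(* The default value [u] extends the sorted times by [u], so that [T m = t]
   and [T m.+1 = u]. *)
pose T i := nth u tau i.
have Tge i : (size tau <= i)%N -> T i = u by move=> ?; rewrite /T nth_default.
have Tlt i : (i < size tau)%N -> 0 <= T i <= t by move=> il; apply/tau_le/mem_nth.
have T_ge0 i : (i <= m)%N -> 0 <= T i by rewrite -ltnS -sm => /Tlt/andP[].
have T_let i : (i <= m)%N -> T i <= t by rewrite -ltnS -sm => /Tlt/andP[].
have Thomo : {homo T : i j / (i <= j)%N >-> i <= j}.
  move=> i j ij; have [js|js] := ltnP j (size tau).
    by apply: (sorted_leq_nth le_trans le_refl) => //; rewrite inE// (leq_ltn_trans ij).
  rewrite (Tge j)//; have [is_|is_] := ltnP i (size tau); last by rewrite Tge.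
  by case/andP: (Tlt i is_) => _ /le_trans; apply.
have T0 : T 0%N = 0.
  have /(nthP u)[j js j0] : 0 \in tau by rewrite mem_tau inE eqxx.
  apply/eqP; rewrite eq_le; apply/andP; split; last exact: T_ge0.
  by rewrite -[leRHS]j0; exact: Thomo.
have Tm : T m = t.
  have /(nthP u)[j js jt] := taut.
  apply/eqP; rewrite eq_le; apply/andP; split; first exact: T_let.
  by rewrite -[leLHS]jt; apply: Thomo; rewrite -ltnS -sm.
have TS : T m.+1 = u by rewrite Tge// sm.
pose Y i w := (N (T i.+1) w - N (T i) w)%N.
have AY : A = [set w | forall i, (i < m)%N -> Y i w = Y i w0].
  have Aw p w : p \in l -> A w -> N p.1 w = N p.1 w0.
    move=> pl; rewrite AE /observation /= => /allP /(_ _ pl) /eqP ->.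
    by move: Aw0; rewrite AE /observation /= => /allP /(_ _ pl) /eqP ->.
  apply/seteqP; split => [w Aw1 i im|w /= Yw].
    have NT j : (j <= m)%N -> N (T j) w = N (T j) w0.
      move=> jm; have : T j \in tau by apply: mem_nth; rewrite sm ltnS.
      rewrite mem_tau inE => /orP[/eqP ->|/mapP[p pl ->]]; first by rewrite !hN.2.
      exact: Aw.
    by rewrite /Y !NT// ltnW.
  have NT j : (j <= m)%N -> N (T j) w = N (T j) w0.
    elim: j => [|j IH] jm; first by rewrite T0 !hN.2.
    have Tj0 := T_ge0 j (ltnW jm).
    have Tjj : T j <= T j.+1 by exact: Thomo.
    rewrite (N_incr w Tj0 Tjj) (N_incr w0 Tj0 Tjj).
    by have := Yw j jm; rewrite /Y IH 1?ltnW// => ->.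
  rewrite AE /observation /=; apply/allP => p pl.
  have : p.1 \in tau by rewrite mem_tau inE map_f ?orbT.
  move=> /(nthP u)[j js jp]; rewrite -jp -/(T j) NT; last by rewrite -ltnS -sm.
  rewrite /T jp; move: Aw0; rewrite AE /observation /= => /allP; exact.
have mY i : measurable_fun setT (Y i) by exact: measurable_fun_subn.
have T00 : 0 <= T 0%N by rewrite T0.
have fam := poisson_indep_increments hN.1 (n := m.+1) T00 Thomo.
pose B0 (i : 'I_m.+1) : set nat := if (i < m)%N then [set Y i w0] else setT.
pose Bk (i : 'I_m.+1) : set nat := if (i < m)%N then [set Y i w0] else [set k].
have mB0 (i : 'I_m.+1) : measurable (B0 i) by [].
have mBk (i : 'I_m.+1) : measurable (Bk i) by [].
have := fam B0 mB0; have := fam Bk mBk.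
rewrite (_ : \bigcap_i _ = A `&` jumps t u k); last first.
  apply/seteqP; split => w; rewrite AY.
    move=> h; split => [i im|].
      by have := h (widen_ord (leqnSn m) (Ordinal im)) I; rewrite /Bk /= im.
    by have := h ord_max I; rewrite /Bk /= ltnn Tm TS.
  move=> [h1 h2] i _; rewrite /Bk; case: ifPn => im; first exact: h1.
  have -> : nat_of_ord i = m by apply/eqP; rewrite eqn_leq -ltnS ltn_ord leqNgt.
  by rewrite /= Tm TS.
rewrite (_ : \bigcap_i _ = A); last first.
  apply/seteqP; split => w; rewrite AY.
    move=> h i im.
    by have := h (widen_ord (leqnSn m) (Ordinal im)) I; rewrite /B0 /= im.
  by move=> h1 i _; rewrite /B0; case: ifPn => im; first exact: h1.
rewrite !big_ord_recr /=.
rewrite /B0 /Bk /= ltnn preimage_setT probability_setT mulr1.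
under eq_bigr do rewrite ltn_ord.
move=> h1; under eq_bigr do rewrite ltn_ord.
move=> h2; rewrite -{}h2 in h1.
have mJ := measurable_jumps t u k.
rewrite /indep_sets -(fineK (fin_num_measure P _ mA)) -(fineK (fin_num_measure P _ mJ)).
rewrite -EFinM -(fineK (fin_num_measure P _ (measurableI _ _ mA mJ))) h1.
by congr (_ * fine (P _))%:E; apply/seteqP; split => w; rewrite /jumps /= Tm TS.
Qed.

(** Measurability for the natural filtration of the Poisson process. *)
Definition past_measurable d' (S : measurableType d') (t : R) (F : Omega -> S) :=
  measurable_fun setT (F : g_sigma_algebraType (past_gen t) -> S).

Lemma past_measurableW d' (S : measurableType d') t (F : Omega -> S) :
  past_measurable t F -> measurable_fun setT F.
Proof.
move=> pF _ B mB; have := pF measurableT B mB; rewrite !setTI => h.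
have : <<s past_gen t >> `<=` (@measurable _ Omega).
  apply: smallest_sub; [exact: sigma_algebra_measurable|exact: past_gen_measurable].
exact.
Qed.

Lemma past_measurable_N (s t : R) : 0 <= s -> s <= t -> past_measurable t (N s : Omega -> nat).
Proof.
move=> s0 st _ B _; rewrite setTI.
rewrite (_ : _ @^-1` B = \bigcup_(k in B) \bigcup_m observation [:: (s, k); (t, m)]).
  apply: bigcup_measurable => k _; apply: bigcup_measurable => m _.
  apply: sub_sigma_algebra; exists [:: (s, k); (t, m)]; split => //=.
  - by rewrite s0 st lexx (le_trans s0 st).
  - by rewrite !inE eqxx orbT.
apply/seteqP; split => w /=.
  by move=> Bw; exists (N s w) => //; exists (N t w) => //; rewrite /observation /= !eqxx.
by move=> [k Bk [m _]]; rewrite /observation /= => /andP[/eqP -> _].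
Qed.

(** A generator of the past of [s] need not observe time [t]; it is the
    countable union, over the values at [t], of generators of the past of
    [t]. *)
Lemma past_measurable_mono d' (S : measurableType d') (s t : R) (F : Omega -> S) :
  s <= t -> past_measurable s F -> past_measurable t F.
Proof.
move=> st pF _ B mB; have := pF measurableT B mB; rewrite !setTI.
apply: (smallest_sub (X := <<s past_gen t >>)); first exact: smallest_sigma_algebra.
move=> A [l [al sl ->]].
rewrite (_ : observation l = \bigcup_m observation ((t, m) :: l)).
  have [_ _ bU] := smallest_sigma_algebra setT (past_gen t).
  apply: bU => m; apply: sub_sigma_algebra; exists ((t, m) :: l); split => //=.
  - have [p pl ps] := mapP sl.
    have s0 : 0 <= s by rewrite ps; case/andP: (allP al p pl).
    rewrite lexx (le_trans s0 st)/=; apply: sub_all al => q /andP[-> /= qs].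
    exact: le_trans qs st.
  - by rewrite inE eqxx.
apply/seteqP; split => w /=.
  by move=> lw; exists (N t w) => //; rewrite /observation /= eqxx.
by move=> [m _]; rewrite /observation /= => /andP[].
Qed.

Lemma past_event_indep (s u : R) k (B : set R) (F : Omega -> R) : 0 <= s -> s <= u ->
  past_measurable s F -> measurable B -> indep_sets P (F @^-1` B) (jumps s u k).
Proof.
move=> s0 su pF mB; have := pF measurableT B mB; rewrite setTI.
apply: indep_sigma.
- exact: past_genI.
- exact: past_gen_measurable.
- exact: measurable_jumps.
- by move=> A; exact: past_gen_indep.
Qed.

Lemma Ex_past_jumps (s u : R) k (F : Omega -> R) : 0 <= s -> s < u ->
  past_measurable s F -> bmf F ->
  \int[P]_w (F w * \1_(jumps s u k) w) = \int[P]_w F w * poisson_pmf (u - s) k.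
Proof.
move=> s0 su pF bF; have mJ := measurable_jumps s u k.
rewrite indep_ExM//; last 2 first.
- exact: bmf_indic.
- move=> B C mB mC; rewrite preimage_indic.
  have mFB : measurable (F @^-1` B) by rewrite -[X in measurable X]setTI; exact: bF.1.
  have iJ := past_event_indep k s0 (ltW su) pF mB.
  case: ifPn => _; case: ifPn => _.
  + by rewrite /indep_sets setIT probability_setT mule1.
  + exact: iJ.
  + rewrite /indep_sets -setDE measureD//; last by rewrite ltey_eq fin_num_measure.
    rewrite probability_setC// muleBr ?fin_num_measure// mule1; congr (_ - _)%E; exact: iJ.
  + by rewrite /indep_sets setI0 measure0 mule0.
congr (_ * _); rewrite Ex_indic//.
by rewrite [P _](hN.1.(poisson_law) _ s0 su)/= mul1r.
Qed.

(** Over a time [h = u - s] there is no jump with probability [1 - h] and one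
    jump with probability [h], each up to [h ^+ 2], and more with probability
    at most [h ^+ 2]: hence three errors of size [M * h ^+ 2]. *)
Lemma Ex_poisson_step (s u M : R) (F : nat -> Omega -> R) : 0 <= s -> s < u ->
  (forall k, past_measurable s (F k)) -> (forall k w, `|F k w| <= M) ->
  `|\int[P]_w (F (N u w - N s w)%N w) -
     ((1 - (u - s)) * \int[P]_w F 0%N w + (u - s) * \int[P]_w F 1%N w)|
  <= 3 * M * (u - s) ^+ 2.
Proof.
move=> s0 su pF FM.
have M0 : 0 <= M by apply: le_trans (FM 0%N point).
have bF k : bmf (F k) by split; [exact: past_measurableW (pF k)|exists M].
pose x w := (N u w - N s w)%N.
have mx : measurable_fun setT (fun w => F (x w) w).
  apply: measurable_fun_nat_comp; first by move=> k; exact: (bF k).1.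
  exact: measurable_fun_subn.
have bx : bmf (fun w => F (x w) w) by split => //; exists M.
pose J k : Omega -> R := \1_(jumps s u k).
have bJ k : bmf (J k) by apply: bmf_indic; exact: measurable_jumps.
have JE k w : J k w = (x w == k)%:R.
  by rewrite /J indicE; congr (_ %:R); congr nat_of_bool; apply/idP/eqP; rewrite inE.
pose Z w := 1 - J 0%N w - J 1%N w.
have bZ : bmf Z by apply: bmfB => //; apply: bmfB => //; exact: bmf_cst.
have Z0 w : 0 <= Z w by rewrite /Z !JE; case: (x w) => [|[|?]] /=; lra.
have FE w : F (x w) w = F 0%N w * J 0%N w + F 1%N w * J 1%N w + F (x w) w * Z w.
  by rewrite /Z !JE; case: (x w) => [|[|?]] /=; ring.
have EJ k : \int[P]_w J k w = poisson_pmf (u - s) k.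
  have := Ex_past_jumps k s0 su (past_measurable_mono (lexx s) (measurable_cst (1:R))) (bmf_cst _ 1).
  by rewrite Ex_cst mul1r; under eq_Rintegral do rewrite mul1r.
under eq_Rintegral do rewrite FE.
have bFJ k : bmf (fun w => F k w * J k w) by exact: bmfM.
have bFZ : bmf (fun w => F (x w) w * Z w) by exact: bmfM.
rewrite ExD//; last exact: bmfD.
rewrite ExD// !Ex_past_jumps//.
set h := u - s; set a := \int[P]_w F 0%N w; set b := \int[P]_w F 1%N w.
have h0 : 0 < h by rewrite subr_gt0.
have p0 : poisson_pmf h 0 = expR (- h) by rewrite /poisson_pmf h0 expr0 fact0 invr1 !mul1r.
have p1 : poisson_pmf h 1 = h * expR (- h) by rewrite /poisson_pmf h0 expr1 invr1 mulr1.
have aM : `|a| <= M by apply: le_norm_Ex.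
have bM : `|b| <= M by apply: le_norm_Ex.
have e1 : 1 - h <= expR (- h) by apply: expR_ge1Dx.
have e2 : expR (- h) * (1 + h) <= 1.
  by rewrite expRN mulrC ler_pdivrMr ?expR_gt0// mul1r expR_ge1Dx.
have EZ : \int[P]_w Z w <= h ^+ 2.
  rewrite ExB//; last by apply: bmfB => //; exact: bmf_cst.
  rewrite ExB//; last exact: bmf_cst.
  by rewrite Ex_cst !EJ p0 p1; nra.
have ER : `|\int[P]_w (F (x w) w * Z w)| <= M * h ^+ 2.
  apply: le_trans (le_normr_Rintegral _ (bmf_integrable P bFZ)) _ => //.
  apply: le_trans (ler_wpM2l M0 EZ); rewrite -ExZ//.
  apply: le_Ex; [exact: bmf_abs|exact: bmfZ|move=> w].
  by rewrite normrM (ger0_norm (Z0 w)) ler_wpM2r.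
rewrite p0 p1; set c := \int[P]_w (F (x w) w * Z w) in ER *.
set e := expR (- h) in e1 e2 *.
have -> : a * e + b * (h * e) + c - ((1 - h) * a + h * b) = a * (e - (1 - h)) + b * (h * (e - 1)) + c by ring.
have -> : 3 * M * h ^+ 2 = M * h ^+ 2 + M * h ^+ 2 + M * h ^+ 2 by ring.
have e3 : e <= 1 by rewrite /e -expR0 ler_expR oppr_le0 ltW.
apply: le_trans (ler_normD _ _) (lerD _ ER).
apply: le_trans (ler_normD _ _) (lerD _ _).
  rewrite normrM ler_pM//= ger0_norm; nra.
rewrite normrM; apply: ler_pM => //.
by rewrite ler_norml; apply/andP; split; nra.
Qed.

End PoissonPast.

(** * Riemann sums *)

Section RiemannSums.
Context (R : realType).
Notation mu := (@lebesgue_measure R).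

Lemma Rintegral_sum_int d (T : measurableType d) (m : {measure set T -> \bar R}) (D : set T)
   (I : Type) (s : seq I) (F : I -> T -> R) : measurable D ->
  (forall i, m.-integrable D (EFin \o F i)) ->
  m.-integrable D (EFin \o (fun x => \sum_(i <- s) F i x)) /\
  \int[m]_(x in D) (\sum_(i <- s) F i x) = \sum_(i <- s) \int[m]_(x in D) F i x.
Proof.
move=> mD iF; elim: s => [|i s [IH1 IH2]].
  split.
    apply: (eq_integrable mD (cst 0%E)); last exact: integrable0.
    by move=> x _ /=; rewrite big_nil.
  transitivity (\int[m]_(x in D) (0 : R)); first by apply: eq_Rintegral => x _; rewrite big_nil.
  by rewrite big_nil Rintegral_cst// mul0r.
have E : EFin \o (fun x => \sum_(j <- i :: s) F j x) = (EFin \o F i) \+ (EFin \o (fun x => \sum_(j <- s) F j x)).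
  by apply/funext => x /=; rewrite big_cons.
split; first by rewrite E; exact: integrableD.
rewrite big_cons -IH2 -RintegralD//.
by apply: eq_Rintegral => x _; rewrite big_cons.
Qed.

Definition gridpt (a b : R) (n j : nat) : R := a + j%:R * ((b - a) / n.+1%:R).

Lemma gridpt_lt a b n : a < b -> {homo gridpt a b n : i j / (i < j)%N >-> i < j}.
Proof.
move=> ab i j ij; rewrite ltrD2l ltr_pM2r ?ltr_nat//.
by rewrite divr_gt0 ?subr_gt0.
Qed.

Lemma gridptS a b n j : gridpt a b n j.+1 = gridpt a b n j + (b - a) / n.+1%:R.
Proof. by rewrite /gridpt -natr1 mulrDl mul1r addrA. Qed.

Lemma gridpt0 a b n : gridpt a b n 0 = a.
Proof. by rewrite /gridpt mul0r addr0. Qed.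

Lemma gridpt_last a b n : gridpt a b n n.+1 = b.
Proof. by rewrite /gridpt mulrC divfK ?pnatr_eq0// addrC subrK. Qed.

Definition cell (a b : R) n j : set R := `[gridpt a b n j, gridpt a b n j.+1[.

Lemma cellP a b n s : a < b -> a <= s < b ->
  exists j : 'I_n.+1, forall i : 'I_n.+1, cell a b n i s <-> i = j.
Proof.
move=> ab /andP[a_s sb]; set dl := (b - a) / n.+1%:R.
have dl0 : 0 < dl by rewrite divr_gt0 ?subr_gt0.
have q0 : 0 <= (s - a) / dl by rewrite divr_ge0 ?subr_ge0// ltW.
have /andP[k1 k2] := truncn_itv q0; set k := Num.truncn _ in k1 k2.
have kn : (k < n.+1)%N.
  rewrite -(ltr_nat R); apply: le_lt_trans k1 _.
  rewrite ltr_pdivrMr// /dl mulrCA divff ?pnatr_eq0// mulr1.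
  by rewrite ltrD2r.
exists (Ordinal kn) => i; rewrite /cell /= in_itv/=.
have mono := gridpt_lt n ab.
have sk : gridpt a b n k <= s < gridpt a b n k.+1.
  rewrite /gridpt -/dl -lerBrDl -ltrBlDl.
  by rewrite -ler_pdivlMr// k1 -ltr_pdivrMr.
split=> [/andP[i1 i2]|->]; last by [].
case/andP: sk => s1 s2; apply: val_inj => /=; apply/eqP; rewrite eqn_leq.
apply/andP; split; rewrite leqNgt; apply/negP => lt.
- have : gridpt a b n k.+1 <= gridpt a b n i.
    by move: lt; rewrite leq_eqVlt => /predU1P[->//|/mono/ltW].
  by move=> h; have := lt_le_trans s2 (le_trans h i1); rewrite ltxx.
- have : gridpt a b n i.+1 <= gridpt a b n k.
    by move: lt; rewrite leq_eqVlt => /predU1P[->//|/mono/ltW].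
  by move=> h; have := lt_le_trans i2 (le_trans h s1); rewrite ltxx.
Qed.

Lemma cell_sub a b n j : a < b -> (j < n.+1)%N -> cell a b n j `<=` `[a, b[.
Proof.
move=> ab jn x; rewrite /cell /= !in_itv/= => /andP[x1 x2].
have mono := gridpt_lt n ab.
apply/andP; split.
  apply: le_trans x1; rewrite -[leLHS](gridpt0 a b n).
  by case: j {jn x2} => // j; exact/ltW/mono.
apply: lt_le_trans x2 _; rewrite -[leRHS](gridpt_last a b n).
by move: jn; rewrite leq_eqVlt => /predU1P[[->]//|/mono/ltW].
Qed.

Lemma measurable_cell a b n j : measurable (cell a b n j).
Proof. exact: measurable_itv. Qed.

(** [f] enters through its exact integrals over the cells, so it need only be
    integrable; [Y] is taken at right end points because the paths to be
    sampled are right-continuous. *)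
Definition riemann_sum (a b : R) (f Y : R -> R) n :=
  \sum_(j < n.+1) (\int[mu]_(x in cell a b n j) f x) * Y (gridpt a b n j.+1).

Lemma cells_integral (a b : R) (f : R -> R) n (c : nat -> R) : a < b ->
  mu.-integrable `[a, b[ (EFin \o f) ->
  \sum_(j < n.+1) (\int[mu]_(x in cell a b n j) f x) * c j =
  \int[mu]_(s in `[a, b[) (f s * \sum_(j < n.+1) \1_(cell a b n j) s * c j).
Proof.
move=> ab fi.
have mD : measurable (`[a, b[%classic : set R) by exact: measurable_itv.
have mf : measurable_fun `[a, b[ f by case/integrableP : fi => /measurable_EFinP.
pose F (j : 'I_n.+1) s := c j * (f s * \1_(cell a b n j) s).
have iF (j : 'I_n.+1) : mu.-integrable `[a, b[ (EFin \o (fun s => f s * \1_(cell a b n j) s)).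
  apply: le_integrable fi => //.
    apply/measurable_EFinP; apply: measurable_funM => //.
    by apply: measurable_funTS; apply: measurable_indic; exact: measurable_cell.
  move=> s _ /=; rewrite lee_fin normrM indicE ler_piMr//.
  by case: (_ \in _); rewrite ?normr1 ?normr0.
transitivity (\int[mu]_(s in `[a, b[) \sum_(j < n.+1) F j s); last first.
  apply: eq_Rintegral => s _; rewrite mulr_sumr; apply: eq_bigr => j _.
  by rewrite /F mulrCA [_ * c j]mulrC.
have iF2 (j : 'I_n.+1) : mu.-integrable `[a, b[ (EFin \o F j).
  rewrite (_ : EFin \o F j = (fun s => (c j)%:E * ((f s * \1_(cell a b n j) s)%R)%:E)%E)//.
  by apply: integrableZl => //; exact: iF.
have [] := @Rintegral_sum_int _ _ mu `[a, b[ 'I_n.+1 (index_enum _) F.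
- exact: mD.
- exact: iF2.
move=> _ ->.
apply: eq_bigr => j _; rewrite /F [RHS]RintegralZl//.
rewrite mulrC; congr (_ * _).
transitivity (\int[mu]_(x in `[a, b[ `&` cell a b n j) f x).
  by rewrite setIidr//; exact: cell_sub.
rewrite Rintegral_mkcondr; apply: eq_Rintegral => s _.
by rewrite patchE indicE; case: ifPn => _; rewrite ?mulr1 ?mulr0.
Qed.

Lemma sum_cells (a b : R) (f : R -> R) n : a < b ->
  mu.-integrable `[a, b[ (EFin \o f) ->
  \sum_(j < n.+1) (\int[mu]_(x in cell a b n j) f x) = \int[mu]_(s in `[a, b[) f s.
Proof.
move=> ab fi; have := @cells_integral a b f n (fun=> 1) ab fi.
under eq_bigr do rewrite mulr1; move=> ->.
apply: eq_Rintegral => s; rewrite inE /= in_itv/= => asb.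
have [j Hj] := cellP n ab asb.
have sj : cell a b n j s by exact/Hj.
rewrite (bigD1 j)//= indicE mem_set// mul1r big1 ?addr0 ?mulr1// => i ij.
by rewrite indicE memNset ?mul0r// => /Hj E; rewrite E eqxx in ij.
Qed.

(** The Cauchy-Schwarz inequality against a constant: the integral of the
    square of [f] minus its mean is nonnegative. *)
Lemma sqr_Rintegral_le (D : set R) (f : R -> R) : measurable D ->
  (0 < mu D < +oo)%E -> mu.-integrable D (EFin \o f) ->
  mu.-integrable D (EFin \o (fun x => f x ^+ 2)) ->
  (\int[mu]_(x in D) f x) ^+ 2 <= fine (mu D) * \int[mu]_(x in D) (f x ^+ 2).
Proof.
move=> mD /andP[D0 Dy] fi f2i.
have dD : mu D = (fine (mu D))%:E by rewrite fineK// ge0_fin_numE// ltW.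
set dl := fine (mu D) in dD *.
have dl0 : 0 < dl by rewrite -lte_fin -dD.
set I := \int[mu]_(x in D) f x.
have ci (c : R) : mu.-integrable D (EFin \o cst c).
  apply: measurable_bounded_integrable => //; exists `|c|; split; first exact: num_real.
  by move=> x cx y _ /=; exact: ltW.
have : 0 <= \int[mu]_(x in D) (f x ^+ 2 + ((- 2 * I / dl) * f x + (I / dl) ^+ 2)).
  apply: Rintegral_ge0 => x _; rewrite (_ : _ + _ = (f x - I / dl) ^+ 2) ?sqr_ge0//.
  by ring.
have i1 : mu.-integrable D (EFin \o (fun x => (- 2 * I / dl) * f x)).
  by rewrite (_ : EFin \o _ = (fun x => (- 2 * I / dl)%:E * (f x)%:E)%E)//; exact: integrableZl.
rewrite RintegralD//; last first.
  rewrite (_ : EFin \o _ = (EFin \o (fun x => (- 2 * I / dl) * f x)) \+ (EFin \o cst ((I / dl) ^+ 2)))//.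
  by apply: integrableD.
rewrite [X in _ + X]RintegralD//; last exact: ci.
have -> : \int[mu]_(x in D) (- 2 * I / dl * f x) = - 2 * I / dl * I by exact: RintegralZl.
rewrite Rintegral_cst// -/dl.
set J := \int[mu]_(x in D) _.
have -> : J + (- 2 * I / dl * I + (I / dl) ^+ 2 * dl) = J - I ^+ 2 / dl by field; rewrite gt_eqF.
by rewrite subr_ge0 ler_pdivrMr// mulrC.
Qed.

(** The sum is the integral of [f] against the function equal on each cell to
    the value of [Y] at its right end. Right continuity makes these functions
    converge pointwise, and dominated convergence applies. *)
Lemma riemann_sum_cvg (a b M : R) (f Y : R -> R) : a < b ->
  mu.-integrable `[a, b] (EFin \o f) -> (forall t, `|Y t| <= M) ->
  (forall t, a <= t < b -> Y s @[s --> t^'+] --> Y t) ->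
  mu.-integrable `[a, b] (EFin \o (fun s => f s * Y s)) /\
  riemann_sum a b f Y n @[n --> \oo] --> \int[mu]_(s in `[a, b]) (f s * Y s).
Proof.
move=> ab fi YM Yr.
pose Yn n s := \sum_(j < n.+1) \1_(cell a b n j) s * Y (gridpt a b n j.+1).
have mD : measurable (`[a, b[%classic : set R) by exact: measurable_itv.
have fi' : mu.-integrable `[a, b[ (EFin \o f).
  apply: integrableS fi => //.
  by move=> x /=; rewrite !in_itv/= => /andP[-> /ltW].
have fm : measurable_fun `[a, b[ f by case/integrableP : fi' => /measurable_EFinP.
have Yncvg s : `[a, b[%classic s -> Yn n s @[n --> \oo] --> Y s.
  rewrite /= in_itv/= => asb; apply/cvgrPdist_lt => e e0.
  have /cvgrPdist_lt/(_ e e0) := Yr s asb.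
  move=> -[eta /= eta0 He].
  have : (b - a) / n.+1%:R @[n --> \oo] --> (b - a) * 0.
    by apply: cvgMr; exact: cvg_harmonic.
  rewrite mulr0 => /cvgrPdist_lt/(_ eta eta0); apply: filterS => n.
  rewrite sub0r normrN ger0_norm; last by rewrite divr_ge0 ?subr_ge0 ?ltW.
  move=> dle.
  have [j Hj] := cellP n ab asb.
  have sj : cell a b n j s by exact/Hj.
  have -> : Yn n s = Y (gridpt a b n j.+1).
    rewrite /Yn (bigD1 j)//= indicE mem_set// mul1r big1 ?addr0// => i ij.
    rewrite indicE memNset ?mul0r//.
    by move/Hj => E; rewrite E eqxx in ij.
  move: sj; rewrite /cell /= in_itv/= => /andP[s1 s2].
  apply: He => //=.
  rewrite ltr0_norm ?subr_lt0// opprB.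
  apply: le_lt_trans dle; by rewrite gridptS addrAC -[leRHS]add0r lerD2r subr_le0.
have Ynb n s : `[a, b[%classic s -> `|Yn n s| <= M.
  rewrite /= in_itv/= => asb; have [j Hj] := cellP n ab asb.
  have sj : cell a b n j s by exact/Hj.
  rewrite /Yn (bigD1 j)//= indicE mem_set// mul1r big1 ?addr0// => i ij.
  by rewrite indicE memNset ?mul0r// => /Hj E; rewrite E eqxx in ij.
have mYn n : measurable_fun `[a, b[ (Yn n).
  apply: measurable_sum => j; apply: measurable_funM => //.
  by apply: measurable_funTS; apply: measurable_indic; exact: measurable_cell.
have mY : measurable_fun `[a, b[ Y by exact: (measurable_fun_cvg mYn Yncvg).
have M0 : 0 <= M by exact: le_trans (YM 0).
have gi : mu.-integrable `[a, b[ (fun s => (M * `|f s|)%:E).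
  rewrite (_ : (fun s => _) = (fun s => M%:E * (`|f s|)%:E)%E)//.
  apply: integrableZl => //.
  exact: (integrable_norm fi').
have fYi : mu.-integrable `[a, b[ (EFin \o (fun s => f s * Y s)).
  apply: le_integrable gi => //.
    by apply/measurable_EFinP; exact: measurable_funM.
  move=> s _ /=; rewrite lee_fin normrM (ger0_norm (mulr_ge0 _ _))// mulrC.
  exact: ler_wpM2r.
have fYic : mu.-integrable `[a, b] (EFin \o (fun s => f s * Y s)).
  apply/integrableP; split.
    apply/measurable_EFinP/measurable_fun_itv_bndo_bndcP.
    by case/integrableP : fYi => /measurable_EFinP.
  case/integrableP : fYi => mf; rewrite integral_itv_bndo_bndc//.
  by apply/measurable_EFinP; apply: measurableT_comp => //; exact/measurable_EFinP.
split=> //.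
rewrite -Rintegral_itv_bndo_bndc//.
have RE n : riemann_sum a b f Y n = \int[mu]_(s in `[a, b[) (f s * Yn n s).
  by rewrite /riemann_sum (@cells_integral a b f n (fun j => Y (gridpt a b n j.+1))).
apply: cvg_trans (_ : \int[mu]_(s in `[a, b[) (f s * Yn n s) @[n --> \oo] --> _).
  by apply: near_eq_cvg; apply: nearW => n /=; rewrite RE.
apply: fine_cvg; rewrite fineK; last exact: integrable_fin_num.
apply: (@dominated_cvg _ _ _ mu `[a, b[ _ _ _ (fun s => (M * `|f s|)%:E)) => //=.
- by move=> n; apply/measurable_EFinP; apply: measurable_funM; [exact: fm|exact: mYn].
- move=> s abs; apply: cvg_EFin; first exact: nearW.
  by apply: cvgMr; exact: Yncvg.
- move=> n s abs; rewrite lee_fin normrM mulrC ler_wpM2r//; exact: Ynb.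
Qed.

End RiemannSums.

(** * Perturbed test functions *)

Section TrigBounds.
Context (R : realType).
Implicit Types a b x y d : R.

Lemma MVT_all (f df : R -> R) a b : (forall x, is_derive x 1 f (df x)) ->
  exists2 c, `|c - a| <= `|b - a| & f b - f a = df c * (b - a).
Proof.
move=> fdf.
have cf : continuous f.
  by move=> x; apply/differentiable_continuous/derivable1_diffP; case: (fdf x).
have [ab|ba] := leP a b.
  have [c] := @MVT_segment R f df a b ab (fun x _ => fdf x) (continuous_subspaceT cf).
  rewrite in_itv/= => /andP[ac cb] E; exists c => //.
  by rewrite !ger0_norm ?subr_ge0// lerD2r.
have [c] := @MVT_segment R f df b a (ltW ba) (fun x _ => fdf x) (continuous_subspaceT cf).
rewrite in_itv/= => /andP[bc ca] E; exists c.
  by rewrite !ler0_norm ?subr_le0 ?(ltW ba)// lerN2 lerD2r.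
by rewrite -opprB E -mulrN opprB.
Qed.

Lemma cos_lip a b : `|cos b - cos a| <= `|b - a|.
Proof.
have [c _ ->] := @MVT_all cos (fun x => - sin x) a b (@is_derive_cos R).
by rewrite normrM -[leRHS]mul1r ler_wpM2r// normrN sin_max.
Qed.

Lemma sin_lip a b : `|sin b - sin a| <= `|b - a|.
Proof.
have [c _ ->] := @MVT_all sin cos a b (@is_derive_sin R).
by rewrite normrM -[leRHS]mul1r ler_wpM2r// cos_max.
Qed.

Lemma cos_taylor a d : `|cos (a + d) - cos a + d * sin a| <= d ^+ 2.
Proof.
have [c cd E] := @MVT_all cos (fun x => - sin x) a (a + d) (@is_derive_cos R).
rewrite addrAC subrr add0r in cd E; rewrite {}E.
rewrite (_ : _ + _ = d * (sin a - sin c)); last by ring.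
rewrite normrM -[leRHS]real_normK ?num_real// expr2 ler_wpM2l//.
by apply: le_trans (sin_lip _ _) _; rewrite distrC.
Qed.

Lemma sin_taylor a d : `|sin (a + d) - sin a - d * cos a| <= d ^+ 2.
Proof.
have [c cd E] := @MVT_all sin cos a (a + d) (@is_derive_sin R).
rewrite addrAC subrr add0r in cd E; rewrite {}E.
rewrite (_ : _ - _ = d * (cos c - cos a)); last by ring.
rewrite normrM -[leRHS]real_normK ?num_real// expr2 ler_wpM2l//.
exact: le_trans (cos_lip _ _) _.
Qed.

End TrigBounds.

Section Correctors.
Context (R : realType).
Variable theta : R.
Hypothesis ct1 : cos theta != 1.
Hypothesis ct2 : cos (theta *+ 2) != 1.

(** [ccos al] and [csin al] are the real and imaginary parts of exp(i x) / (1
    - exp(i al)), as 1 / (1 - exp(i al)) = (1 + i cot(al / 2)) / 2. They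
    solve g(x + al) - g(x) = - cos x and - sin x: see [ccosD] and [csinD]. *)
Definition ccot (al : R) := sin al / (1 - cos al).
Definition ccos (al x : R) := (cos x - ccot al * sin x) / 2.
Definition csin (al x : R) := (sin x + ccot al * cos x) / 2.

Lemma ccotE al : cos al != 1 ->
  ccot al * (1 - cos al) = sin al /\ ccot al * sin al = 1 + cos al.
Proof.
move=> c1; have c0 : 1 - cos al != 0 by rewrite subr_eq0 eq_sym.
split; first by rewrite /ccot divfK.
rewrite /ccot mulrAC -expr2; apply: (mulIf c0); rewrite divfK//.
by have := cos2Dsin2 al; set c := cos al; set s := sin al => cs; nra.
Qed.

Lemma ccosD al x : cos al != 1 -> ccos al (x + al) - ccos al x = - cos x.
Proof.
move=> /ccotE[]; rewrite /ccos cosD sinD; set k := ccot al.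
set c := cos al; set s := sin al; set X := cos x; set Y := sin x => e1 e2.
have -> : (X * c - Y * s - k * (Y * c + X * s)) / 2 - (X - k * Y) / 2 =
  (X * (c - 1) - Y * s + Y * (k * (1 - c)) - X * (k * s)) / 2 by field.
by rewrite e1 e2; field.
Qed.

Lemma csinD al x : cos al != 1 -> csin al (x + al) - csin al x = - sin x.
Proof.
move=> /ccotE[]; rewrite /csin cosD sinD; set k := ccot al.
set c := cos al; set s := sin al; set X := cos x; set Y := sin x => e1 e2.
have -> : (Y * c + X * s + k * (X * c - Y * s)) / 2 - (Y + k * X) / 2 =
  (Y * (c - 1) + X * s - X * (k * (1 - c)) - Y * (k * s)) / 2 by field.
by rewrite e1 e2; field.
Qed.

Variables (a b : R).
Let k1 := ccot theta.
(** [corr1] compensates the observable [lobs], and [corr2] the product [lobs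
    * corr1] minus its mean [rate]. This product has frequency 2 theta, with
    Fourier coefficients [u] and [w]. *)
Definition lobs x := a * cos x + b * sin x.
Definition corr1 x := a * ccos theta x + b * csin theta x.
Let u := (a ^+ 2 - b ^+ 2 + 2 * a * b * k1) / 4.
Let w := (2 * a * b + k1 * (b ^+ 2 - a ^+ 2)) / 4.
Definition corr2 x := - (u * ccos (theta *+ 2) (x *+ 2) + w * csin (theta *+ 2) (x *+ 2)).
Definition rate := (a ^+ 2 + b ^+ 2) / 4.

Lemma corr1D x : corr1 (x + theta) = corr1 x - lobs x.
Proof.
rewrite /corr1 /lobs; have := ccosD x ct1; have := csinD x ct1.
set A := ccos _ (x + _); set B := csin _ (x + _) => e1 e2.
have -> : A = ccos theta x - cos x by rewrite -e2; ring.
have -> : B = csin theta x - sin x by rewrite -e1; ring.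
by ring.
Qed.

Lemma corr2D x : corr2 (x + theta) = corr2 x + lobs x * corr1 x - rate.
Proof.
rewrite /corr2 mulrnDl.
have := ccosD (x *+ 2) ct2; have := csinD (x *+ 2) ct2.
set A := ccos _ (_ + _); set B := csin _ (_ + _) => e1 e2.
have -> : A = ccos (theta *+ 2) (x *+ 2) - cos (x *+ 2) by rewrite -e2; ring.
have -> : B = csin (theta *+ 2) (x *+ 2) - sin (x *+ 2) by rewrite -e1; ring.
have -> : cos (x *+ 2) = cos x ^+ 2 - sin x ^+ 2 by rewrite mulr2n cosD.
have -> : sin (x *+ 2) = 2 * (cos x * sin x) by rewrite mulr2n sinD; ring.
have -> : rate = rate * (cos x ^+ 2 + sin x ^+ 2) by rewrite cos2Dsin2 mulr1.
by rewrite /lobs /corr1 /rate /u /w /ccos /csin -/k1; field.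
Qed.

(** A common bound of [lobs], [corr1], [corr2] and [rate]; as it is at least
    1, lower powers of it are bounded by higher ones in the error estimates.
    *)
Definition bound_const := 1 + rate + (`|a| + `|b|) * (1 + `|k1|) +
  (`|u| + `|w|) * (1 + `|ccot (theta *+ 2)|).

Lemma bound_const_ge1 : 1 <= bound_const.
Proof.
rewrite /bound_const -!addrA lerDl !addr_ge0// ?mulr_ge0 ?addr_ge0//.
all: by rewrite sqr_ge0.
Qed.

Lemma norm_ccos al x : `|ccos al x| <= 1 + `|ccot al|.
Proof.
rewrite /ccos normrM; apply: le_trans (_ : (1 + `|ccot al|) * 1 <= _); last by rewrite mulr1.
apply: ler_pM => //; last by rewrite normfV ger0_norm// invf_le1 ?ler1n.
apply: le_trans (ler_normB _ _) _; rewrite normrM lerD ?cos_max//.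
by rewrite -[leRHS]mulr1 ler_wpM2l// sin_max.
Qed.

Lemma norm_csin al x : `|csin al x| <= 1 + `|ccot al|.
Proof.
rewrite /csin normrM; apply: le_trans (_ : (1 + `|ccot al|) * 1 <= _); last by rewrite mulr1.
apply: ler_pM => //; last by rewrite normfV ger0_norm// invf_le1 ?ler1n.
apply: le_trans (ler_normD _ _) _; rewrite normrM lerD ?sin_max//.
by rewrite -[leRHS]mulr1 ler_wpM2l// cos_max.
Qed.

Lemma norm_lin (c e M X Y : R) : `|X| <= M -> `|Y| <= M -> `|c * X + e * Y| <= (`|c| + `|e|) * M.
Proof.
by move=> XM YM; apply: le_trans (ler_normD _ _) _; rewrite !normrM mulrDl lerD// ler_wpM2l.
Qed.

Let r0 : 0 <= rate.
Proof. by rewrite /rate; apply: divr_ge0 => //; rewrite addr_ge0 ?sqr_ge0. Qed.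

Lemma norm_corr x : [/\ `|lobs x| <= bound_const, `|corr1 x| <= bound_const,
  `|corr2 x| <= bound_const & 0 <= rate <= bound_const].
Proof.
have n1 : 0 <= (`|a| + `|b|) * (1 + `|k1|) by rewrite mulr_ge0 ?addr_ge0.
have n2 : 0 <= (`|u| + `|w|) * (1 + `|ccot (theta *+ 2)|) by rewrite mulr_ge0 ?addr_ge0.
split.
- apply: le_trans (norm_lin _ _ (cos_max x) (sin_max x)) _.
  apply: le_trans (_ : (`|a| + `|b|) * (1 + `|k1|) <= _).
    by rewrite ler_wpM2l ?addr_ge0// lerDl.
  by rewrite /bound_const; have := r0; lra.
- apply: le_trans (norm_lin _ _ (norm_ccos _ x) (norm_csin _ x)) _.
  by rewrite /bound_const -/k1; have := r0; lra.
- rewrite normrN; apply: le_trans (norm_lin _ _ (norm_ccos _ _) (norm_csin _ _)) _.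
  by rewrite /bound_const; have := r0; lra.
- by rewrite r0 /bound_const; lra.
Qed.

Variable e : R.
Hypothesis e01 : 0 < e <= 1.
(** The corrections cancel the terms of order [e] and [e ^+ 2] that the
    oscillation of the phase produces in the evolution of [cos A], except for
    the averaged decay [- e ^+ 2 * rate * cos A]. *)
Definition Psi A x := cos A - e * (sin A * corr1 x) + e ^+ 2 * (cos A * corr2 x).
Let K := bound_const.

Lemma norm_Psi_cos A x : `|Psi A x - cos A| <= 2 * K * e.
Proof.
have [_ g q _] := norm_corr x; have [e0 e1] := andP e01; have e0' := ltW e0.
have := bound_const_ge1; rewrite -/K => K1.
rewrite (_ : Psi A x - cos A = - (e * (sin A * corr1 x)) + e ^+ 2 * (cos A * corr2 x)); last by rewrite /Psi; ring.
apply: le_trans (ler_normD _ _) _; rewrite normrN !normrM (ger0_norm (ltW e0)).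
have sg : `|sin A| * `|corr1 x| <= K by rewrite -[K]mul1r ler_pM// sin_max.
have sq : `|cos A| * `|corr2 x| <= K by rewrite -[K]mul1r ler_pM// cos_max.
rewrite (_ : 2 * K * e = e * K + e * K); last by ring.
apply: lerD; first by rewrite ler_wpM2l.
rewrite -mulrA ler_wpM2l// -[K]mul1r; exact: ler_pM.
Qed.

Lemma norm_Psi A x : `|Psi A x| <= 3 * K.
Proof.
have := norm_Psi_cos A x; have := cos_max A; have := bound_const_ge1; rewrite -/K => K1 cA h.
have [e0 e1] := andP e01; have e0' := ltW e0.
rewrite -[Psi A x](subrK (cos A)); apply: le_trans (ler_normD _ _) _.
by apply: le_trans (lerD h cA) _; nra.
Qed.

Lemma Psi_lip A d x : `|Psi (A + d) x - Psi A x| <= 3 * K * `|d|.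
Proof.
have [_ g q _] := norm_corr x; have [e0 e1] := andP e01; have e0' := ltW e0.
have := bound_const_ge1; rewrite -/K => K1.
have hc : `|cos (A + d) - cos A| <= `|d|.
  by apply: le_trans (cos_lip _ _) _; rewrite addrAC subrr add0r.
have hs : `|sin (A + d) - sin A| <= `|d|.
  by apply: le_trans (sin_lip _ _) _; rewrite addrAC subrr add0r.
rewrite (_ : _ - _ = (cos (A + d) - cos A) - e * ((sin (A + d) - sin A) * corr1 x)
  + e ^+ 2 * ((cos (A + d) - cos A) * corr2 x)); last by rewrite /Psi; ring.
apply: le_trans (ler_normD _ _) _.
have h1 : `|(cos (A + d) - cos A) - e * ((sin (A + d) - sin A) * corr1 x)| <= `|d| + K * `|d|.
  apply: le_trans (ler_normB _ _) (lerD hc _).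
  rewrite !normrM -[leRHS]mul1r ler_pM ?mulr_ge0//; first by rewrite ger0_norm.
  by rewrite mulrC; exact: ler_pM.
have h2 : `|e ^+ 2 * ((cos (A + d) - cos A) * corr2 x)| <= K * `|d|.
  rewrite !normrM -[leRHS]mul1r ler_pM// ?mulr_ge0//.
    by rewrite (ger0_norm e0') -expr2 exprn_ile1.
  by rewrite mulrC; exact: ler_pM.
by have := normr_ge0 d; nra.
Qed.

Definition dPsi A x := - sin A - e * (cos A * corr1 x) - e ^+ 2 * (sin A * corr2 x).

Lemma Psi_taylor A d x : `|Psi (A + d) x - Psi A x - d * dPsi A x| <= 3 * K * d ^+ 2.
Proof.
have [_ g q _] := norm_corr x; have [e0 e1] := andP e01; have e0' := ltW e0.
have := bound_const_ge1; rewrite -/K => K1.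
have := cos_taylor A d; have := sin_taylor A d.
set rs := sin (A + d) - sin A - d * cos A; set rc := cos (A + d) - cos A + d * sin A => hs hc.
rewrite (_ : _ - _ = rc - e * (rs * corr1 x) + e ^+ 2 * (rc * corr2 x)); last first.
  by rewrite /Psi /dPsi /rs /rc; ring.
have d0 : 0 <= d ^+ 2 by exact: sqr_ge0.
apply: le_trans (ler_normD _ _) _.
have h1 : `|rc - e * (rs * corr1 x)| <= d ^+ 2 + K * d ^+ 2.
  apply: le_trans (ler_normB _ _) (lerD hc _).
  rewrite !normrM -[leRHS]mul1r ler_pM ?mulr_ge0//; first by rewrite ger0_norm.
  by rewrite mulrC; exact: ler_pM.
have h2 : `|e ^+ 2 * (rc * corr2 x)| <= K * d ^+ 2.
  rewrite !normrM -[leRHS]mul1r ler_pM// ?mulr_ge0//.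
    by rewrite (ger0_norm e0') -expr2 exprn_ile1.
  by rewrite mulrC; exact: ler_pM.
by nra.
Qed.

(** The phase jumps at rate 1 while [A] drifts at speed [e * lobs]. By the
    equations of the two correctors, [Psi] is an eigenfunction of this
    evolution for [- e ^+ 2 * rate], up to terms of order [e ^+ 3]. *)
Lemma generator A x :
  `|Psi A (x + theta) - Psi A x + e * (lobs x * dPsi A x) + e ^+ 2 * (rate * Psi A x)|
  <= 3 * K ^+ 2 * e ^+ 3.
Proof.
have [l g q /andP[_ r]] := norm_corr x; have [e0 e1] := andP e01; have e0' := ltW e0.
have := bound_const_ge1; rewrite -/K => K1.
rewrite (_ : _ + _ = e ^+ 3 * (- (sin A * (lobs x * corr2 x)) - sin A * (rate * corr1 x) + e * (cos A * (rate * corr2 x)))); last first.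
  by rewrite /Psi /dPsi corr1D corr2D; ring.
rewrite normrM [leRHS]mulrC normrX (ger0_norm (ltW e0)) ler_wpM2l ?exprn_ge0 ?(ltW e0)//.
have P (y z t : R) : `|y| <= 1 -> `|z| <= K -> `|t| <= K -> `|y * (z * t)| <= K ^+ 2.
  by move=> ? ? ?; rewrite !normrM -[leRHS]mul1r ler_pM// ?mulr_ge0// expr2 ler_pM.
have rK : `|rate| <= K by rewrite ger0_norm.
have h1 : `|- (sin A * (lobs x * corr2 x))| <= K ^+ 2 by rewrite normrN P// sin_max.
have h2 : `|sin A * (rate * corr1 x)| <= K ^+ 2 by rewrite P// sin_max.
have h3 : `|e * (cos A * (rate * corr2 x))| <= K ^+ 2.
  rewrite normrM -[leRHS]mul1r ler_pM//; first by rewrite ger0_norm// ltW.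
  by rewrite P// cos_max.
apply: le_trans (ler_normD _ _) _; have := ler_normB (- (sin A * (lobs x * corr2 x))) (sin A * (rate * corr1 x)).
by lra.
Qed.

(** A first-order expansion in [A] reduces one step of the discretized
    evolution to [generator], with remainders of order [h ^+ 2]. *)
Lemma Psi_step A x h : 0 <= h <= 1 ->
  `|(1 - h) * Psi (A + e * h * lobs x) x + h * Psi (A + e * h * lobs (x + theta)) (x + theta)
    - (1 - e ^+ 2 * rate * h) * Psi A x| <= 3 * K ^+ 2 * e ^+ 3 * h + 9 * K ^+ 3 * h ^+ 2.
Proof.
move=> /andP[h0 h1]; have [e0 e1] := andP e01; have e0' := ltW e0.
have := bound_const_ge1; rewrite -/K => K1.
have [l _ _ _] := norm_corr x; have [l' _ _ _] := norm_corr (x + theta).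
set d0 := e * h * lobs x; set d1 := e * h * lobs (x + theta).
have eh0 : 0 <= e * h by rewrite mulr_ge0// ltW.
have ehh : e * h <= h by rewrite -[leRHS]mul1r ler_wpM2r.
have d0K : `|d0| <= h * K by rewrite normrM ler_pM// ger0_norm.
have d1K : `|d1| <= h * K by rewrite normrM ler_pM// ger0_norm.
have t1 := Psi_taylor A d0 x; have t2 := Psi_lip A d0 x; have t3 := Psi_lip A d1 (x + theta).
have t4 := generator A x.
set r1 := Psi (A + d0) x - Psi A x - d0 * dPsi A x in t1.
set r2 := Psi (A + d0) x - Psi A x in t2.
set r3 := Psi (A + d1) _ - Psi A _ in t3.
set r4 := (X in `|X| <= _) in t4.
rewrite (_ : _ - _ = r1 - h * r2 + h * r3 + h * r4); last first.
  by rewrite /r1 /r2 /r3 /r4 /d0; ring.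
have d0K2 : d0 ^+ 2 <= h ^+ 2 * K ^+ 2.
  by rewrite -exprMn -[leLHS]real_normK ?num_real// lerXn2r// ?nnegrE// mulr_ge0// (le_trans ler01).
have b1 : `|r1| <= 3 * K ^+ 3 * h ^+ 2.
  apply: le_trans t1 _; rewrite (_ : 3 * K ^+ 3 * h ^+ 2 = 3 * K * (h ^+ 2 * K ^+ 2)); last by ring.
  by rewrite ler_wpM2l// mulr_ge0// (le_trans ler01).
have K23 : K ^+ 2 <= K ^+ 3 by rewrite [leRHS]exprS ler_peMl ?sqr_ge0.
have bb (d : R) : `|d| <= h * K -> h * (3 * K * `|d|) <= 3 * K ^+ 3 * h ^+ 2.
  move=> dK; apply: le_trans (_ : h * (3 * K * (h * K)) <= _).
    by rewrite ler_wpM2l// ler_wpM2l// mulr_ge0// (le_trans ler01).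
  rewrite (_ : h * _ = 3 * K ^+ 2 * h ^+ 2); last by ring.
  by rewrite ler_wpM2r ?sqr_ge0// ler_wpM2l.
have b2 : `|h * r2| <= 3 * K ^+ 3 * h ^+ 2.
  by rewrite normrM (ger0_norm h0); apply: le_trans (ler_wpM2l h0 t2) (bb _ d0K).
have b3 : `|h * r3| <= 3 * K ^+ 3 * h ^+ 2.
  by rewrite normrM (ger0_norm h0); apply: le_trans (ler_wpM2l h0 t3) (bb _ d1K).
have b4 : `|h * r4| <= 3 * K ^+ 2 * e ^+ 3 * h.
  by rewrite normrM (ger0_norm h0) mulrC ler_wpM2r.
have := ler_normD (r1 - h * r2 + h * r3) (h * r4).
have := ler_normD (r1 - h * r2) (h * r3).
have := ler_normB r1 (h * r2).
lra.
Qed.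

End Correctors.

(** * Expectation over one segment *)

Section PoissonPiece.
Context (R : realType) d (Omega : measurableType d) (P : probability Omega R).
Variable N : R -> {RV P >-> nat}.
Hypothesis hN : standard_poisson_process N.
Variable theta : R.
Hypothesis ct1 : cos theta != 1.
Hypothesis ct2 : cos (theta *+ 2) != 1.

Definition angle (t : R) (w : Omega) : R := theta * (N t w)%:R.

Lemma past_measurable_angle (s t : R) : 0 <= s -> s <= t -> past_measurable N t (angle s).
Proof.
move=> s0 st; apply: measurable_funM => //.
apply: (@measurableT_comp _ _ _ _ _ _ (fun k : nat => k%:R : R)) => //.
exact: past_measurable_N.
Qed.

Lemma measurable_lobs (a b : R) : measurable_fun setT (lobs a b).
Proof.
apply: measurable_funD; apply: measurable_funM => //; apply: continuous_measurable_fun.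
  exact: continuous_cos.
exact: continuous_sin.
Qed.

Section Steps.
Variables (a b e : R).
Hypothesis e01 : 0 < e <= 1.
Let K := bound_const theta a b.

Lemma measurable_ccs al : measurable_fun setT (ccos al : R -> R) /\ measurable_fun setT (csin al : R -> R).
Proof.
have mc : measurable_fun setT (@cos R) by apply: continuous_measurable_fun; exact: continuous_cos.
have ms : measurable_fun setT (@sin R) by apply: continuous_measurable_fun; exact: continuous_sin.
split; apply: measurable_funM => //.
  by apply: measurable_funB => //; exact: measurable_funM.
by apply: measurable_funD => //; exact: measurable_funM.
Qed.

Lemma measurable_Psi d' (S : measurableType d') (A x : S -> R) :
  measurable_fun setT A -> measurable_fun setT x ->
  measurable_fun setT (fun w => Psi theta a b e (A w) (x w)).
Proof.
move=> mA mx.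
have mc : measurable_fun setT (@cos R) by apply: continuous_measurable_fun; exact: continuous_cos.
have ms : measurable_fun setT (@sin R) by apply: continuous_measurable_fun; exact: continuous_sin.
have mcA := measurableT_comp mc mA; have msA := measurableT_comp ms mA.
have [m1 m2] := measurable_ccs theta; have [m3 m4] := measurable_ccs (theta *+ 2).
have mc1 : measurable_fun setT (corr1 theta a b).
  by apply: measurable_funD; apply: measurable_funM.
have mx2 : measurable_fun setT (fun x : R => x *+ 2) by exact: natmul_measurable.
have mc2 : measurable_fun setT (corr2 theta a b).
  apply: measurable_funN; apply: measurable_funD; apply: measurable_funM => //.
    exact: measurableT_comp m3 mx2.
  exact: measurableT_comp m4 mx2.
apply: measurable_funD.
  apply: measurable_funB => //; apply: measurable_funM => //; apply: measurable_funM => //.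
  exact: measurableT_comp mc1 mx.
apply: measurable_funM => //; apply: measurable_funM => //.
exact: measurableT_comp mc2 mx.
Qed.

(** [Ex_poisson_step] for the perturbed test function: the values without and
    with a jump are those compared in [Psi_step]. *)
Lemma piece_step (s h : R) (A : Omega -> R) : 0 <= s -> 0 < h <= 1 ->
  past_measurable N s A ->
  `|\int[P]_w (Psi theta a b e (A w + e * h * lobs a b (angle (s + h) w)) (angle (s + h) w))
   - (1 - e ^+ 2 * rate a b * h) * \int[P]_w (Psi theta a b e (A w) (angle s w))|
  <= 3 * K ^+ 2 * e ^+ 3 * h + 18 * K ^+ 3 * h ^+ 2.
Proof.
move=> s0 /andP[h0 h1] pA.
have su : s < s + h by rewrite ltrDl.
pose F k w := Psi theta a b e (A w + e * h * lobs a b (angle s w + theta * k%:R)) (angle s w + theta * k%:R).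
have pang := past_measurable_angle s0 (lexx s).
have pF k : past_measurable N s (F k).
  have mk : past_measurable N s (fun w => angle s w + theta * k%:R) by exact: measurable_funD.
  apply: measurable_Psi => //; apply: measurable_funD => //; apply: measurable_funM => //.
  exact: (measurableT_comp (measurable_lobs a b)).
have bP := @norm_Psi R theta a b e e01; rewrite -/K in bP.
have FM k w : `|F k w| <= 3 * K by exact: bP.
have K1 : 1 <= K by exact: bound_const_ge1.
have := Ex_poisson_step hN s0 su pF FM.
rewrite (_ : s + h - s = h); last by rewrite addrAC subrr add0r.
have -> : (fun w => F (N (s + h) w - N s w)%N w) =
  (fun w => Psi theta a b e (A w + e * h * lobs a b (angle (s + h) w)) (angle (s + h) w)).
  apply/funext => w; rewrite /F.
  rewrite (_ : angle s w + _ = angle (s + h) w)//.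
  by rewrite /angle -mulrDr -natrD -(N_incr hN w s0 (ltW su)).
have bF k : bmf (F k) by split; [exact: past_measurableW (pF k)|exists (3 * K)].
have bPs : bmf (fun w => Psi theta a b e (A w) (angle s w)).
  by split; [exact: past_measurableW (measurable_Psi pA pang)|exists (3 * K) => w; exact: bP].
rewrite (_ : (1 - h) * _ + h * _ = \int[P]_w ((1 - h) * F 0%N w + h * F 1%N w)); last first.
  by rewrite [RHS]ExD; [congr (_ + _); rewrite [RHS]ExZ|exact: bmfZ|exact: bmfZ].
move=> IJ; set J := \int[P]_w ((1 - h) * F 0%N w + h * F 1%N w) in IJ.
have JJ : `|J - (1 - e ^+ 2 * rate a b * h) * \int[P]_w (Psi theta a b e (A w) (angle s w))|
   <= 3 * K ^+ 2 * e ^+ 3 * h + 9 * K ^+ 3 * h ^+ 2.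
  rewrite -ExZ// -ExB//; try by [exact: bmfZ|apply: bmfD; exact: bmfZ].
  apply: le_norm_Ex; first by apply: bmfB; [apply: bmfD; exact: bmfZ|exact: bmfZ].
  move=> w; rewrite /F mulr0 addr0 mulr1.
  by apply: Psi_step => //; rewrite (ltW h0).
rewrite -(subrKA J) ; apply: le_trans (ler_normD _ _) _.
apply: le_trans (lerD IJ JJ) _.
have K3 : K <= K ^+ 3 by rewrite [leRHS]exprS ler_peMr ?(le_trans ler01)// expr2 -[1]mul1r ler_pM.
have := ler_wpM2r (sqr_ge0 h) K3; lra.
Qed.

(** The observable is read at the end of each step, in agreement with the
    right end points of [riemann_sum]. *)
Fixpoint phase_sum (s h : R) (A : Omega -> R) (n : nat) : Omega -> R :=
  if n is m.+1 then fun w => phase_sum s h A m w + e * h * lobs a b (angle (s + m.+1%:R * h) w)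
  else A.

Lemma past_phase_sum (s h : R) (A : Omega -> R) n : 0 <= s -> 0 < h -> past_measurable N s A ->
  past_measurable N (s + n%:R * h) (phase_sum s h A n).
Proof.
move=> s0 h0 pA; elim: n => [|n IH]; first by rewrite mul0r addr0.
have le1 : s + n%:R * h <= s + n.+1%:R * h by rewrite lerD2l ler_wpM2r ?(ltW h0)// ler_nat.
apply: measurable_funD; first exact: past_measurable_mono IH.
apply: measurable_funM => //; apply: (measurableT_comp (measurable_lobs a b)).
by apply: past_measurable_angle => //; rewrite addr_ge0// mulr_ge0// ltW.
Qed.

(** The expectations of [Psi] along the sum satisfy a linear recursion up to
    the error of [piece_step], which accumulates over the [n] steps; the
    exchange of [Psi] with the cosine is paid only at the two ends. *)
Lemma piece_discrete (s h : R) (A : Omega -> R) n : 0 <= s -> 0 < h <= 1 -> e ^+ 2 * rate a b * h <= 1 ->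
  past_measurable N s A ->
  `|\int[P]_w cos (phase_sum s h A n w) - (1 - e ^+ 2 * rate a b * h) ^+ n * \int[P]_w cos (A w)|
  <= 4 * K * e + n%:R * (3 * K ^+ 2 * e ^+ 3 * h + 18 * K ^+ 3 * h ^+ 2).
Proof.
move=> s0 h01 rh pA; have [h0 h1] := andP h01; have [e0 e1] := andP e01.
set D := 3 * _ * _ * _ + _; set r := 1 - _.
have bP := @norm_Psi R theta a b e e01; rewrite -/K in bP.
have K1 : 1 <= K by exact: bound_const_ge1.
have [_ _ _ /andP[rate0 _]] := norm_corr theta a b 0.
have r01 : 0 <= r <= 1.
  rewrite /r subr_ge0 rh/= lerBlDr lerDl; apply: mulr_ge0; last exact: ltW.
  by apply: mulr_ge0 => //; exact: sqr_ge0.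
have D0 : 0 <= D.
  have K0 := le_trans ler01 K1.
  by apply: addr_ge0; rewrite !mulr_ge0 ?exprn_ge0// ltW.
pose E j := \int[P]_w Psi theta a b e (phase_sum s h A j w) (angle (s + j%:R * h) w).
have ps j : past_measurable N (s + j%:R * h) (phase_sum s h A j) by exact: past_phase_sum.
have sj j : 0 <= s + j%:R * h by rewrite addr_ge0// mulr_ge0// ltW.
have Estep j : `|E j.+1 - r * E j| <= D.
  have := piece_step (sj j) h01 (ps j); rewrite /E /=.
  by rewrite (_ : s + j%:R * h + h = s + j.+1%:R * h)// -natr1 mulrDl mul1r addrA.
have En j : `|E j - r ^+ j * E 0%N| <= j%:R * D.
  elim: j => [|j IH]; first by rewrite expr0 mul1r subrr normr0 mul0r.
  rewrite (_ : _ - _ = (E j.+1 - r * E j) + r * (E j - r ^+ j * E 0%N)); last first.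
    by rewrite exprS; ring.
  rewrite (_ : j.+1%:R * D = D + j%:R * D); last by rewrite -natr1; ring.
  apply: le_trans (ler_normD _ _) (lerD (Estep j) _).
  case/andP: r01 => r0 r1; rewrite normrM (ger0_norm r0).
  by apply: le_trans IH; rewrite ler_piMl.
have EC j : `|E j - \int[P]_w cos (phase_sum s h A j w)| <= 2 * K * e.
  have mps := past_measurableW (ps j).
  have mang := past_measurableW (past_measurable_angle (sj j) (lexx _)).
  have bPs : bmf (fun w => Psi theta a b e (phase_sum s h A j w) (angle (s + j%:R * h) w)).
    by split; [exact: measurable_Psi|exists (3 * K) => w; exact: bP].
  rewrite -ExB//; last exact: bmf_cos.
  apply: le_norm_Ex; first by apply: bmfB => //; exact: bmf_cos.
  by move=> w; exact: norm_Psi_cos.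
have := EC n; have := EC 0%N; have := En n; rewrite /=.
set c0 := \int[P]_w cos (A w); set cn := \int[P]_w cos _ => h3 h4 h5.
rewrite (_ : cn - _ = (cn - E n) + (E n - r ^+ n * E 0%N) + r ^+ n * (E 0%N - c0)); last by ring.
have rn : `|r ^+ n * (E 0%N - c0)| <= 2 * K * e.
  apply: le_trans h4; case/andP: r01 => r0 r1.
  by rewrite normrM ler_piMl// ger0_norm ?exprn_ge0// exprn_ile1.
rewrite distrC in h5.
have := ler_normD (cn - E n + (E n - r ^+ n * E 0%N)) (r ^+ n * (E 0%N - c0)).
have := ler_normD (cn - E n) (E n - r ^+ n * E 0%N).
lra.
Qed.

End Steps.
End PoissonPiece.

(** * Decorrelation of the phase *)

Section PoissonMixing.
Context (R : realType) d (Omega : measurableType d) (P : probability Omega R).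
Variable N : R -> {RV P >-> nat}.
Hypothesis hN : standard_poisson_process N.

Lemma past_jumps_set_indep (s u : R) (K : set nat) (B : set R) (F : Omega -> R) :
  0 <= s -> s <= u -> past_measurable N s F -> measurable B ->
  indep_sets P (F @^-1` B) [set w | K (N u w - N s w)%N].
Proof.
move=> s0 su pF mB.
have mFB : measurable (F @^-1` B).
  by rewrite -[X in measurable X]setTI; exact: (past_measurableW pF).
have cI (A E : set Omega) : indep_sets P A E -> indep_sets P E A.
  by rewrite /indep_sets setIC muleC.
apply/cI.
apply: (@indep_sigma _ _ _ P [set A | A = set0 \/ exists k, A = jumps N s u k]) => //.
- move=> A A' [->|[k ->]]; first by left; rewrite set0I.
  move=> [->|[k' ->]]; first by left; rewrite setI0.
  have [->|kk] := eqVneq k k'; first by right; exists k'; rewrite setIid.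
  left; apply/seteqP; split => w //= [/= h1 h2].
  by rewrite /jumps /= h1 in h2; rewrite h2 eqxx in kk.
- by move=> A [->|[k ->]] //; exact: measurable_jumps.
- move=> A [->|[k ->]]; first by rewrite /indep_sets set0I !measure0 mul0e.
  by apply/cI; exact: past_event_indep.
rewrite (_ : [set w | _] = \bigcup_(k in K) jumps N s u k); last first.
  apply/seteqP; split => w /=; first by move=> Kw; exists (N u w - N s w)%N.
  by move=> [k Kk]; rewrite /jumps /= => ->.
have [z0 zC zU] := smallest_sigma_algebra setT [set A | A = set0 \/ exists k, A = jumps N s u k].
rewrite bigcup_mkcond; apply: zU => k; case: ifPn => _ //.
by apply: sub_sigma_algebra; right; exists k.
Qed.

Lemma Ex_past_fun_jumps (s u M : R) (psi : nat -> R) (F : Omega -> R) :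
  0 <= s -> s <= u -> past_measurable N s F -> bmf F -> (forall k, `|psi k| <= M) ->
  \int[P]_w (F w * psi (N u w - N s w)%N) = \int[P]_w F w * \int[P]_w psi (N u w - N s w)%N.
Proof.
move=> s0 su pF bF psiM; apply: indep_ExM => //.
  split; last by exists M => w; exact: psiM.
  have mx : measurable_fun setT (fun w => (N u w - N s w)%N) by exact: measurable_fun_subn.
  exact: (@measurableT_comp _ _ _ _ _ _ psi).
move=> B C mB mC.
exact: (@past_jumps_set_indep s u (psi @^-1` C)).
Qed.

Variable theta : R.
Hypothesis ct1 : cos theta != 1.
Notation phase := (angle N theta).

(** The squared modulus of E[F exp(i theta N_s)]. *)
Definition modsq (F : Omega -> R) (s : R) :=
  (\int[P]_w (F w * cos (phase s w))) ^+ 2 + (\int[P]_w (F w * sin (phase s w))) ^+ 2.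

(** The squared modulus of E[exp(i theta (N_u - N_s))]. *)
Definition charsq (s u : R) :=
  (\int[P]_w cos (theta * (N u w - N s w)%:R)) ^+ 2 + (\int[P]_w sin (theta * (N u w - N s w)%:R)) ^+ 2.

Definition gap := (1 - cos theta) / 2.

Lemma gap_gt0 : 0 < gap.
Proof. by rewrite /gap divr_gt0// subr_gt0 lt_neqAle ct1 cos_le1. Qed.

Lemma measurable_angle t : measurable_fun setT (phase t).
Proof.
apply: measurable_funM => //.
exact: (@measurableT_comp _ _ _ _ _ _ (fun k : nat => k%:R : R)).
Qed.

(** The increment over [s, u] is independent of the past, so the complex
    expectation behind [modsq] is multiplied by the characteristic function
    of this increment. *)
Lemma modsq_step (s u : R) (F : Omega -> R) : 0 <= s -> s <= u ->
  past_measurable N s F -> bmf F -> modsq F u = charsq s u * modsq F s.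
Proof.
move=> s0 su pF bF.
have pang : past_measurable N s (phase s) := past_measurable_angle theta s0 (lexx s).
have bc := bmf_cos (past_measurableW pang); have bs := bmf_sin (past_measurableW pang).
pose xi w := theta * (N u w - N s w)%:R.
have ang w : phase u w = phase s w + xi w.
  by rewrite /angle /xi -mulrDr -natrD -(N_incr hN w s0 su).
have mxi : measurable_fun setT xi.
  apply: measurable_funM => //.
  by apply: (@measurableT_comp _ _ _ _ _ _ (fun k : nat => k%:R : R)) => //; exact: measurable_fun_subn.
have pFc : past_measurable N s (fun w => F w * cos (phase s w)).
  by apply: measurable_funM => //; exact: continuous_measurableT (@continuous_cos R) pang.
have pFs : past_measurable N s (fun w => F w * sin (phase s w)).
  by apply: measurable_funM => //; exact: continuous_measurableT (@continuous_sin R) pang.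
have bFc : bmf (fun w => F w * cos (phase s w)) by exact: bmfM.
have bFs : bmf (fun w => F w * sin (phase s w)) by exact: bmfM.
have bcx := bmf_cos mxi; have bsx := bmf_sin mxi.
have bP (U V : Omega -> R) : bmf U -> bmf V -> bmf (fun w => U w * V w) by exact: bmfM.
have E1 : \int[P]_w (F w * cos (phase u w)) =
  \int[P]_w (F w * cos (phase s w)) * \int[P]_w cos (xi w)
  - \int[P]_w (F w * sin (phase s w)) * \int[P]_w sin (xi w).
  rewrite -(Ex_past_fun_jumps (psi := fun k => cos (theta * k%:R)) s0 su pFc bFc (fun k => cos_max _)).
  rewrite -(Ex_past_fun_jumps (psi := fun k => sin (theta * k%:R)) s0 su pFs bFs (fun k => sin_max _)).
  rewrite -ExB; [|exact: bP|exact: bP].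
  by apply: eq_Rintegral => w _; rewrite ang cosD /xi; ring.
have E2 : \int[P]_w (F w * sin (phase u w)) =
  \int[P]_w (F w * sin (phase s w)) * \int[P]_w cos (xi w)
  + \int[P]_w (F w * cos (phase s w)) * \int[P]_w sin (xi w).
  rewrite -(Ex_past_fun_jumps (psi := fun k => cos (theta * k%:R)) s0 su pFs bFs (fun k => cos_max _)).
  rewrite -(Ex_past_fun_jumps (psi := fun k => sin (theta * k%:R)) s0 su pFc bFc (fun k => sin_max _)).
  rewrite -ExD; [|exact: bP|exact: bP].
  by apply: eq_Rintegral => w _; rewrite ang sinD /xi; ring.
by rewrite /modsq E1 E2 /charsq -/xi; ring.
Qed.

(** The exact value is exp(- 4 gap h); the expansion of one step is enough
    for this weaker decay when [h] is small. *)
Lemma charsq_le (s h : R) : 0 <= s -> 0 < h <= 1 / 2 -> h <= gap / 9 ->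
  charsq s (s + h) <= 1 - gap * h.
Proof.
move=> s0 /andP[h0 h12] hg.
have su : s < s + h by rewrite ltrDl.
have pc (c : nat -> R) k : past_measurable N s (cst (c k) : Omega -> R) by exact: measurable_cst.
have hh : s + h - s = h by rewrite addrAC subrr add0r.
have := Ex_poisson_step hN s0 su (pc (fun k => cos (theta * k%:R))) (fun k w => cos_max _).
have := Ex_poisson_step hN s0 su (pc (fun k => sin (theta * k%:R))) (fun k w => sin_max _).
rewrite /charsq hh /= !Ex_cst !mulr0 mulr1 sin0 cos0 mulr0 add0r mulr1.
set p := \int[P]_w _; set q := \int[P]_w _.
have := sin_max theta; have := cos2Dsin2 theta; have g0 := gap_gt0.
have : cos theta = 1 - 2 * gap by rewrite /gap; field.
set c := cos theta; set g := gap in g0 hg *; set sn := sin theta => cE cs.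
rewrite mulr1 => s1 hp hq.
have g1 : g <= 1 by have := cos_geN1 theta; rewrite -/c; lra.
move: hp hq; rewrite !ler_norml => /andP[q1 q2] /andP[p1 p2]; subst c.
have {}s1 : -1 <= sn <= 1 by rewrite -ler_norml.
have gh0 : 0 <= g * h by rewrite mulr_ge0// ltW.
have gh1 : g * h <= 1 / 2 by nra.
have h2 : 3 * h ^+ 2 <= g * h / 3 by nra.
have qu : q ^+ 2 <= (1 - 5 / 3 * (g * h)) ^+ 2.
  rewrite -[leLHS]real_normK ?num_real// lerXn2r ?nnegrE//; first by lra.
  by rewrite ler_norml; apply/andP; split; nra.
have pu : p ^+ 2 <= (5 / 2 * h) ^+ 2.
  rewrite -[leLHS]real_normK ?num_real// lerXn2r ?nnegrE//; first by lra.
  by rewrite ler_norml; apply/andP; split; nra.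
have h3 : (5 / 2 * h) ^+ 2 <= 7 / 10 * (g * h) by nra.
have h4 : (1 - 5 / 3 * (g * h)) ^+ 2 <= 1 - 19 / 10 * (g * h) by nra.
lra.
Qed.

End PoissonMixing.

(** * Square bound for sums *)

Section L2bound.
Context (R : realType) d (Omega : measurableType d) (P : probability Omega R).
Variable N : R -> {RV P >-> nat}.
Hypothesis hN : standard_poisson_process N.
Variable theta : R.
Hypothesis ct1 : cos theta != 1.
Notation phase := (angle N theta).
Notation mu := (@lebesgue_measure R).

Fixpoint weighted_sum (f : nat -> R) (phi h : R) (n : nat) : Omega -> R :=
  if n is m.+1 then
    fun w => weighted_sum f phi h m w + f m * cos (phase (m.+1%:R * h) w + phi)
  else cst 0.

Lemma past_weighted_sum f phi (h : R) n : 0 < h ->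
  past_measurable N (n%:R * h) (weighted_sum f phi h n) /\ bmf (weighted_sum f phi h n).
Proof.
move=> h0; elim: n => [|n [IH1 IH2]]; first by split; [exact: measurable_cst|exact: bmf_cst].
have le1 : n%:R * h <= n.+1%:R * h by rewrite ler_wpM2r ?(ltW h0)// ler_nat.
have nh : 0 <= n.+1%:R * h by rewrite mulr_ge0// ltW.
have pa : past_measurable N (n.+1%:R * h) (fun w => cos (phase (n.+1%:R * h) w + phi)).
  apply: continuous_measurableT (@continuous_cos R) _; apply: measurable_funD => //.
  exact: past_measurable_angle.
split.
  apply: measurable_funD; first exact: past_measurable_mono le1 IH1.
  by apply: measurable_funM.
apply: bmfD => //; apply: bmfZ; apply: bmf_cos; apply: measurable_funD => //.
exact: measurable_angle.
Qed.

(** The second moment is controlled together with the potential [modsq]. The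
    potential dominates the covariance of the partial sum with the next term,
    and the independence of increments contracts it by [1 - gap * h] at each
    step; this contraction pays for both cross terms, and each step leaves at
    most [8 / (gap * h) * f n ^+ 2]. *)
Lemma discrete_L2 (f : nat -> R) (phi h : R) n : 0 < h <= 1 / 2 -> h <= gap theta / 9 ->
  \int[P]_w (weighted_sum f phi h n w ^+ 2) <= 8 / (gap theta * h) * \sum_(j < n) f j ^+ 2.
Proof.
move=> h01 hg; have /andP[h0 h1] := h01; have g0 := gap_gt0 ct1.
set g := gap theta in g0 hg *; have gh0 : 0 < g * h by rewrite mulr_gt0.
pose S j := weighted_sum f phi h j.
suff : \int[P]_w (S n w ^+ 2) + modsq N theta (S n) (n%:R * h) <= 8 / (g * h) * \sum_(j < n) f j ^+ 2.
  by apply: le_trans; rewrite lerDl addr_ge0// sqr_ge0.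
elim: n => [|n IH].
  rewrite big_ord0 mulr0 /S /=.
  rewrite (_ : \int[P]_w _ = 0); last by rewrite -[RHS](Ex_cst P); apply: eq_Rintegral => w _; rewrite /= expr0n.
  have z (G : Omega -> R) : \int[P]_w (cst 0 w * G w) = 0.
    by rewrite -[RHS](Ex_cst P); apply: eq_Rintegral => w _; rewrite mul0r.
  by rewrite /modsq !z expr0n /= !addr0.
have [pS bS] : past_measurable N (n%:R * h) (S n) /\ bmf (S n) := past_weighted_sum f phi n h0.
have nh : 0 <= n%:R * h by rewrite mulr_ge0// ltW.
have nS : n%:R * h + h = n.+1%:R * h by rewrite -natr1 mulrDl mul1r.
have le1 : n%:R * h <= n.+1%:R * h by rewrite -nS lerDl ltW.
have m1 := modsq_step hN theta nh le1 pS bS.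
have c1 := charsq_le hN ct1 nh h01 hg; rewrite nS -/g in c1.
have m0 : 0 <= modsq N theta (S n) (n%:R * h) by rewrite addr_ge0// sqr_ge0.
set T := n.+1%:R * h in m1 c1 *; set F := f n.
have mT := measurable_angle N theta T.
have bc := bmf_cos mT; have bs := bmf_sin mT.
have mTp : measurable_fun setT (fun w => phase T w + phi) by exact: measurable_funD.
pose Y w := cos (phase T w + phi).
have bY : bmf Y by exact: bmf_cos.
have YE w : Y w = cos phi * cos (phase T w) - sin phi * sin (phase T w) by rewrite /Y cosD; ring.
set Gc := \int[P]_w (S n w * cos (phase T w)) in m1.
set Gs := \int[P]_w (S n w * sin (phase T w)) in m1.
set V := modsq N theta (S n) (n%:R * h) in IH m1 m0.
have V'le : Gc ^+ 2 + Gs ^+ 2 <= (1 - g * h) * V.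
  by rewrite [leLHS]m1; exact: ler_wpM2r.
pose x := \int[P]_w (S n w * Y w).
have bP (U W : Omega -> R) : bmf U -> bmf W -> bmf (fun w => U w * W w) by exact: bmfM.
have xE : x = cos phi * Gc - sin phi * Gs.
  rewrite /x /Gc /Gs -!ExZ; [|exact: bP|exact: bP].
  rewrite -ExB; [|by apply: bmfZ; exact: bP|by apply: bmfZ; exact: bP].
  by apply: eq_Rintegral => w _; rewrite YE; ring.
pose aa := \int[P]_w (Y w * cos (phase T w)); pose bb := \int[P]_w (Y w * sin (phase T w)).
have aa1 : `|aa| <= 1.
  by apply: le_norm_Ex => [|w]; [exact: bP|rewrite normrM mulr_ile1 ?cos_max].
have bb1 : `|bb| <= 1.
  by apply: le_norm_Ex => [|w]; [exact: bP|rewrite normrM mulr_ile1 ?cos_max ?sin_max].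
have EY : \int[P]_w (Y w * Y w) <= 1.
  rewrite -[leRHS](Ex_cst P); apply: le_Ex; [exact: bP|exact: bmf_cst|move=> w].
  by rewrite -expr2 -[leLHS]real_normK ?num_real// expr_le1// cos_max.
have E1 : \int[P]_w (S n.+1 w ^+ 2) = \int[P]_w (S n w ^+ 2) + 2 * F * x + F ^+ 2 * \int[P]_w (Y w * Y w).
  rewrite /x -!ExZ; [|exact: bP|exact: bP].
  have b1 : bmf (fun w => S n w ^+ 2) by exact: bP.
  have b2 : bmf (fun w => 2 * F * (S n w * Y w)) by apply: bmfZ; exact: bP.
  have b3 : bmf (fun w => F ^+ 2 * (Y w * Y w)) by apply: bmfZ; exact: bP.
  rewrite -ExD// -ExD//; last exact: bmfD.
  by apply: eq_Rintegral => w _; rewrite /S /= -/(S n w) -/F -/(Y w); ring.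
have Eg (h' : R -> R) (bh : bmf (fun w => h' (phase T w))) :
   \int[P]_w (S n.+1 w * h' (phase T w)) = \int[P]_w (S n w * h' (phase T w)) + F * \int[P]_w (Y w * h' (phase T w)).
  rewrite -ExZ; last exact: bP.
  rewrite -ExD; [|exact: bP|by apply: bmfZ; exact: bP].
  by apply: eq_Rintegral => w _; rewrite /S /= -/(S n w) -/F -/(Y w); ring.
rewrite E1 /modsq -/T (Eg _ bc) (Eg _ bs) -/Gc -/Gs -/aa -/bb.
set I := \int[P]_w (S n w ^+ 2) in IH *; set J := \int[P]_w (Y w * Y w) in EY *.
rewrite big_ord_recr /= [leRHS]mulrDr -/F.
apply: le_trans (lerD IH (lexx _)).
have F2 := sqr_ge0 F.
have a2 : aa ^+ 2 <= 1 by rewrite -[leLHS]real_normK ?num_real// expr_le1.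
have b2 : bb ^+ 2 <= 1 by rewrite -[leLHS]real_normK ?num_real// expr_le1.
have V2 : 0 <= Gc ^+ 2 + Gs ^+ 2 by rewrite addr_ge0 ?sqr_ge0.
set y := Gc * aa + Gs * bb.
have y2 : y ^+ 2 <= 2 * (Gc ^+ 2 + Gs ^+ 2).
  have := sqr_ge0 (Gc * bb - Gs * aa); rewrite /y.
  have : 0 <= (Gc ^+ 2 + Gs ^+ 2) * (2 - aa ^+ 2 - bb ^+ 2) by apply: mulr_ge0 => //; lra.
  lra.
have x2 : (cos phi * Gc - sin phi * Gs) ^+ 2 <= Gc ^+ 2 + Gs ^+ 2.
  have := sqr_ge0 (cos phi * Gs + sin phi * Gc); have := cos2Dsin2 phi => cs.
  have -> : Gc ^+ 2 + Gs ^+ 2 = (Gc ^+ 2 + Gs ^+ 2) * (cos phi ^+ 2 + sin phi ^+ 2) by rewrite cs mulr1.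
  lra.
rewrite -xE in x2.
set be := g * h in gh0 V'le *.
have be1 : be <= 1 / 2.
  rewrite /be; have : g <= 1 by rewrite /g /gap; have := cos_geN1 theta; lra.
  by nra.
(* Young's inequality, weighted so that the bounds of [x ^+ 2] and [y ^+ 2]
   below add up to the contraction [be] of the potential. *)
have YM (z : R) : 2 * F * z <= be / 3 * z ^+ 2 + 3 / be * F ^+ 2.
  have : 0 <= 3 / be * (F - be / 3 * z) ^+ 2 by apply: mulr_ge0; [apply: divr_ge0 => //; exact: ltW|exact: sqr_ge0].
  have -> : 3 / be * (F - be / 3 * z) ^+ 2 = 3 / be * F ^+ 2 - 2 * F * z + be / 3 * z ^+ 2.
    by field; rewrite gt_eqF.
  lra.
have := YM x; have := YM y.
have -> : I + 2 * F * x + F ^+ 2 * J + ((Gc + F * aa) ^+ 2 + (Gs + F * bb) ^+ 2) =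
  I + 2 * F * x + 2 * F * y + F ^+ 2 * (J + aa ^+ 2 + bb ^+ 2) + (Gc ^+ 2 + Gs ^+ 2) by rewrite /y; ring.
move=> Yy Yx.
have h3 : F ^+ 2 * (J + aa ^+ 2 + bb ^+ 2) <= F ^+ 2 * 3 by rewrite ler_wpM2l//; lra.
have ib : 2 <= be^-1 by rewrite -[2]invrK lef_pV2 ?posrE ?invr_gt0//; lra.
have h4 : F ^+ 2 * 3 <= F ^+ 2 * (2 / be) by rewrite ler_wpM2l//; lra.
have h5 : be / 3 * x ^+ 2 <= be / 3 * (Gc ^+ 2 + Gs ^+ 2) by rewrite ler_wpM2l//; lra.
have h6 : be / 3 * y ^+ 2 <= be / 3 * (2 * (Gc ^+ 2 + Gs ^+ 2)) by rewrite ler_wpM2l//; lra.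
have h7 : be * (Gc ^+ 2 + Gs ^+ 2) + (Gc ^+ 2 + Gs ^+ 2) <= V.
  have : (1 + be) * (Gc ^+ 2 + Gs ^+ 2) <= (1 + be) * ((1 - be) * V) by rewrite ler_wpM2l//; lra.
  have : 0 <= be ^+ 2 * V by rewrite mulr_ge0 ?sqr_ge0.
  lra.
have -> : 8 / be * F ^+ 2 = 3 / be * F ^+ 2 + 3 / be * F ^+ 2 + F ^+ 2 * (2 / be) by ring.
lra.
Qed.

End L2bound.

(** * Integrals against the oscillating phase *)

Lemma cvg_le_bound (R : realType) (x_ b_ : nat -> R) (x b : R) :
  x_ n @[n --> \oo] --> x -> b_ n @[n --> \oo] --> b ->
  (\forall n \near \oo, x_ n <= b_ n) -> x <= b.
Proof. by move=> cx cb H; apply: (ler_cvg_to cx cb). Qed.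

Lemma expX_expR (R : realType) (y : R) n : 0 <= y <= 1 ->
  `|(1 - y) ^+ n - expR (- (n%:R * y))| <= n%:R * y ^+ 2.
Proof.
move=> /andP[y0 y1].
have e1 : 1 - y <= expR (- y) by apply: expR_ge1Dx.
have e2 : expR (- y) * (1 + y) <= 1.
  by rewrite expRN mulrC ler_pdivrMr ?expR_gt0// mul1r expR_ge1Dx.
have e3 : expR (- y) <= 1 by rewrite -expR0 ler_expR oppr_le0.
have e0 := expR_gt0 (- y).
set u := 1 - y in e1 *; set v := expR (- y) in e1 e2 e3 e0 *.
have uv : `|u - v| <= y ^+ 2.
  by rewrite ler_norml; apply/andP; split; rewrite /u in e1 *; nra.
have -> : expR (- (n%:R * y)) = v ^+ n by rewrite -expRM_natl mulrN.
have u0 : 0 <= u by rewrite /u; lra.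
have u1 : u <= 1 by rewrite /u; lra.
elim: n => [|n IH]; first by rewrite !expr0 subrr normr0 mul0r.
rewrite (_ : _ - _ = u * (u ^+ n - v ^+ n) + (u - v) * v ^+ n); last by rewrite !exprS; ring.
rewrite (_ : n.+1%:R * y ^+ 2 = n%:R * y ^+ 2 + y ^+ 2); last by rewrite -natr1; ring.
apply: le_trans (ler_normD _ _) _; rewrite lerD// normrM.
  by rewrite (ger0_norm u0); apply: le_trans IH; rewrite ler_piMl.
by apply: le_trans uv; rewrite ler_piMr// ger0_norm ?exprn_ge0 ?exprn_ile1// ltW.
Qed.

Section Paths.
Context (R : realType) d (Omega : measurableType d) (P : probability Omega R).
Variable N : R -> {RV P >-> nat}.
Hypothesis hN : standard_poisson_process N.
Variable theta : R.
Notation phase := (angle N theta).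
Notation mu := (@lebesgue_measure R).

Definition tick (eps t : R) := 2 * t / eps ^+ 2.

Lemma tick_ge0 eps t : 0 < eps -> 0 <= t -> 0 <= tick eps t.
Proof. by move=> e0 t0; rewrite /tick; apply: divr_ge0; [exact: mulr_ge0|exact: exprn_ge0 (ltW e0)]. Qed.

Lemma ler_tick eps : 0 < eps -> {homo tick eps : s t / s <= t}.
Proof.
move=> e0 s t st; rewrite /tick ler_wpM2r ?invr_ge0 ?sqr_ge0//.
by rewrite ler_wpM2l.
Qed.

Lemma tick_cvg (G : R -> R) eps (w : Omega) t : 0 < eps -> 0 <= t ->
  G (phase (tick eps s) w) @[s --> t^'+] --> G (phase (tick eps t) w).
Proof.
move=> e0 t0; apply: cvg_near_cst.
have [eta /= eta0 He] := poisson_right_continuous hN.1 w (tick_ge0 e0 t0).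
exists (eta * eps ^+ 2 / 2) => /=; first by rewrite divr_gt0// mulr_gt0// exprn_gt0.
move=> s /= ds ts; rewrite /angle (He (tick eps s))//.
- rewrite /= /tick -mulrBl -mulrBr normrM normrM ger0_norm// (ger0_norm (x := _^-1)); last first.
    by rewrite invr_ge0 sqr_ge0.
  by rewrite ltr_pdivrMr ?exprn_gt0// mulrC -ltr_pdivlMr.
- by rewrite /tick ltr_pM2r ?invr_gt0 ?exprn_gt0// ltr_pM2l.
Qed.

Lemma tick_grid eps a b n j : tick eps (gridpt a b n j) =
  tick eps a + j%:R * tick eps ((b - a) / n.+1%:R).
Proof. by rewrite /tick /gridpt; ring. Qed.

Hypothesis ct1 : cos theta != 1.

(** The shift [phi] treats both noises at once: [phi = 0] gives the cosine
    and [phi = - (pi / 2)] the sine. *)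
Definition poisson_int (phi : R) (f : R -> R) (eps r : R) (w : Omega) : R :=
  2 / eps * \int[mu]_(s in `[0, r]) (f s * cos (phase (tick eps s) w + phi)).

Lemma weighted_sumE f phi h n w :
  weighted_sum N theta f phi h n w = \sum_(j < n) f j * cos (phase (j.+1%:R * h) w + phi).
Proof. by elim: n => [|n IH]; rewrite ?big_ord0// big_ord_recr /= IH. Qed.

(** On a grid with [n] cells the integral becomes a sum as in [discrete_L2],
    where [h] is of order 1 / (n eps^2), and the squared weight of a cell is
    of order 1 / (n eps^2) times the integral of [f ^+ 2] over it. The
    factors cancel. *)
Lemma poisson_int_L2 (phi : R) (f : R -> R) (eps r : R) : 0 < eps -> 0 < r ->
  mu.-integrable `[0, r] (EFin \o f) ->
  mu.-integrable `[0, r] (EFin \o (fun x => f x ^+ 2)) ->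
  bmf (poisson_int phi f eps r) /\
  \int[P]_w (poisson_int phi f eps r w ^+ 2) <= 16 / gap theta * \int[mu]_(s in `[0, r]) (f s ^+ 2).
Proof.
move=> e0 r0 fi f2i.
pose Y w s := cos (phase (tick eps s) w + phi).
have Yr w t : 0 <= t < r -> Y w s @[s --> t^'+] --> Y w t.
  by move=> /andP[t0 _]; exact: (@tick_cvg (fun x => cos (x + phi)) eps w t e0 t0).
pose F n w := 2 / eps * riemann_sum 0 r f (Y w) n.
have fi' : mu.-integrable `[0, r[ (EFin \o f).
  by apply: integrableS fi => // x /=; rewrite !in_itv/= => /andP[-> /ltW].
have f2i' : mu.-integrable `[0, r[ (EFin \o (fun x => f x ^+ 2)).
  by apply: integrableS f2i => // x /=; rewrite !in_itv/= => /andP[-> /ltW].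
have fai : mu.-integrable `[0, r[ (EFin \o (fun x => `|f x|)) := integrable_norm fi'.
have cel g n (j : 'I_n.+1) : mu.-integrable `[0, r[ (EFin \o g) -> mu.-integrable (cell 0 r n j) (EFin \o g).
  by move=> gi; apply: integrableS gi => //; [exact: measurable_cell|exact: cell_sub].
pose dl n := r / n.+1%:R.
have dl0 n : 0 < dl n by rewrite divr_gt0.
pose c n j := 2 / eps * \int[mu]_(x in cell 0 r n j) f x.
pose h n := tick eps (dl n).
have h0 n : 0 < h n by rewrite /h /tick divr_gt0 ?mulr_gt0// exprn_gt0.
have FE n w : F n w = weighted_sum N theta (c n) phi (h n) n.+1 w.
  rewrite weighted_sumE /F /riemann_sum mulr_sumr; apply: eq_bigr => j _.
  rewrite mulrA /c /Y tick_grid subr0 -/(dl n) -/(h n).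
  by rewrite {1}/tick mulr0 mul0r add0r.
have bF n : bmf (F n).
  have [_ [m B]] := past_weighted_sum N theta (c n) phi n.+1 (h0 n).
  have E : F n = weighted_sum N theta (c n) phi (h n) n.+1 by apply/funext => w; rewrite FE.
  by rewrite E; split.
pose M := 2 / eps * \int[mu]_(s in `[0, r[) `|f s|.
have FM n w : `|F n w| <= M.
  have e20 : 0 <= 2 / eps by rewrite divr_ge0// ltW.
  rewrite normrM (ger0_norm e20) /M ler_wpM2l// -(sum_cells n r0 fai).
  apply: le_trans (ler_norm_sum _ _ _) _; apply: ler_sum => j _.
  rewrite normrM -[leRHS]mulr1; apply: ler_pM => //; last exact: cos_max.
  by apply: le_normr_Rintegral; [exact: measurable_cell|exact: cel].
have cF w : F n w @[n --> \oo] --> poisson_int phi f eps r w.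
  apply: cvgMr.
  by have [] := riemann_sum_cvg r0 fi (fun t => cos_max _) (Yr w).
have [bI _] := Ex_bounded_cvg P (fun n => (bF n).1) FM cF; split=> //.
have [|n w|w|_ cE] := @Ex_bounded_cvg _ _ _ P (fun n w => F n w ^+ 2) (fun w => poisson_int phi f eps r w ^+ 2) (M ^+ 2).
- by move=> n; apply: measurable_funX; exact: (bF n).1.
- by rewrite normrX lerXn2r// nnegrE// (le_trans _ (FM n w)).
- exact: (cvgM (cF w) (cF w)).
apply: (cvg_le_bound cE (@cvg_cst _ _ _ _ _)).
have g0 := gap_gt0 ct1.
have hto0 : h n @[n --> \oo] --> (0 : R).
  have : (2 * r / eps ^+ 2) * n.+1%:R^-1 @[n --> \oo] --> (2 * r / eps ^+ 2) * 0.
    by apply: cvgMr; exact: cvg_harmonic.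
  rewrite mulr0; apply: cvg_trans; apply: near_eq_cvg; apply: nearW => n.
  by rewrite /h /tick /dl; ring.
have m0 : 0 < Num.min (1 / 2) (gap theta / 9) by rewrite lt_min; apply/andP; split; exact: divr_gt0.
have /cvgr0Pnorm_lt/(_ _ m0) := hto0; apply: filterS => n.
rewrite ger0_norm ?(ltW (h0 n))// lt_min => /andP[hn1 hn2].
have h01 : 0 < h n <= 1 / 2 by rewrite h0 ltW.
have := discrete_L2 hN ct1 (c n) phi n.+1 h01 (ltW hn2).
under eq_Rintegral do rewrite -FE.
move=> /le_trans; apply.
have csq (j : 'I_n.+1) : c n j ^+ 2 <= 4 / eps ^+ 2 * (dl n * \int[mu]_(x in cell 0 r n j) (f x ^+ 2)).
  rewrite /c exprMn (_ : (2 / eps) ^+ 2 = 4 / eps ^+ 2); last by rewrite expr_div_n -natrX.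
  rewrite ler_wpM2l ?divr_ge0 ?sqr_ge0//.
  have muc : mu (cell 0 r n j) = (dl n)%:E.
    rewrite /cell lebesgue_measure_itv/= lte_fin (gridpt_lt n r0 (ltnSn j)).
    by rewrite gridptS -EFinB addrAC subrr add0r subr0.
  have := @sqr_Rintegral_le _ (cell 0 r n j) f (measurable_cell _ _ _ _).
  by rewrite muc /= => -> //; [rewrite lte_fin dl0 ltry|exact: cel|exact: cel].
apply: le_trans (_ : 8 / (gap theta * h n) * \sum_(j < n.+1) (4 / eps ^+ 2 * (dl n * \int[mu]_(x in cell 0 r n j) (f x ^+ 2))) <= _).
  apply: ler_wpM2l; last by apply: ler_sum => j _; exact: csq.
  by apply: divr_ge0 => //; apply: mulr_ge0; exact: ltW.
rewrite -mulr_sumr -mulr_sumr (sum_cells n r0 f2i').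
rewrite Rintegral_itv_bndo_bndc// !mulrA /h /tick.
have dn0 := dl0 n; set x := dl n in dn0 *; set J := \int[mu]_(_ in _) _.
rewrite le_eqVlt; apply/orP; left; apply/eqP.
by field; rewrite !gt_eqF//= ?mulr_gt0.
Qed.

End Paths.

(** * Characteristic functions for piecewise constant integrands *)

Lemma mu_cell (R : realType) (a b : R) n j : a < b ->
  lebesgue_measure (cell a b n j) = ((b - a) / n.+1%:R)%:E.
Proof.
move=> ab; rewrite /cell lebesgue_measure_itv/= lte_fin (gridpt_lt n ab (ltnSn j)).
by rewrite gridptS -EFinB addrAC subrr add0r.
Qed.

Lemma Rintegral_cell1 (R : realType) (a b : R) n j : a < b ->
  \int[lebesgue_measure]_(x in cell a b n j) (1 : R) = (b - a) / n.+1%:R.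
Proof.
move=> ab; rewrite Rintegral_cst; last exact: measurable_cell.
by rewrite mul1r -[RHS]/(fine _%:E); congr fine; exact: mu_cell.
Qed.

Section PieceLimit.
Context (R : realType) d (Omega : measurableType d) (P : probability Omega R).
Variable N : R -> {RV P >-> nat}.
Hypothesis hN : standard_poisson_process N.
Variable theta : R.
Hypothesis ct1 : cos theta != 1.
Hypothesis ct2 : cos (theta *+ 2) != 1.
Notation phase := (angle N theta).
Notation mu := (@lebesgue_measure R).

Definition segment_int (a b eps x y : R) (w : Omega) : R :=
  2 / eps * \int[mu]_(s in `[x, y]) lobs a b (phase (tick eps s) w).

Lemma lobs_bounded a b (x : R) : `|lobs a b x| <= `|a| + `|b|.
Proof. by apply: le_trans (norm_lin _ _ (cos_max x) (sin_max x)) _; rewrite mulr1. Qed.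

Section Cvg.
Variables (a b eps x y : R).
Hypothesis (e0 : 0 < eps) (x0 : 0 <= x) (xy : x < y).

Let h n := tick eps ((y - x) / n.+1%:R).

Lemma phase_sum_cvg (A : Omega -> R) w :
  phase_sum N theta a b eps (tick eps x) (h n) A n.+1 w @[n --> \oo] --> A w + segment_int a b eps x y w.
Proof.
pose Y s := lobs a b (phase (tick eps s) w).
have Yr t : x <= t < y -> Y s @[s --> t^'+] --> Y t.
  by move=> /andP[t0 _]; apply: (@tick_cvg _ _ _ _ _ hN theta (lobs a b) eps w t e0); exact: le_trans t0.
have i1 : mu.-integrable `[x, y] (EFin \o (fun=> 1 : R)).
  apply: continuous_compact_integrable; first exact: segment_compact.
  by apply: continuous_subspaceT => t; exact: cvg_cst.
have [_ cY] := riemann_sum_cvg xy i1 (fun t => lobs_bounded a b _) Yr.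
have E n : phase_sum N theta a b eps (tick eps x) (h n) A n.+1 w = A w + 2 / eps * riemann_sum x y (fun=> 1) Y n.
  have -> m : phase_sum N theta a b eps (tick eps x) (h n) A m w =
     A w + \sum_(j < m) eps * h n * lobs a b (phase (tick eps x + j.+1%:R * h n) w).
    elim: m => [|m IH]; first by rewrite big_ord0 addr0.
    by rewrite big_ord_recr /= IH addrA.
  congr (_ + _); rewrite /riemann_sum mulr_sumr; apply: eq_bigr => j _.
  rewrite (Rintegral_cell1 _ _ xy) /Y tick_grid -/(h n) [RHS]mulrA; congr (_ * _).
  have q0 : n.+1%:R != 0 :> R by rewrite pnatr_eq0.
  rewrite /h /tick; set q := n.+1%:R in q0 *.
  by field; rewrite ?q0 ?gt_eqF.
apply: cvg_trans (_ : A w + 2 / eps * riemann_sum x y (fun=> 1) Y n @[n --> \oo] --> _).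
  by apply: near_eq_cvg; apply: nearW => n; rewrite E.
apply: cvgD; first exact: cvg_cst.
rewrite /segment_int; apply: cvgMr.
rewrite (_ : \int[mu]_(s in `[x, y]) lobs a b (phase (tick eps s) w) = \int[mu]_(s in `[x, y]) (1 * Y s))//.
by apply: eq_Rintegral => s _; rewrite mul1r.
Qed.

Let h0 n : 0 < h n.
Proof. by rewrite /h /tick divr_gt0 ?exprn_gt0// mulr_gt0// divr_gt0// subr_gt0. Qed.

Let hn n : n.+1%:R * h n = tick eps (y - x).
Proof. by rewrite /h /tick; field; rewrite gt_eqF//= pnatr_eq0. Qed.

Lemma past_segment (A : Omega -> R) : past_measurable N (tick eps x) A ->
  past_measurable N (tick eps y) (fun w => A w + segment_int a b eps x y w).
Proof.
move=> pA.
apply: (@measurable_fun_cvg _ (g_sigma_algebraType (past_gen N (tick eps y))) R setT (fun n => phase_sum N theta a b eps (tick eps x) (h n) A n.+1)).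
  move=> n; have := past_phase_sum theta a b eps (n := n.+1) (tick_ge0 e0 x0) (h0 n) pA.
  rewrite hn (_ : _ + _ = tick eps y)//.
  by rewrite /tick -mulrDl -mulrDr addrC subrK.
by move=> w _; exact: phase_sum_cvg.
Qed.

(** In [piece_discrete] the terms of order [h ^+ 2] per step vanish with the
    mesh, while the number of steps times [h] is the length of the segment on
    the clock [tick], of order 1 / eps^2: the term in [e ^+ 3] and the cost
    at the two ends are both of order [eps]. *)
Lemma segment_limit (A : Omega -> R) : eps <= 1 -> past_measurable N (tick eps x) A ->
  `|\int[P]_w cos (A w + segment_int a b eps x y w)
    - expR (- ((a ^+ 2 + b ^+ 2) * (y - x) / 2)) * \int[P]_w cos (A w)|
  <= (4 * bound_const theta a b + 6 * bound_const theta a b ^+ 2 * (y - x)) * eps.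
Proof.
move=> e1 pA; set K := bound_const theta a b.
have e01 : 0 < eps <= 1 by rewrite e0.
have [_ _ _ /andP[rate0 _]] := norm_corr theta a b 0.
pose F n := phase_sum N theta a b eps (tick eps x) (h n) A n.+1.
pose I := \int[P]_w cos (A w + segment_int a b eps x y w).
have pF n : past_measurable N (tick eps x + n.+1%:R * h n) (F n).
  exact: (past_phase_sum theta a b eps (n := n.+1) (tick_ge0 e0 x0) (h0 n) pA).
have cI : \int[P]_w cos (F n w) @[n --> \oo] --> I.
  have [] := @Ex_bounded_cvg _ _ _ P (fun n w => cos (F n w)) (fun w => cos (A w + segment_int a b eps x y w)) 1.
  - by move=> n; apply: (bmf_cos _).1; exact: past_measurableW (pF n).
  - by move=> n w; exact: cos_max.
  - by move=> w; apply: continuous_cvg; [exact: continuous_cos|exact: phase_sum_cvg].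
  - by [].
set Y := tick eps (y - x); have hnY n : n.+1%:R * h n = Y := hn n.
have hto0 : h n @[n --> \oo] --> (0 : R).
  have : Y * n.+1%:R^-1 @[n --> \oo] --> Y * 0.
    by apply: cvgMr; exact: cvg_harmonic.
  rewrite mulr0; apply: cvg_trans; apply: near_eq_cvg; apply: nearW => n.
  by rewrite -(hnY n) mulrAC mulfV ?pnatr_eq0// mul1r.
set c := expR _; set A0 := \int[P]_w cos (A w).
have A01 : `|A0| <= 1.
  by apply: le_norm_Ex => [|w]; [exact: bmf_cos (past_measurableW pA)|exact: cos_max].
have cN : `|\int[P]_w cos (F n w) - c * A0| @[n --> \oo] --> `|I - c * A0|.
  by apply: cvg_norm; apply: cvgB => //; exact: cvg_cst.
pose B n := 4 * K * eps + Y * (3 * K ^+ 2 * eps ^+ 3) + (Y * (18 * K ^+ 3) + Y * (eps ^+ 2 * rate a b) ^+ 2) * h n.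
have cB : B n @[n --> \oo] --> 4 * K * eps + Y * (3 * K ^+ 2 * eps ^+ 3).
  rewrite -[X in _ --> X]addr0; apply: cvgD; first exact: cvg_cst.
  by rewrite -(mulr0 (Y * (18 * K ^+ 3) + Y * (eps ^+ 2 * rate a b) ^+ 2)); exact: cvgMr.
rewrite (_ : (4 * K + _) * eps = 4 * K * eps + Y * (3 * K ^+ 2 * eps ^+ 3)); last first.
  by rewrite /Y /tick; field; rewrite gt_eqF.
apply: (cvg_le_bound cN cB).
have r0 : 0 < (1 + rate a b)^-1 by rewrite invr_gt0 ltr_pwDl.
have /cvgr0Pnorm_lt/(_ _ r0) := hto0; apply: filterS => n.
rewrite (ger0_norm (ltW (h0 n))) => hr.
have ehr : (1 + rate a b) * h n <= 1 by rewrite mulrC -ler_pdivlMr ?ltr_pwDl// mul1r ltW.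
have rh0 : 0 <= rate a b * h n by rewrite mulr_ge0// ltW.
have h1 : h n <= 1 by lra.
have e2 : eps ^+ 2 <= 1 by rewrite exprn_ile1// ltW.
have e20 : 0 <= eps ^+ 2 by exact: sqr_ge0.
have yle : eps ^+ 2 * rate a b * h n <= 1.
  have h2 : rate a b * h n <= 1 by have := h0 n; lra.
  by rewrite -mulrA; apply: le_trans h2; rewrite ler_piMl.
have h01 : 0 < h n <= 1 by rewrite h0.
have := piece_discrete hN ct1 ct2 e01 n.+1 (tick_ge0 e0 x0) h01 yle pA.
rewrite -/K -/A0 -/(F n).
have y01 : 0 <= eps ^+ 2 * rate a b * h n <= 1 by rewrite yle -mulrA mulr_ge0.
have := expX_expR n.+1 y01.
have -> : expR (- (n.+1%:R * (eps ^+ 2 * rate a b * h n))) = c.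
  congr (expR (- _)); rewrite mulrCA [n.+1%:R * _]mulrC mulrA.
  rewrite -[eps ^+ 2 * rate a b * h n * n.+1%:R]mulrA [h n * _]mulrC.
  by rewrite hnY /Y /tick /rate; field; rewrite gt_eqF.
set u := (1 - _) ^+ _; set Cn := \int[P]_w cos (F n w).
move=> uc CnA.
have -> : Cn - c * A0 = (Cn - u * A0) + (u - c) * A0 by ring.
have t2 : `|(u - c) * A0| <= n.+1%:R * (eps ^+ 2 * rate a b * h n) ^+ 2.
  by rewrite normrM; apply: le_trans uc; rewrite ler_piMr.
apply: le_trans (ler_normD _ _) _; apply: le_trans (lerD CnA t2) _.
rewrite /B -(hnY n) le_eqVlt; apply/orP; left; apply/eqP; ring.
Qed.
End Cvg.

(** The grid [r] may have repeated points, as it will come from merging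
    several subdivisions. *)
Fixpoint steps_int (r : nat -> R) (a b : nat -> R) (eps phi : R) (m : nat) : Omega -> R :=
  if m is k.+1 then
    fun w => steps_int r a b eps phi k w + segment_int (a k) (b k) eps (r k) (r k.+1) w
  else cst phi.

Lemma past_steps (r a b : nat -> R) eps phi m : 0 < eps -> 0 <= r 0%N ->
  {homo r : i j / (i <= j)%N >-> i <= j} ->
  past_measurable N (tick eps (r m)) (steps_int r a b eps phi m).
Proof.
move=> e0 r0 rh; elim: m => [|m IH]; first exact: measurable_cst.
have rm : 0 <= r m by apply: le_trans (rh _ _ (leq0n m)).
have := rh _ _ (leqnSn m); rewrite le_eqVlt => /predU1P[E|lt].
  rewrite -E /=; under eq_fun do rewrite /segment_int -E set_itv1 Rintegral_set1 mulr0 addr0.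
  exact: IH.
exact: past_segment.
Qed.

(** Each segment multiplies the expectation by its Gaussian factor, because
    the argument accumulated before it belongs to the past. *)
Lemma steps_limit (r a b : nat -> R) phi m : 0 <= r 0%N ->
  {homo r : i j / (i <= j)%N >-> i <= j} ->
  exists C, forall eps, 0 < eps <= 1 ->
  `|\int[P]_w cos (steps_int r a b eps phi m w)
   - expR (- (\sum_(k < m) (a k ^+ 2 + b k ^+ 2) * (r k.+1 - r k)) / 2) * cos phi| <= C * eps.
Proof.
move=> r0 rh; elim: m => [|m [C IH]].
  exists 0 => eps _; rewrite big_ord0 oppr0 mul0r expR0 mul1r mul0r /=.
  by rewrite Ex_cst subrr normr0.
have rm : 0 <= r m by apply: le_trans (rh _ _ (leq0n m)).
pose K := bound_const theta (a m) (b m).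
exists (C + (4 * K + 6 * K ^+ 2 * (r m.+1 - r m))) => eps e01.
have /andP[e0 e1] := e01; have {}IH := IH _ e01.
rewrite big_ord_recr /=.
set S := \sum_(_ < _) _ in IH *; set I := \int[P]_w cos (steps_int _ _ _ _ _ _ w) in IH *.
set v := (a m ^+ 2 + b m ^+ 2) * (r m.+1 - r m).
have rle := rh _ _ (leqnSn m).
have v0 : 0 <= v by rewrite mulr_ge0 ?subr_ge0// addr_ge0 ?sqr_ge0.
have K1 : 1 <= K by exact: bound_const_ge1.
have H : `|\int[P]_w cos (steps_int r a b eps phi m w + segment_int (a m) (b m) eps (r m) (r m.+1) w)
   - expR (- (v / 2)) * I| <= (4 * K + 6 * K ^+ 2 * (r m.+1 - r m)) * eps.
  move: rle; rewrite le_eqVlt => /predU1P[E|lt].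
    rewrite /v -E subrr !mulr0 mul0r oppr0 expR0 mul1r addr0.
    rewrite (_ : \int[P]_w _ = I) ?subrr ?normr0//.
      apply: mulr_ge0; last exact: ltW.
      by rewrite ?mulr0 ?addr0 mulr_ge0// (le_trans ler01).
    by apply: eq_Rintegral => w _; rewrite /segment_int set_itv1 Rintegral_set1 mulr0 addr0.
  by have := segment_limit (a m) (b m) e0 rm lt e1 (past_steps a b phi (m := m) e0 r0 rh).
set J := \int[P]_w _ in H *.
have -> : - (S + v) / 2 = - (v / 2) + - S / 2 by field.
rewrite expRD.
set ev := expR (- (v / 2)) in H *; set es := expR (- S / 2) in IH *.
have ev1 : ev <= 1 by rewrite /ev -expR0 ler_expR oppr_le0 divr_ge0.
have ev0 : 0 <= ev by exact: expR_ge0.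
have -> : J - ev * es * cos phi = (J - ev * I) + ev * (I - es * cos phi) by ring.
rewrite [leRHS]mulrDl [leRHS]addrC; apply: le_trans (ler_normD _ _) (lerD H _).
by rewrite normrM (ger0_norm ev0); apply: le_trans IH; rewrite ler_piMl.
Qed.

End PieceLimit.

(** * The Gaussian characteristic function *)

Section GaussChar.
Context (R : realType).
Notation mu := (@lebesgue_measure R).
Variable sg : R.
Hypothesis sg0 : 0 < sg.
Let s2 : R := Num.sqrt 2.
Let p := normal_pdf (0 : R) sg.
Let p2 := normal_pdf (0 : R) (s2 * sg).

Let sgN0 : sg != 0. Proof. by rewrite gt_eqF. Qed.
Let s2N0 : s2 * sg != 0. Proof. by rewrite mulf_neq0// /s2 sqrtr_eq0 -ltNge. Qed.

Let pE x : p x = normal_peak sg * expR (- (x ^+ 2 / (sg ^+ 2 *+ 2))).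
Proof. by rewrite /p normal_pdfE// /normal_fun subr0 mulNr. Qed.

Lemma integral_normal_prob (f : R -> \bar R) : measurable_fun setT f ->
  (\int[normal_prob 0 sg]_x `|f x| < +oo)%E ->
  (\int[normal_prob 0 sg]_x f x = \int[mu]_x (f x * (normal_pdf 0 sg x)%:E))%E.
Proof.
move=> mf finf.
rewrite -(Radon_Nikodym_change_of_variables (normal_prob_dominates 0 sg))//=; last first.
  by apply/integrableP; split.
apply: ae_eq_integral => //.
- apply: emeasurable_funM => //; apply: (measurable_int mu).
  apply: (integrableS _ _ (@subsetT _ _)) => //=.
  by apply: Radon_Nikodym_integrable; exact: normal_prob_dominates.
- apply: emeasurable_funM => //=; apply/measurableT_comp => //=.
  by apply/measurable_funTS; exact: measurable_normal_pdf.
- apply: ae_eqe_mul2l => /=.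
  rewrite Radon_NikodymE//=; first exact: normal_prob_dominates.
  move=> abmu.
  case: cid => /= h [h1 h2 h3].
  apply: integral_ae_eq => //=.
  + by apply/measurable_funTS/measurableT_comp =>//; exact: measurable_normal_pdf.
  + by move=> E E01 mE; rewrite -h3.
Qed.

Let p_ge0 x : 0 <= p x. Proof. exact: normal_pdf_ge0. Qed.
Let mp : measurable_fun setT p. Proof. exact: measurable_normal_pdf. Qed.
Let ip : mu.-integrable setT (EFin \o p). Proof. exact: integrable_normal_pdf. Qed.

(** As [y * exp (- y) <= 1], a factor [x ^+ 2] is absorbed by half of the
    exponent, which leaves a Gaussian density of larger variance. *)
Lemma sqr_pdf_le : exists2 K, 0 <= K & forall x, x ^+ 2 * p x <= K * p2 x.
Proof.
have P0 := normal_peak_gt0 s2N0.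
exists (normal_peak sg * (4 * sg ^+ 2) / normal_peak (s2 * sg)).
  apply: divr_ge0; last exact: normal_peak_ge0.
  by rewrite mulr_ge0 ?normal_peak_ge0// mulr_ge0// sqr_ge0.
move=> x; rewrite pE /p2 normal_pdfE// /normal_fun subr0 mulNr.
set pk := normal_peak (_ * _) in P0 *.
rewrite exprMn sqr_sqrtr//.
set y := x ^+ 2 / (4 * sg ^+ 2).
have s20 : sg ^+ 2 != 0 by rewrite expf_neq0.
have -> : x ^+ 2 / ((2 * sg ^+ 2) *+ 2) = y by rewrite /y; congr (_ / _); ring.
have -> : x ^+ 2 / (sg ^+ 2 *+ 2) = y + y by rewrite /y -(mulr_natl (sg ^+ 2)); field.
have -> : x ^+ 2 = 4 * sg ^+ 2 * y by rewrite /y; field.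
rewrite opprD expRD.
have -> : normal_peak sg * (4 * sg ^+ 2) / pk * (pk * expR (- y)) = normal_peak sg * (4 * sg ^+ 2) * expR (- y).
  by rewrite mulrA divfK// gt_eqF.
rewrite [leLHS](_ : _ = normal_peak sg * (4 * sg ^+ 2) * expR (- y) * (y * expR (- y))); last by ring.
rewrite ler_piMr//.
  by apply: mulr_ge0; [apply: mulr_ge0; [exact: normal_peak_ge0|apply: mulr_ge0 => //; exact: sqr_ge0]|exact: expR_ge0].
rewrite expRN ler_pdivrMr ?expR_gt0// mul1r; apply: le_trans (expR_ge1Dx y).
by rewrite lerDr.
Qed.

Let ip2 : mu.-integrable setT (EFin \o p2). Proof. exact: integrable_normal_pdf. Qed.

Let isq : mu.-integrable setT (EFin \o (fun x => x ^+ 2 * p x)).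
Proof.
have [K K0 KP] := sqr_pdf_le.
apply: (integrable_bounded_by _ _ _ (integrable_scale K _ ip2)) => // [|x _].
  by apply: measurable_funM => //; exact: measurable_funX.
by rewrite ger0_norm// mulr_ge0 ?sqr_ge0.
Qed.

Let ipsq : mu.-integrable setT (EFin \o (fun x => (1 + x ^+ 2) * p x)).
Proof.
apply: (integrable_bounded_by _ _ _ (integrable_add measurableT ip isq)) => // [|x _].
  by apply: measurable_funM => //; apply: measurable_funD => //; exact: measurable_funX.
by rewrite ger0_norm ?mulr_ge0 ?addr_ge0 ?sqr_ge0// mulrDl mul1r.
Qed.

Let idom (f : R -> R) C : measurable_fun setT f -> (forall x, `|f x| <= C * (1 + x ^+ 2)) ->
  mu.-integrable setT (EFin \o (fun x => f x * p x)).
Proof.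
move=> mf fC.
apply: (integrable_bounded_by _ _ _ (integrable_scale C _ ipsq)) => // [|x _]; first exact: measurable_funM.
by rewrite normrM (ger0_norm (p_ge0 x)) mulrA ler_wpM2r.
Qed.

Variable phi : R.
Definition gauss_cos (a : R) := \int[mu]_x (cos (a * x + phi) * p x).
Definition gauss_xsin (a : R) := \int[mu]_x (x * sin (a * x + phi) * p x).

Let mlin a : measurable_fun setT (fun x : R => a * x + phi).
Proof. by apply: measurable_funD => //; exact: measurable_funM. Qed.
Let mcos a : measurable_fun setT (fun x : R => cos (a * x + phi)).
Proof. exact: continuous_measurableT (@continuous_cos R) (mlin a). Qed.
Let msin a : measurable_fun setT (fun x : R => sin (a * x + phi)).
Proof. exact: continuous_measurableT (@continuous_sin R) (mlin a). Qed.

Let idom1 (f : R -> R) : measurable_fun setT f -> (forall x, `|f x| <= 1 + x ^+ 2) ->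
  mu.-integrable setT (EFin \o (fun x => f x * p x)).
Proof. by move=> mf h; apply: (idom (C := 1)) => // x; rewrite mul1r. Qed.

Let xle (x : R) : `|x| <= 1 + x ^+ 2.
Proof.
have := sqr_ge0 (`|x| - 1); rewrite -(@real_normK _ x) ?num_real//; have := normr_ge0 x; nra.
Qed.

Let icos a : mu.-integrable setT (EFin \o (fun x => cos (a * x + phi) * p x)).
Proof.
apply: idom1 => [|x]; first exact: mcos.
apply: le_trans (cos_max _) _.
by rewrite lerDl sqr_ge0.
Qed.

Let ixsin a : mu.-integrable setT (EFin \o (fun x => x * sin (a * x + phi) * p x)).
Proof.
apply: idom1 => [|x]; first by apply: measurable_funM => //; exact: msin.
rewrite normrM; apply: le_trans (xle x).
by rewrite ler_piMr// sin_max.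
Qed.

(** The second-order remainder of the cosine is integrable against the
    density, which has a finite second moment. *)
Lemma is_derive_gauss_cos (a : R) : is_derive a 1 gauss_cos (- gauss_xsin a).
Proof.
set M := \int[mu]_x (x ^+ 2 * p x).
have est h : `|gauss_cos (a + h) - gauss_cos a + h * gauss_xsin a| <= h ^+ 2 * M.
  have iB : mu.-integrable setT (EFin \o (fun x => cos ((a + h) * x + phi) * p x - cos (a * x + phi) * p x)).
    by apply: integrable_sub => //; exact: icos.
  have iZ : mu.-integrable setT (EFin \o (fun x => h * (x * sin (a * x + phi) * p x))).
    by apply: integrable_scale => //; exact: ixsin.
  have -> : gauss_cos (a + h) - gauss_cos a + h * gauss_xsin a =
    \int[mu]_x ((cos ((a + h) * x + phi) * p x - cos (a * x + phi) * p x) + h * (x * sin (a * x + phi) * p x)).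
    by rewrite RintegralD// RintegralB// RintegralZl.
  have iD := integrable_add measurableT iB iZ.
  apply: le_trans (le_normr_Rintegral _ iD) _ => //.
  have -> : h ^+ 2 * M = \int[mu]_x (h ^+ 2 * (x ^+ 2 * p x)) by rewrite RintegralZl//; exact: isq.
  apply: le_Rintegral => //.
  - exact: integrable_abs iD.
  - by apply: integrable_scale => //; exact: isq.
  - move=> x _; have -> : (a + h) * x + phi = (a * x + phi) + h * x by ring.
    rewrite [X in `|X|](_ : _ = (cos ((a * x + phi) + h * x) - cos (a * x + phi) + h * x * sin (a * x + phi)) * p x); last by ring.
    rewrite normrM (ger0_norm (p_ge0 x)) mulrA ler_wpM2r//.
    by apply: le_trans (cos_taylor _ _) _; rewrite exprMn.
have M0 : 0 <= M by apply: Rintegral_ge0 => x _; rewrite mulr_ge0 ?sqr_ge0.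
have lim : h^-1 *: (gauss_cos (h *: 1 + a) - gauss_cos a) @[h --> 0^'] --> - gauss_xsin a.
  apply/cvgrPdist_lt => e e0.
  have d0 : 0 < e / (M + 1) by rewrite divr_gt0// ltr_pwDr.
  exists (e / (M + 1)) => //= h hd hn0.
  have {}hd : `|h| < e / (M + 1) by move: hd; rewrite /ball_ /= sub0r normrN.
  rewrite scaler1 [h + a]addrC.
  rewrite (_ : - gauss_xsin a - _ = - (h^-1 * (gauss_cos (a + h) - gauss_cos a + h * gauss_xsin a))); last first.
    by rewrite (_ : forall u : R, h^-1 *: (u : R^o) = h^-1 * u)//; field.
  rewrite normrN normrM normfV ltr_pdivrMl ?normr_gt0//.
  apply: le_lt_trans (est h) _.
  rewrite -(@real_normK _ h) ?num_real// expr2 -mulrA ltr_pM2l ?normr_gt0//.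
  move: hd; rewrite ltr_pdivlMr ?ltr_pwDr//; have := normr_ge0 h; nra.
by split; [apply/cvg_ex; exists (- gauss_xsin a)|exact: cvg_lim].
Qed.

Let dp (x : R) : is_derive x 1 p (- (x / sg ^+ 2) * p x).
Proof.
have -> : p = fun x => normal_peak sg * expR (- (x ^+ 2 / (sg ^+ 2 *+ 2))) by apply/funext => z; exact: pE.
have s20 : sg ^+ 2 != 0 by rewrite expf_neq0.
have d1 : is_derive x 1 (fun z : R => - (z ^+ 2 / (sg ^+ 2 *+ 2))) (- (x / sg ^+ 2)).
  apply: is_derive_eq; rewrite -(mulr_natl (sg ^+ 2)) /GRing.scale /=; by field.
have d2 := @is_derive1_comp _ expR (fun z : R => - (z ^+ 2 / (sg ^+ 2 *+ 2))) x _ _ (is_derive_expR _) d1.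
by apply: is_derive_eq; rewrite /GRing.scale /=; ring.
Qed.

Let dF (a x : R) : is_derive x 1 (fun x => p x * sin (a * x + phi))
  (- (sg ^+ 2)^-1 * (x * sin (a * x + phi) * p x) + a * (cos (a * x + phi) * p x)).
Proof.
have d1 : is_derive x 1 (fun z : R => a * z + phi) a.
  by apply: is_derive_eq; rewrite /GRing.scale /= mulr1 addr0.
have d2 := @is_derive1_comp _ sin (fun z : R => a * z + phi) x _ _ (is_derive_sin _) d1.
have := dp x => dpx.
by apply: is_derive_eq; rewrite /GRing.scale /=; ring.
Qed.

(** Integration by parts, as the derivative of the density is [- x / sg ^+ 2]
    times the density. On [-b, b] the boundary terms are of order [1 / b]. *)
Lemma gauss_xsinE a : gauss_xsin a = sg ^+ 2 * a * gauss_cos a.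
Proof.
pose f x := - (sg ^+ 2)^-1 * (x * sin (a * x + phi) * p x) + a * (cos (a * x + phi) * p x).
have i1 := integrable_scale (- (sg ^+ 2)^-1) measurableT (ixsin a).
have i2 := integrable_scale a measurableT (icos a).
have fi : mu.-integrable setT (EFin \o f) := integrable_add measurableT i1 i2.
have s20 : sg ^+ 2 != 0 by rewrite expf_neq0.
suff f0 : \int[mu]_x f x = 0.
  move: f0; rewrite /f RintegralD// RintegralZl// RintegralZl//.
  rewrite -/(gauss_xsin a) -/(gauss_cos a) => h.
  have -> : gauss_xsin a = sg ^+ 2 * ((sg ^+ 2)^-1 * gauss_xsin a) by rewrite mulrA mulfV// mul1r.
  by rewrite -mulrA; congr (_ * _); lra.
pose b n : R := n.+1%:R.
have b0 n : 0 < b n by rewrite ltr0n.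
pose D n : set R := `[- b n, b n]%classic.
have mD n : measurable (D n) by exact: measurable_itv.
have mf : measurable_fun setT f := integrable_measurable fi.
have cvgfD (x : R) : (f \_ (D n)) x @[n --> \oo] --> f x.
  apply: cvg_near_cst.
  exists (Num.truncn `|x|) => // n /= xn.
  rewrite patchE mem_set// /D /= in_itv/= -ler_norml.
  have h := truncnS_gt `|x|; apply: ltW; apply: lt_le_trans h _.
  by rewrite ler_nat ltnS.
have fle n x : `|(f \_ (D n)) x| <= `|f x|.
  by rewrite patchE; case: ifPn => // _; rewrite normr0 normr_ge0.
have mfD n : measurable_fun setT (f \_ (D n)).
  by apply/(measurable_restrictT f (mD n)); exact: measurable_funTS.
have [_ cI] := @Rintegral_dominated_cvg _ _ _ mu setT (fun n => f \_ (D n)) f (fun x => `|f x|) measurableT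
  mfD (fun x _ => cvgfD x) (integrable_abs measurableT fi) (fun n x _ => fle n x).
have IE n : \int[mu]_x (f \_ (D n)) x = p (b n) * sin (a * b n + phi) - p (- b n) * sin (a * (- b n) + phi).
  rewrite -Rintegral_mkcond /D /Rintegral.
  have lt : - b n < b n by rewrite gt0_cp.
  have dF' x := dF a x.
  have cF : continuous (fun x => p x * sin (a * x + phi)).
    by move=> x; apply/differentiable_continuous/derivable1_diffP; case: (dF a x).
  rewrite (continuous_FTC2 (F := fun x => p x * sin (a * x + phi)) lt)//.
  - apply: continuous_subspaceT => x; rewrite /f.
    have cp : {for x, continuous p}.
      by apply/differentiable_continuous/derivable1_diffP; case: (dp x).
    have cl : a * z + phi @[z --> x] --> a * x + phi.
      by apply: cvgD; [apply: cvgMr; exact: cvg_id|exact: cvg_cst].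
    apply: cvgD; apply: cvgM; try exact: cvg_cst; apply: cvgM => //; try exact: cvg_cst.
      by apply: cvgM; [exact: cvg_id|apply: continuous_cvg; [exact: continuous_sin|]].
    by apply: continuous_cvg; [exact: continuous_cos|].
  - split => [x _||]; first by case: (dF a x).
      by apply: cvg_at_right_filter; exact: cF.
    by apply: cvg_at_left_filter; exact: cF.
  - by move=> x _; rewrite derive1E; case: (dF a x).
have [K K0 KP] := sqr_pdf_le.
have pb n : `|\int[mu]_x (f \_ (D n)) x| <= 2 * (K * normal_peak (s2 * sg)) * (b n)^-1.
  have b1 : 1 <= b n by rewrite ler1n.
  have h (y : R) : `|y| = b n -> p y <= K * normal_peak (s2 * sg) * (b n)^-1.
    move=> yb; rewrite ler_pdivlMr//.
    apply: le_trans (_ : y ^+ 2 * p y <= _).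
      rewrite mulrC ler_wpM2r// -real_normK ?num_real// yb expr2.
      by rewrite ler_peMl// ltW.
    by apply: le_trans (KP y) _; rewrite ler_wpM2l// normal_pdf_ub.
  rewrite IE; apply: le_trans (ler_normB _ _) _.
  rewrite (_ : 2 * _ * _ = K * normal_peak (s2 * sg) * (b n)^-1 + K * normal_peak (s2 * sg) * (b n)^-1); last by ring.
  apply: lerD; rewrite normrM (ger0_norm (p_ge0 _)).
    by apply: le_trans (h (b n) _); [rewrite ler_piMr// sin_max|rewrite ger0_norm// ltW].
  by apply: le_trans (h (- b n) _); [rewrite ler_piMr// sin_max|rewrite normrN ger0_norm// ltW].
apply/eqP; rewrite -normr_le0.
apply: (ler_cvg_to (cvg_norm cI) (_ : 2 * (K * normal_peak (s2 * sg)) * (b n)^-1 @[n --> \oo] --> 0)).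
  rewrite -[X in _ --> X](mulr0 (2 * (K * normal_peak (s2 * sg)))); apply: cvgMr; exact: cvg_harmonic.
by apply: nearW => n; exact: pb.
Qed.

(** The two previous lemmas give the differential equation y' = - sg ^+ 2 * a
    * y. *)
Lemma gauss_cosE a : gauss_cos a = expR (- (sg ^+ 2 * a ^+ 2 / 2)) * cos phi.
Proof.
pose U (a : R) := gauss_cos a * expR (sg ^+ 2 * a ^+ 2 / 2).
have dU (x : R) : is_derive x 1 U 0.
  have d1 : is_derive x 1 (fun z : R => sg ^+ 2 * z ^+ 2 / 2) (sg ^+ 2 * x).
    by apply: is_derive_eq; rewrite /GRing.scale /=; field.
  have d2 := @is_derive1_comp _ expR (fun z : R => sg ^+ 2 * z ^+ 2 / 2) x _ _ (is_derive_expR _) d1.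
  have d3 := is_derive_gauss_cos x; rewrite gauss_xsinE in d3.
  by apply: is_derive_eq; rewrite /GRing.scale /=; ring.
have [c _] := MVT_all 0 a dU; rewrite mul0r => /eqP; rewrite subr_eq0 => /eqP.
rewrite /U (expr0n _ 2) /= mulr0 mul0r expR0 mulr1 => E.
have -> : gauss_cos a = gauss_cos a * expR (sg ^+ 2 * a ^+ 2 / 2) * expR (- (sg ^+ 2 * a ^+ 2 / 2)).
  by rewrite -mulrA -expRD subrr expR0 mulr1.
rewrite E mulrC; congr (_ * _).
rewrite /gauss_cos (_ : \int[mu]_x _ = \int[mu]_x (cos phi * p x)); last first.
  by apply: eq_Rintegral => x _; rewrite mul0r add0r.
rewrite RintegralZl//.
by rewrite /Rintegral integral_normal_pdf /= mulr1.
Qed.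

Lemma normal_prob_cos a : \int[normal_prob 0 sg]_x cos (a * x + phi) = expR (- (sg ^+ 2 * a ^+ 2 / 2)) * cos phi.
Proof.
rewrite -gauss_cosE /gauss_cos /Rintegral integral_normal_prob.
- by congr fine; apply: eq_integral => x _; rewrite EFinM.
- by apply/measurable_EFinP; exact: mcos.
- have := bmf_integrable (normal_prob 0 sg) (bmf_cos (mlin a)).
  by case/integrableP.
Qed.

End GaussChar.

(** * Brownian increments *)

Section PastOfFamily.
Context d (Omega : measurableType d) (R : realType) (P : probability Omega R).
Variables (n : nat) (Y : nat -> {RV P >-> R}).
Hypothesis indY : independent_family P (fun (i : 'I_n.+1) w => Y i w).

Definition family_gen : set (set Omega) :=
  [set A | exists2 B : nat -> set R, forall i, measurable (B i)
    & A = [set w | forall i, (i < n)%N -> B i (Y i w)]].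

Lemma family_genI : setI_closed family_gen.
Proof.
move=> A1 A2 [B1 mB1 ->] [B2 mB2 ->]; exists (fun i => B1 i `&` B2 i).
  by move=> i; exact: measurableI.
apply/seteqP; split => w /=; first by move=> [h1 h2] i il; split; [exact: h1|exact: h2].
by move=> h; split => i il; case: (h i il).
Qed.

Lemma measurable_pre (i : nat) (B : set R) : measurable B -> measurable (Y i @^-1` B).
Proof. by move=> mB; rewrite -[X in measurable X]setTI; exact: measurable_funPT. Qed.

Lemma family_gen_measurable : family_gen `<=` measurable.
Proof.
move=> A [B mB ->].
rewrite (_ : [set w | _] = \bigcap_(i in [set i | (i < n)%N]) (Y i @^-1` B i)).
  by apply: bigcap_measurableType => i _; exact: measurable_pre.
by apply/seteqP; split.
Qed.

(** The product rule for all families of Borel sets, once with [E] and once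
    with the whole line in the last place. *)
Lemma family_gen_indep A (E : set R) : measurable E -> family_gen A -> indep_sets P A (Y n @^-1` E).
Proof.
move=> mE [B mB AE].
have mA : measurable A by apply: family_gen_measurable; exists B.
have key (E' : set R) : measurable E' ->
    fine (P (A `&` Y n @^-1` E')) = \prod_(i < n) fine (P (Y i @^-1` B i)) * fine (P (Y n @^-1` E')).
  move=> mE'; pose B' (i : 'I_n.+1) := if (i < n)%N then B i else E'.
  have mB' i : measurable (B' i) by rewrite /B'; case: ifP.
  have Bn : B' ord_max = E' by rewrite /B' /= ltnn.
  have := indY mB'; rewrite big_ord_recr /= Bn.
  rewrite (eq_bigr (fun i : 'I_n => fine (P (Y i @^-1` B i)))); last first.
    by move=> i _; rewrite /B' /= ltn_ord.
  move=> <-; congr (fine (P _)); rewrite AE; apply/seteqP; split => w /=.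
    move=> [h1 h2] i _ /=; rewrite /B'; case: ifPn => [|]; first exact: h1.
    rewrite -leqNgt => ni; have -> // : (i : nat) = n by apply/eqP; rewrite eqn_leq ni -ltnS ltn_ord.
  move=> h; split.
    by move=> i il; have := h (Ordinal (ltnW il : (i < n.+1)%N)) I; rewrite /B' /= il.
  by have := h ord_max I; rewrite /B' /= ltnn.
have mYE := measurable_pre n mE.
have PA : fine (P A) = \prod_(i < n) fine (P (Y i @^-1` B i)).
  by have := key setT measurableT; rewrite preimage_setT setIT probability_setT mulr1.
rewrite /indep_sets -[LHS]fineK; last by apply: fin_num_measure; exact: measurableI.
by rewrite key// -PA EFinM !fineK ?fin_num_measure.
Qed.

Lemma family_indep (F : Omega -> R) (B E : set R) :
  measurable_fun setT (F : g_sigma_algebraType family_gen -> R) ->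
  measurable B -> measurable E -> indep_sets P (F @^-1` B) (Y n @^-1` E).
Proof.
move=> mF mB mE; have := mF measurableT B mB; rewrite setTI.
apply: indep_sigma.
- exact: family_genI.
- exact: family_gen_measurable.
- exact: measurable_pre.
- by move=> A; exact: family_gen_indep.
Qed.

Lemma family_measurable (i : nat) : (i < n)%N ->
  measurable_fun setT (Y i : g_sigma_algebraType family_gen -> R).
Proof.
move=> il _ B mB; rewrite setTI; apply: sub_sigma_algebra.
exists (fun j => if j == i then B else setT) => [j|]; first by case: ifP.
apply/seteqP; split => w /=; last by move=> /(_ i il); rewrite eqxx.
by move=> Bw j jl; case: eqP => // ->.
Qed.

Lemma family_sum_indep (c : nat -> R) (B E : set R) : measurable B -> measurable E ->
  indep_sets P ((fun w => \sum_(i < n) c i * Y i w) @^-1` B) (Y n @^-1` E).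
Proof.
apply: family_indep.
apply: measurable_sum => i; apply: measurable_funM => //.
exact: family_measurable.
Qed.

End PastOfFamily.

Section BrownianCharacteristic.
Context d (Omega : measurableType d) (R : realType) (P : probability Omega R).
Variable W : R -> {RV P >-> R}.
Hypothesis hW : standard_brownian_motion W.

Lemma brownian_incr_cos (s t c phi : R) : 0 <= s -> s <= t ->
  \int[P]_w cos (c * (W t w - W s w) + phi) = expR (- (c ^+ 2 * (t - s) / 2)) * cos phi.
Proof.
move=> s0; rewrite le_eqVlt => /orP[/eqP <-|st].
  rewrite (_ : (fun w => _) = fun=> cos phi); last by apply/funext => w; rewrite subrr mulr0 add0r.
  by rewrite Ex_cst subrr mulr0 mul0r oppr0 expR0 mul1r.
have mY : measurable_fun setT (fun w => W t w - W s w) by exact: measurable_funB.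
have mY' : @measurable_fun _ _ Omega (measurableTypeR R) setT (fun w => W t w - W s w) := mY.
pose Y : {mfun Omega >-> measurableTypeR R} := @mfun_Sub _ _ Omega (measurableTypeR R) _ (mem_set mY').
have sg0 : 0 < Num.sqrt (t - s) by rewrite sqrtr_gt0 subr_gt0.
have := normal_prob_cos sg0 phi c.
rewrite sqr_sqrtr ?subr_ge0 1?ltW// (mulrC (t - s)) => <-.
have mf : measurable_fun setT (fun x : R => (cos (c * x + phi))%:E).
  apply/measurable_EFinP; apply: continuous_measurableT; first exact: continuous_cos.
  by apply: measurable_funD => //; exact: measurable_funM.
have mf' : @measurable_fun _ _ (measurableTypeR R) (\bar R) setT (fun x : R => (cos (c * x + phi))%:E) := mf.
have bc : bmf (fun w => cos (c * (W t w - W s w) + phi)).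
  by apply: bmf_cos; apply: measurable_funD => //; exact: measurable_funM.
have iY : P.-integrable setT ((fun x : R => (cos (c * x + phi))%:E) \o Y) by exact: (bmf_integrable P bc).
rewrite /Rintegral; congr fine.
rewrite -[LHS](integral_distribution (X := Y) mf' iY).
have h (A : set (measurableTypeR R)) : measurable A -> A `<=` setT ->
    distribution P Y A = normal_prob 0 (Num.sqrt (t - s)) A.
  by move=> mA _; exact: (brownian_law hW s0 st mA).
exact: (@eq_measure_integral _ (measurableTypeR R) R setT (normal_prob 0 (Num.sqrt (t - s))) (distribution P Y) _ h).
Qed.

(** The last increment is independent of the previous ones, and its sine has
    mean 0 by [brownian_incr_cos] with [phi = - (pi / 2)]. *)
Lemma brownian_steps_cos (n : nat) (s c : nat -> R) (phi : R) : 0 <= s 0%N ->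
  {homo s : i j / (i <= j)%N >-> i <= j} ->
  \int[P]_w cos (step_integral W n s c w + phi)
    = expR (- ((\sum_(i < n) c i ^+ 2 * (s i.+1 - s i)) / 2)) * cos phi.
Proof.
move=> s0 hs.
have mS m : measurable_fun setT (step_integral W m s c).
  by apply: measurable_sum => i; apply: measurable_funM => //; exact: measurable_funB.
have mY i : measurable_fun setT (fun w => W (s i.+1) w - W (s i) w) by exact: measurable_funB.
elim: n phi => [|n IH] phi.
  rewrite (_ : (fun w => _) = fun=> cos phi); last first.
    by apply/funext => w; rewrite /step_integral big_ord0 add0r.
  by rewrite Ex_cst big_ord0 mul0r oppr0 expR0 mul1r.
have si0 i : 0 <= s i by apply: le_trans s0 (hs _ _ _).
pose Y i : {RV P >-> R} := mfun_Sub (mem_set (mY i)).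
have indY : independent_family P (fun (i : 'I_n.+1) w => Y i w) by exact: (brownian_indep_increments hW).
have ind := @family_sum_indep _ _ _ P n Y indY c.
have mcY : measurable_fun setT (fun w => c n * Y n w) by exact: measurable_funM.
have mSp : measurable_fun setT (fun w => step_integral W n s c w + phi) by exact: measurable_funD.
have EM (f g : R -> R) : continuous f -> continuous g ->
    bmf (fun w => f (step_integral W n s c w + phi)) -> bmf (fun w => g (c n * Y n w)) ->
    \int[P]_w (f (step_integral W n s c w + phi) * g (c n * Y n w)) =
    \int[P]_w f (step_integral W n s c w + phi) * \int[P]_w g (c n * Y n w).
  move=> cf cg bf bg; apply: indep_ExM => // B C mB mC.
  have mfp : measurable_fun setT (fun x : R => f (x + phi)).
    by apply: (continuous_measurableT cf); exact: measurable_funD.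
  have mgp : measurable_fun setT (fun x : R => g (c n * x)).
    by apply: (continuous_measurableT cg); exact: measurable_funM.
  have := ind ((fun x : R => f (x + phi)) @^-1` B) ((fun x : R => g (c n * x)) @^-1` C).
  apply; first by rewrite -[X in measurable X]setTI; exact: mfp.
  by rewrite -[X in measurable X]setTI; exact: mgp.
have b1 := bmf_cos mSp; have b2 := bmf_cos mcY.
have b3 := bmf_sin mSp; have b4 := bmf_sin mcY.
rewrite (_ : (fun w => _) = fun w => cos (step_integral W n s c w + phi) * cos (c n * Y n w)
    - sin (step_integral W n s c w + phi) * sin (c n * Y n w)); last first.
  apply/funext => w; rewrite -cosD; congr cos; rewrite /step_integral big_ord_recr /=; ring.
rewrite ExB; [|exact: bmfM|exact: bmfM].
rewrite (EM cos cos)//; [|exact: continuous_cos|exact: continuous_cos].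
rewrite (EM sin sin)//; [|exact: continuous_sin|exact: continuous_sin].
have -> : \int[P]_w cos (c n * Y n w) = expR (- (c n ^+ 2 * (s n.+1 - s n) / 2)).
  have := brownian_incr_cos (c n) 0 (si0 n) (hs _ _ (leqnSn n)); rewrite cos0 mulr1 => <-.
  by apply: eq_Rintegral => w _; rewrite addr0.
have -> : \int[P]_w sin (c n * Y n w) = 0.
  have := brownian_incr_cos (c n) (- (pi / 2)) (si0 n) (hs _ _ (leqnSn n)).
  rewrite cosN cos_pihalf mulr0 => <-.
  by apply: eq_Rintegral => w _; rewrite cosBpihalf.
rewrite IH mulr0 subr0 big_ord_recr /= mulrAC -expRD; congr (expR _ * _); lra.
Qed.

End BrownianCharacteristic.

(** * Step functions and second moments *)

Section Refinement.
Context (R : realType).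
Implicit Types (V : R -> R) (r s c : nat -> R).

Definition step_sum V n s c : R := \sum_(i < n) c i * (V (s i.+1) - V (s i)).

(** The indicator selects the intervals of [r] that lie between [r i] and [r
    j]. It compares values and not indices because points of [r] may
    coincide; the extra terms are then increments of [V] over a single point.
    *)
Lemma sorted_telescope V r m i j : {homo r : i j / (i <= j)%N >-> i <= j} ->
  (i <= m)%N -> (j <= m)%N -> r i <= r j ->
  V (r j) - V (r i) =
  \sum_(k < m) ((r i <= r k) && (r k.+1 <= r j))%:R * (V (r k.+1) - V (r k)).
Proof.
move=> hr im jm rij.
have E0 k : r k = r k.+1 -> ((r i <= r k) && (r k.+1 <= r j))%:R * (V (r k.+1) - V (r k)) = 0 :> R.
  by move=> ->; rewrite subrr mulr0.
have [ij|ji] := leqP i j; last first.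
  have e : r i = r j by apply/eqP; rewrite eq_le rij hr// ltnW.
  rewrite e subrr big1// => k _; case: andP => [[h1 h2]|]; last by rewrite mul0r.
  rewrite -{1}e in h1; have e1 : r k = r k.+1; last by rewrite e1 subrr mulr0.
  by apply/eqP; rewrite eq_le hr// (le_trans h2)// -e.
rewrite -(big_mkord xpredT (fun k => ((r i <= r k) && (r k.+1 <= r j))%:R * (V (r k.+1) - V (r k)))).
rewrite (big_cat_nat (leq0n i) im) /= (big_cat_nat ij jm) /=.
rewrite [X in _ = X + _]big_nat_cond big1 => [|k /andP[/andP[_ ki] _]]; last first.
  have [h1|] := boolP (r i <= r k); last by rewrite mul0r.
  rewrite -(_ : r k = r k.+1) ?subrr ?mulr0//.
  by apply/eqP; rewrite eq_le hr//= (le_trans (hr _ _ ki)).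
rewrite [X in _ = _ + (_ + X)]big_nat_cond [X in _ = _ + (_ + X)]big1 => [|k /andP[/andP[jk _] _]]; last first.
  have [h1|] := boolP (r k.+1 <= r j); last by rewrite andbF mul0r.
  rewrite -(_ : r k = r k.+1) ?subrr ?mulr0//.
  by apply/eqP; rewrite eq_le hr//= (le_trans h1)// hr.
rewrite add0r addr0 -(telescope_sumr (fun k => V (r k)) ij); apply: eq_big_nat => k /andP[ik kj].
by rewrite !hr// mul1r.
Qed.

(** The new subdivision and coefficients do not depend on [V]: they serve
    both for the primitive of the oscillating noise and for the Brownian
    path. *)
Lemma common_refinement (p : nat) (n : nat -> nat) (s c : nat -> nat -> R) :
  (forall i, 0 <= s i 0%N /\ {homo s i : i j / (i <= j)%N >-> i <= j}) ->
  exists m r (c' : nat -> nat -> R), [/\ 0 <= r 0%N, {homo r : i j / (i <= j)%N >-> i <= j}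
    & forall i V, (i < p)%N -> step_sum V (n i) (s i) (c i) = step_sum V m r (c' i)].
Proof.
move=> hs.
pose l := sort <=%R (flatten [seq [seq s i k | k <- iota 0 (n i).+1] | i <- iota 0 p]).
have ls i k : (i < p)%N -> (k <= n i)%N -> s i k \in l.
  move=> ip kn; rewrite mem_sort; apply/flatten_mapP; exists i; first by rewrite mem_iota.
  by apply/mapP; exists k; rewrite // mem_iota.
have l0 x : x \in l -> 0 <= x.
  rewrite mem_sort => /flatten_mapP[i _ /mapP[k _ ->]].
  by apply: le_trans (proj1 (hs i)) _; apply: (proj2 (hs i)).
have sl : sorted <=%R l by apply: sort_sorted; exact: le_total.
pose r k := nth (last 0 l) l k.
have rge k : (size l <= k)%N -> r k = last 0 l by move=> h; rewrite /r nth_default.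
have hr : {homo r : i j / (i <= j)%N >-> i <= j}.
  move=> i j ij; have [js|js] := ltnP j (size l).
    by apply: (sorted_leq_nth le_trans le_refl) => //; rewrite inE// (leq_ltn_trans ij).
  rewrite (rge j)//; have [is_|is_] := ltnP i (size l); last by rewrite rge.
  rewrite -nth_last /r (set_nth_default (last 0 l) 0); last by rewrite prednK// (leq_ltn_trans _ is_).
  apply: (sorted_leq_nth le_trans le_refl) => //; rewrite ?inE// ?prednK ?(leq_ltn_trans _ is_)//.
  by rewrite -ltnS prednK// (leq_ltn_trans _ is_).
exists (size l), r, (fun i k => \sum_(j < n i) c i j * ((s i j <= r k) && (r k.+1 <= s i j.+1))%:R).
split => //.
  have [h|h] := posnP (size l); last by apply: l0; exact: mem_nth.
  by rewrite rge ?h// (size0nil h).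
move=> i V ip; rewrite /step_sum.
under [RHS]eq_bigr do rewrite mulr_suml.
rewrite exchange_big /=; apply: eq_bigr => j _.
have /(nthP (last 0 l))[a al ea] := ls i j ip (ltnW (ltn_ord j)).
have /(nthP (last 0 l))[b bl eb] := ls i j.+1 ip (ltn_ord j).
rewrite -ea -eb -/(r a) -/(r b).
rewrite (@sorted_telescope V r (size l) a b hr (ltnW al) (ltnW bl)); last first.
  by rewrite /r ea eb; apply: (proj2 (hs i)).
by rewrite mulr_sumr; apply: eq_bigr => k _; rewrite mulrA.
Qed.

End Refinement.

Section SecondMoment.
Context d (T : measurableType d) (R : realType) (P : {measure set T -> \bar R}).
Implicit Types (F G : T -> R).

(** Stated with the extended integral, the bound also carries square
    integrability. *)
Definition sqm F (c : R) :=
  measurable_fun setT F /\ (\int[P]_w (F w ^+ 2)%:E <= c%:E)%E.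

Lemma measurable_sqrE F : measurable_fun setT F -> measurable_fun setT (fun w => (F w ^+ 2)%:E).
Proof. by move=> mF; apply/measurable_EFinP; exact: measurable_funX. Qed.

Lemma sqm_integrable F c : sqm F c -> P.-integrable setT (EFin \o (fun w => F w ^+ 2)).
Proof.
move=> [mF le]; apply/integrableP; split; first exact: measurable_sqrE.
under eq_integral do rewrite /= ger0_norm ?sqr_ge0//.
exact: le_lt_trans le (ltry _).
Qed.

Lemma sqm_le F c : sqm F c -> \int[P]_w (F w ^+ 2) <= c.
Proof.
move=> sF; have [_ le] := sF; rewrite -lee_fin /Rintegral fineK//.
apply: integrable_fin_num => //; exact: sqm_integrable sF.
Qed.

Lemma sqmW F (c c' : R) : sqm F c -> c <= c' -> sqm F c'.
Proof. by move=> [mF le] cc; split => //; apply: le_trans le _; rewrite lee_fin. Qed.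

Lemma sqmD F G (c c' : R) : sqm F c -> sqm G c' -> sqm (fun w => F w + G w) (2 * c + 2 * c').
Proof.
move=> [mF lF] [mG lG]; split; first exact: measurable_funD.
apply: (@le_trans _ _ (\int[P]_w (2%:E * (F w ^+ 2)%:E + 2%:E * (G w ^+ 2)%:E))%E).
  apply: ge0_le_integral => //.
  - by move=> w _; rewrite lee_fin sqr_ge0.
  - exact: measurable_sqrE (measurable_funD mF mG).
  - by apply: emeasurable_funD; apply: measurable_funeM; exact: measurable_sqrE.
  - by move=> w _; rewrite -!EFinM -EFinD lee_fin; have := sqr_ge0 (F w - G w); nra.
rewrite ge0_integralD//; last 4 first.
- by move=> w _; rewrite mule_ge0 ?lee_fin ?sqr_ge0.
- by apply: measurable_funeM; exact: measurable_sqrE.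
- by move=> w _; rewrite mule_ge0 ?lee_fin ?sqr_ge0.
- by apply: measurable_funeM; exact: measurable_sqrE.
rewrite !ge0_integralZl_EFin//; do ?[by move=> w _; rewrite lee_fin sqr_ge0|exact: measurable_sqrE].
have -> : (2 * c + 2 * c')%:E = (2%:E * c%:E + 2%:E * c'%:E)%E by [].
by apply: leeD; rewrite lee_pmul2l.
Qed.

Lemma sqm_L2_limit (I : Type) (A : set_system I) {FA : ProperFilter A} (u : I -> T -> R) F c :
  measurable_fun setT F -> L2_cvg P setT A u F -> (\forall i \near A, sqm (u i) c) ->
  sqm F (2 * c).
Proof.
move=> mF cu su; split => //.
apply/lee_addgt0Pr => e e0.
have e20 : 0 < e / 2 by rewrite divr_gt0.
have near1 : \forall i \near A, ((\int[P]_w ((u i w - F w) ^+ 2)%:E) < (e / 2)%:E)%E.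
  move: cu; rewrite /L2_cvg => cu.
  have := cu [set x : \bar R | (x < (e / 2)%:E)%E]; apply.
  by apply: (open_nbhs_nbhs); split => //=; exact: open_ereal_lt_ereal.
near A => i.
have [mu_ lu] : sqm (u i) c by near: i.
have lt : ((\int[P]_w ((u i w - F w) ^+ 2)%:E) < (e / 2)%:E)%E by near: i.
have sB : sqm (fun w => F w - u i w) (e / 2).
  split; first exact: measurable_funB.
  by apply: ltW; under eq_integral do rewrite -sqrrN opprB.
have [_] := sqmD (conj mu_ lu) sB.
under eq_integral do rewrite addrC subrK.
move=> /le_trans; apply; rewrite -EFinD lee_fin; lra.
Unshelve. all: by end_near.
Qed.

End SecondMoment.

(** * The Laplace kernel *)

Section KernelBounds.
Context (R : realType).
Notation mu := (@lebesgue_measure R).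
Notation halfline := (`[(0 : R), +oo[%classic).
Notation window n := (`[(n.+2%:R^-1 : R), n.+2%:R]%classic).

Lemma power_integral (c q u v : R) : 0 < u -> u < v ->
  (\int[mu]_(x in `[u, v]) (c * (q * x `^ (q - 1)))%:E = (c * v `^ q - c * u `^ q)%:E)%E.
Proof.
move=> u0 uv.
have dF (x : R) : 0 < x -> is_derive x 1 (fun x : R => c * x `^ q) (c * (q * x `^ (q - 1))).
  move=> x0; have d := is_derive1_powR q x0.
  by apply: is_derive_eq; rewrite /GRing.scale /=; ring.
have cp p (x : R) : 0 < x -> {for x, continuous (fun x : R => x `^ p)}.
  move=> x0; apply/differentiable_continuous/derivable1_diffP.
  by case: (is_derive1_powR p x0).
rewrite (@continuous_FTC2 _ _ (fun x : R => c * x `^ q))//.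
- apply: continuous_in_subspaceT => x; rewrite inE/= in_itv/= => /andP[ux _].
  have x0 := lt_le_trans u0 ux.
  apply: cvgM; first exact: cvg_cst.
  by apply: cvgM; [exact: cvg_cst|exact: cp].
- split.
  + move=> x; rewrite in_itv/= => /andP[ux _].
    by case: (dF x (lt_trans u0 ux)).
  + by apply: cvg_at_right_filter; apply: cvgM; [exact: cvg_cst|exact: cp].
  + by apply: cvg_at_left_filter; apply: cvgM; [exact: cvg_cst|apply: cp; exact: lt_trans uv].
- move=> x; rewrite in_itv/= => /andP[ux _].
  by rewrite derive1E; case: (dF x (lt_trans u0 ux)).
Qed.

Lemma one_sub_exp_ge0 (x : R) : 0 <= x -> 0 <= 1 - expR (- x).
Proof. by move=> x0; rewrite subr_ge0 expR_le1 oppr_le0. Qed.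

Lemma one_sub_exp_le1 (x : R) : 1 - expR (- x) <= 1.
Proof. by rewrite gerBl expR_ge0. Qed.

Lemma one_sub_exp_le (x : R) : 1 - expR (- x) <= x.
Proof. by have := expR_ge1Dx (- x); lra. Qed.

Lemma one_sub_exp_powR (a x : R) : 0 < a <= 1 -> 0 <= x -> 1 - expR (- x) <= x `^ a.
Proof.
move=> /andP[a0 a1]; rewrite le_eqVlt => /orP[/eqP <-|x0].
  by rewrite oppr0 expR0 subrr powR_ge0.
have [x1|x1] := lerP x 1.
  apply: le_trans (one_sub_exp_le x) _.
  by rewrite -[leLHS](powRr1 (ltW x0)); apply: ger_powR => //; rewrite x0.
apply: le_trans (one_sub_exp_le1 x) _.
by rewrite -(powRr0 x); apply: ler_powR; exact: ltW.
Qed.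

Variables (H T : R).
Hypotheses (H02 : 0 < H < 2) (T0 : 0 < T).
Let a := H / 2.
Let a01 : 0 < a < 1. Proof. by have /andP[h1 h2] := H02; rewrite /a; apply/andP; split; lra. Qed.

(** [kernel_increments] bounds the squared increments of the kernel by
    multiples of it. It is of order [r `^ (- H / 2)] near 0 and [r `^ (- 1 -
    H / 2)] at infinity, hence integrable since [0 < H < 2]. *)
Definition majorant (r : R) : R := (1 - expR (- (r * T))) * r `^ (- 1 - a).

Lemma majorant_ge0 r : 0 <= r -> 0 <= majorant r.
Proof. by move=> r0; rewrite mulr_ge0 ?powR_ge0// one_sub_exp_ge0// mulr_ge0// ltW. Qed.

Lemma measurable_majorant : measurable_fun setT majorant.
Proof.
apply: measurable_funM; last exact: measurable_powR.
apply: measurable_funB => //; apply: (continuous_measurableT (@continuous_expR R)).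
by apply: measurableT_comp => //; exact: measurable_funM.
Qed.

Let mE D : measurable_fun D (EFin \o majorant).
Proof. by apply/measurable_EFinP; apply: measurable_funTS; exact: measurable_majorant. Qed.

(** The factor [1 - exp (- r T)] is bounded by [r * T] below 1 and by 1
    above. *)
Lemma majorant_integral_le n :
  (\int[mu]_(x in window n) (majorant x)%:E <= (T / (1 - a) + a^-1)%:E)%E.
Proof.
have /andP[a0 a1] := a01.
have a1N : 1 - a != 0 by rewrite subr_eq0 gt_eqF.
have aN : a != 0 by rewrite gt_eqF.
have v1 : 1 < n.+2%:R :> R by rewrite ltr1n.
have u0 : 0 < n.+2%:R^-1 :> R by rewrite invr_gt0 ltr0n.
have u1 : n.+2%:R^-1 < 1 :> R by rewrite invf_lt1.
set u := n.+2%:R^-1 in u0 u1 *; set v := n.+2%:R in v1 *.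
have mp (q : R) D : measurable_fun D (EFin \o (fun x : R => x `^ q)).
  by apply/measurable_EFinP; apply: measurable_funTS; exact: measurable_powR.
have mp' (c p q : R) D : measurable_fun D (fun x : R => (c * (p * x `^ q))%:E).
  apply/measurable_EFinP; apply: measurable_funTS; apply: measurable_funM => //.
  by apply: measurable_funM => //; exact: measurable_powR.
rewrite (_ : `[u, v]%classic = `[u, 1]%classic `|` `]1, v]%classic); last first.
  apply/seteqP; split => x /=; rewrite !in_itv/=.
    by move=> /andP[ux xv]; have [x1|x1] := lerP x 1; [left|right]; rewrite ?ux ?xv.
  by move=> [/andP[ux x1]|/andP[x1 xv]]; rewrite ?ux ?xv ?(le_trans x1 (ltW v1))// (le_trans (ltW u1) (ltW x1)).
rewrite ge0_integral_setU//=; last 3 first.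
- exact: mE.
- move=> x [] /=; rewrite in_itv/= => /andP[h _]; rewrite lee_fin; apply: majorant_ge0.
    exact: le_trans (ltW u0) h.
  exact: ltW (lt_trans ltr01 h).
- apply/disj_setPS => x [] /=; rewrite !in_itv/= => /andP[_ h1] /andP[h2 _].
  by have := le_lt_trans h1 h2; rewrite ltxx.
rewrite EFinD; apply: leeD.
  apply: (@le_trans _ _ (\int[mu]_(x in `[u, 1%R]) (T / (1 - a) * ((1 - a) * x `^ ((1 - a) - 1)))%:E)%E).
    apply: ge0_le_integral => //.
    - by move=> x /=; rewrite in_itv/= => /andP[h _]; rewrite lee_fin majorant_ge0// (le_trans (ltW u0)).
    - exact: mE.
    - exact: mp'.
    - move=> x /=; rewrite in_itv/= => /andP[h _]; rewrite lee_fin.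
      have x0 := lt_le_trans u0 h.
      rewrite mulrA divfK// (_ : 1 - a - 1 = 1 + (- 1 - a)); last by ring.
      rewrite powRD ?(gt_eqF x0) ?implybT// powRr1 ?(ltW x0)// mulrA ler_wpM2r ?powR_ge0//.
      by rewrite [leRHS]mulrC; exact: one_sub_exp_le.
  rewrite power_integral// lee_fin powR1 mulr1 gerBl mulr_ge0 ?powR_ge0// divr_ge0 ?(ltW T0)// subr_ge0 ltW//.
rewrite integral_itv_obnd_cbnd//.
apply: (@le_trans _ _ (\int[mu]_(x in `[1%R, v]) (- a^-1 * ((- a) * x `^ ((- a) - 1)))%:E)%E).
  apply: ge0_le_integral => //.
  - by move=> x /=; rewrite in_itv/= => /andP[h _]; rewrite lee_fin majorant_ge0// (le_trans ler01).
  - exact: mE.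
  - exact: mp'.
  - move=> x /=; rewrite in_itv/= => /andP[h _]; rewrite lee_fin.
    rewrite mulrA mulrNN mulVf// mul1r (_ : - a - 1 = - 1 - a); last by ring.
    by rewrite ler_piMl ?powR_ge0// one_sub_exp_le1.
rewrite power_integral// lee_fin powR1 mulr1 opprK mulNr gerDr oppr_le0 mulr_ge0 ?powR_ge0// invr_ge0 ltW//.
Qed.

Lemma majorant_integrable : mu.-integrable `[0, +oo[ (EFin \o majorant).
Proof.
apply/integrableP; split; first exact: mE.
pose D n : set R := window n.
have DU : \bigcup_n D n = `]0, +oo[%classic.
  apply/seteqP; split => [x [n _]|x] /=; rewrite /D /= ?in_itv/= ?andbT.
    by move=> /andP[h _]; apply: lt_le_trans h; rewrite invr_gt0 ltr0n.
  move=> x0; exists (maxn (Num.truncn x) (Num.truncn x^-1)) => //=.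
  rewrite in_itv/=; apply/andP; split.
    rewrite invf_ple ?posrE ?ltr0n//; apply: ltW; apply: lt_le_trans (truncnS_gt _) _.
    by rewrite ler_nat ltnS (leq_trans _ (leqnSn _))// leq_maxr.
  apply: ltW; apply: lt_le_trans (truncnS_gt _) _.
  by rewrite ler_nat ltnS (leq_trans _ (leqnSn _))// leq_maxl.
have -> : (\int[mu]_(x in halfline) `|(EFin \o majorant) x| = \int[mu]_(x in halfline) (EFin \o majorant) x)%E.
  apply: eq_integral => x; rewrite inE/= in_itv/= andbT => x0; rewrite ger0_norm//; exact: majorant_ge0.
rewrite -integral_itv_obnd_cbnd; last exact: mE.
rewrite -DU.
have c : (\int[mu]_(x in D n) (EFin \o majorant) x)%E @[n --> \oo] --> (\int[mu]_(x in \bigcup_n D n) (EFin \o majorant) x)%E.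
  apply: ge0_nondecreasing_set_cvg_integral => //.
  - apply/nondecreasing_seqP => n; rewrite subsetEset => x; rewrite /D /= !in_itv/= => /andP[h1 h2].
    rewrite (le_trans h2) ?ler_nat// andbT; apply: le_trans h1.
    by rewrite lef_pV2 ?posrE ?ltr0n// ler_nat.
  - by move=> n; exact: measurable_itv.
  - by move=> n; exact: mE.
  - move=> n x; rewrite /D /= in_itv/= => /andP[h _]; rewrite lee_fin majorant_ge0//.
    by apply: le_trans h; rewrite invr_ge0.
apply: (@le_lt_trans _ _ (T / (1 - a) + a^-1)%:E); last exact: ltry.
rewrite -(cvg_lim _ c)//; apply: lime_le; first by apply/cvg_ex; eexists; exact: c.
by apply: nearW => n; exact: majorant_integral_le.
Qed.

Definition kernel_const : R := \int[mu]_(r in `[0, +oo[) majorant r.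

Notation K := (laplace_kernel H).

Lemma kernel_diff_sqr (s t r : R) : 0 <= r ->
  (K t r - K s r) ^+ 2 = (expR (- (r * s)) - expR (- (r * t))) ^+ 2 * r `^ (- 1 - H).
Proof.
move=> r0; rewrite /laplace_kernel -mulrBl exprMn; congr (_ * _); first by congr (_ ^+ 2); ring.
rewrite expr2; have [->|rN] := eqVneq r 0.
  have /andP[h1 h2] := H02; have h : - ((1 + H) / 2) != 0 by rewrite lt_eqF//; lra.
  rewrite !powR0// ?mulr0// lt_eqF//; lra.
by rewrite -powRD ?rN ?implybT//; congr (_ `^ _); field.
Qed.

(** Each increment of exp(- r s) over the partition is at most 1 - exp(- r
    delta), hence at most (r delta)^(H/2), and the increments sum to at most
    1 - exp(- r T). The sum of their squares is at most the product of these
    two bounds. *)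
Lemma kernel_increments (delta : R) (s : nat -> R) n (r : R) : 0 <= r -> 0 < delta ->
  s 0%N = 0 -> {homo s : i j / (i <= j)%N >-> i <= j} -> s n <= T ->
  (forall k, (k < n)%N -> s k.+1 - s k <= delta) ->
  \sum_(k < n) (K (s k.+1) r - K (s k) r) ^+ 2 <= delta `^ a * majorant r.
Proof.
move=> r0 d0 s0 hs snT sd; have /andP[a0 a1] := a01.
under eq_bigr do rewrite kernel_diff_sqr//.
rewrite -mulr_suml.
have le1 (k : 'I_n) : (expR (- (r * s k)) - expR (- (r * s k.+1))) ^+ 2 <=
    (1 - expR (- (r * delta))) * (expR (- (r * s k)) - expR (- (r * s k.+1))).
  have sk := hs _ _ (leqnSn k).
  have d1 : 0 <= expR (- (r * s k)) - expR (- (r * s k.+1)).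
    by rewrite subr_ge0 ler_expR lerN2 ler_wpM2l.
  rewrite expr2 ler_wpM2r//.
  have -> : expR (- (r * s k)) - expR (- (r * s k.+1)) =
    expR (- (r * s k)) * (1 - expR (- (r * (s k.+1 - s k)))).
    by rewrite mulrBr mulr1 -expRD; congr (_ - expR _); ring.
  apply: (@le_trans _ _ (1 - expR (- (r * (s k.+1 - s k))))).
    rewrite ler_piMl// ?one_sub_exp_ge0 ?mulr_ge0 ?subr_ge0//.
    by rewrite expR_le1 oppr_le0 mulr_ge0// -s0 hs.
  by rewrite lerD2l lerN2 ler_expR lerN2 ler_wpM2l// sd.
have le2 : \sum_(k < n) (expR (- (r * s k)) - expR (- (r * s k.+1))) ^+ 2 <=
    (1 - expR (- (r * delta))) * (1 - expR (- (r * T))).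
  apply: le_trans (ler_sum _ (fun k _ => le1 k)) _.
  rewrite -mulr_sumr ler_wpM2l ?one_sub_exp_ge0 ?mulr_ge0 ?(ltW d0)//.
  rewrite (_ : \sum_(k < n) _ = 1 - expR (- (r * s n))).
    by rewrite lerD2l lerN2 ler_expR lerN2 ler_wpM2l.
  rewrite -(big_mkord xpredT (fun k => expR (- (r * s k)) - expR (- (r * s k.+1)))).
  rewrite (telescope_big (fun i j => expR (- (r * s i)) - expR (- (r * s j)))).
    by rewrite s0 mulr0 oppr0 expR0; case: (n) => [|//]; rewrite s0 mulr0 oppr0 expR0 subrr.
  by move=> k _ /=; ring.
apply: le_trans (ler_wpM2r (powR_ge0 _ _) le2) _.
have [->|rN] := eqVneq r 0.
  by rewrite !mul0r !oppr0 expR0 subrr !mul0r mulr_ge0 ?powR_ge0// majorant_ge0.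
rewrite /majorant mulrCA mulrAC mulrC ler_wpM2l ?one_sub_exp_ge0 ?mulr_ge0 ?(ltW T0)//.
have -> : r `^ (- 1 - a) = r `^ a * r `^ (- 1 - H).
  by rewrite -powRD ?rN ?implybT//; congr (_ `^ _); rewrite /a; field.
rewrite mulrA ler_wpM2r ?powR_ge0// -powRM ?(ltW d0)// [delta * r]mulrC.
by apply: one_sub_exp_powR; rewrite ?a0 ?(ltW a1)// mulr_ge0// ltW.
Qed.

Lemma measurable_kernel t : measurable_fun setT (K t).
Proof.
apply: measurable_funM; last exact: measurable_powR.
apply: measurable_funB => //; apply: (continuous_measurableT (@continuous_expR R)).
by apply: measurableT_comp => //; exact: measurable_funM.
Qed.

Lemma kernel_sqr_le t r : 0 <= t <= T -> 0 <= r -> K t r ^+ 2 <= T `^ a * majorant r.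
Proof.
move=> /andP[t0 tT] r0.
(* A partition with a single increment, starting at time 0 where the kernel
   vanishes. *)
pose s (k : nat) : R := if k is 0%N then 0 else t.
have := @kernel_increments T s 1%N r r0 T0 erefl.
rewrite big_ord1 /= (_ : K 0 r = 0) ?subr0; last first.
  by rewrite /laplace_kernel mulr0 oppr0 expR0 subrr mul0r.
apply => //; first by case=> [|i] [|j].
by case=> // _; rewrite subr0.
Qed.

Lemma kernel_sqr_integrable t : 0 <= t <= T ->
  mu.-integrable `[0, +oo[ (EFin \o (fun r => K t r ^+ 2)).
Proof.
move=> tT; apply: integrable_bounded_by (integrable_scale (T `^ a) _ majorant_integrable) => //.
  by apply: measurable_funTS; apply: measurable_funX; exact: measurable_kernel.
move=> r /=; rewrite in_itv/= andbT => r0; rewrite ger0_norm ?sqr_ge0//.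
exact: kernel_sqr_le.
Qed.

Lemma kernel_increments_integral (delta : R) (s : nat -> R) n : 0 < delta ->
  s 0%N = 0 -> {homo s : i j / (i <= j)%N >-> i <= j} -> s n <= T ->
  (forall k, (k < n)%N -> s k.+1 - s k <= delta) ->
  (\sum_(k < n) \int[mu]_(r in halfline) ((K (s k.+1) r - K (s k) r) ^+ 2)%:E
    <= (delta `^ a * kernel_const)%:E)%E.
Proof.
move=> d0 s0 hs snT sd.
have md (k : 'I_n) : measurable_fun halfline (fun r => ((K (s k.+1) r - K (s k) r) ^+ 2)%:E).
  apply/measurable_EFinP; apply: measurable_funTS; apply: measurable_funX.
  by apply: measurable_funB; exact: measurable_kernel.
rewrite -ge0_integral_sum//=; last by move=> k r _; rewrite lee_fin sqr_ge0.
rewrite EFinM /kernel_const /Rintegral fineK; last by apply: integrable_fin_num => //; exact: majorant_integrable.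
rewrite -integralZl//; last exact: majorant_integrable.
apply: ge0_le_integral => //.
- by move=> r _; rewrite sume_ge0// => k _; rewrite lee_fin sqr_ge0.
- by apply: emeasurable_sum.
- by apply: measurable_funeM; exact: mE.
- move=> r /=; rewrite in_itv/= andbT => r0.
  by rewrite sumEFin -EFinM lee_fin; exact: kernel_increments.
Qed.

End KernelBounds.

(** * Integral bounds and product spaces *)

Section IntegralBound.
Context d (T : measurableType d) (R : realType) (P : probability T R).
Implicit Types (F G : T -> R).

(** Bundling integrability with the bound lets such bounds be combined
    without side conditions. *)
Definition intb F (b : R) := P.-integrable setT (EFin \o F) /\ \int[P]_w F w <= b.

Lemma intb_ext F G b : F =1 G -> intb F b -> intb G b.
Proof. by move=> /funext ->. Qed.

Lemma intbD F G b c : intb F b -> intb G c -> intb (fun w => F w + G w) (b + c).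
Proof.
move=> [iF lF] [iG lG]; split; first exact: integrable_add.
by rewrite RintegralD// lerD.
Qed.

Lemma intb_cst b : intb (fun=> b) b.
Proof. by split; [exact: bmf_integrable (bmf_cst T b)|rewrite Ex_cst]. Qed.

Lemma intbZ F (c b : R) : 0 <= c -> intb F b -> intb (fun w => c * F w) (c * b).
Proof.
move=> c0 [iF lF]; split; first exact: integrable_scale.
by rewrite RintegralZl// ler_wpM2l.
Qed.

Lemma intb_sum (n : nat) (F : nat -> T -> R) (b : nat -> R) :
  (forall i, (i < n)%N -> intb (F i) (b i)) ->
  intb (fun w => \sum_(i < n) F i w) (\sum_(i < n) b i).
Proof.
elim: n => [|n IH] h.
  by rewrite big_ord0; apply: intb_ext (intb_cst 0) => w; rewrite big_ord0.
rewrite big_ord_recr /=; apply: intb_ext (intbD (IH _) (h n _)) => //.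
  by move=> w; rewrite big_ord_recr.
by move=> i il; apply: h; exact: ltnW.
Qed.

Lemma intb_sqm F c : sqm P F c -> intb (fun w => F w ^+ 2) c.
Proof. by move=> sF; split; [exact: sqm_integrable sF|exact: sqm_le]. Qed.

Lemma intb_le F G b : measurable_fun setT F -> (forall w, `|F w| <= G w) -> intb G b ->
  `|\int[P]_w F w| <= b.
Proof.
move=> mF FG [iG lG].
have iF : P.-integrable setT (EFin \o F) by apply: integrable_bounded_by iG.
apply: le_trans (le_normr_Rintegral _ iF) _ => //.
by apply: le_trans lG; apply: le_Rintegral => //; exact: integrable_abs.
Qed.

(** This passes from second to first moments, in place of the Cauchy-Schwarz
    inequality; the best [eta] is the square root of the second moment. *)
Lemma abs_le_sqr (x eta : R) : 0 < eta -> `|x| <= eta + eta^-1 * x ^+ 2.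
Proof.
move=> e0; rewrite -[x ^+ 2]real_normK ?num_real//.
have := normr_ge0 x; move: `|x| => y y0.
have -> : eta + eta^-1 * y ^+ 2 = eta^-1 * (eta ^+ 2 + y ^+ 2) by field; rewrite gt_eqF.
rewrite ler_pdivlMl//; have := sqr_ge0 (eta - y); have := sqr_ge0 y; have := sqr_ge0 eta; nra.
Qed.

Lemma intb_abs F c eta : 0 < eta -> sqm P F c ->
  intb (fun w => eta + eta^-1 * F w ^+ 2) (eta + eta^-1 * c).
Proof.
move=> e0 sF; apply: intbD; first exact: intb_cst.
by apply: intbZ; [rewrite invr_ge0 ltW|exact: intb_sqm].
Qed.

Lemma cos_diff_bound F G (p : nat) (u v : nat -> R) (D D' : nat -> T -> R) (c eta : R) :
  measurable_fun setT F -> measurable_fun setT G -> 0 < eta ->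
  (forall w, F w - G w = \sum_(i < p) (u i * D i w + v i * D' i w)) ->
  (forall i, (i < p)%N -> sqm P (D i) c) -> (forall i, (i < p)%N -> sqm P (D' i) c) ->
  `|\int[P]_w cos (F w) - \int[P]_w cos (G w)| <=
    \sum_(i < p) (`|u i| + `|v i|) * (eta + eta^-1 * c).
Proof.
move=> mF mG e0 FG sD sD'.
rewrite -ExB; [|exact: bmf_cos|exact: bmf_cos].
pose B w := \sum_(i < p) (`|u i| * (eta + eta^-1 * D i w ^+ 2) + `|v i| * (eta + eta^-1 * D' i w ^+ 2)).
apply: (@intb_le _ B).
- by apply: (bmfB (bmf_cos mF) (bmf_cos mG)).1.
- move=> w; apply: le_trans (cos_lip _ _) _; rewrite FG.
  apply: le_trans (ler_norm_sum _ _ _) _; apply: ler_sum => i _.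
  apply: le_trans (ler_normD _ _) _; rewrite !normrM.
  by apply: lerD; apply: ler_wpM2l => //; exact: abs_le_sqr.
- apply: (@intb_sum p (fun i w => `|u i| * (eta + eta^-1 * D i w ^+ 2) + `|v i| * (eta + eta^-1 * D' i w ^+ 2))
    (fun i => (`|u i| + `|v i|) * (eta + eta^-1 * c))) => i ip.
  by rewrite mulrDl; apply: intbD; apply: intbZ => //; apply: intb_abs => //; [exact: sD|exact: sD'].
Qed.

End IntegralBound.

Section ProductSpace.
Context d (T : measurableType d) (R : realType) (Q : probability T R).
Local Notation QQ := (Q \x Q)%E.

Lemma ge0_integral_fst (f : T -> \bar R) : measurable_fun setT f -> (forall x, 0 <= f x)%E ->
  (\int[QQ]_z f z.1 = \int[Q]_x f x)%E.
Proof.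
move=> mf f0.
rewrite (@fubini_tonelli1 _ _ _ _ _ Q Q (fun z => f z.1))//=; last first.
  by apply: measurableT_comp => //; exact: measurable_fst.
apply: eq_integral => x _; rewrite /fubini_F /= integral_cst//.
by rewrite -[RHS]mule1; congr (_ * _)%E; exact: probability_setT.
Qed.

Lemma ge0_integral_snd (f : T -> \bar R) : measurable_fun setT f -> (forall x, 0 <= f x)%E ->
  (\int[QQ]_z f z.2 = \int[Q]_x f x)%E.
Proof.
move=> mf f0.
rewrite (@fubini_tonelli2 _ _ _ _ _ Q Q (fun z => f z.2))//=; last first.
  by apply: measurableT_comp => //; exact: measurable_snd.
apply: eq_integral => x _; rewrite /fubini_G /= integral_cst//.
by rewrite -[RHS]mule1; congr (_ * _)%E; exact: probability_setT.
Qed.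

Lemma sqm_fst (F : T -> R) c : sqm Q F c -> sqm QQ (fun z => F z.1) c.
Proof.
move=> [mF lF]; split; first by apply: measurableT_comp => //; exact: measurable_fst.
rewrite (@ge0_integral_fst (fun x => (F x ^+ 2)%:E))//; first exact: measurable_sqrE.
by move=> x; rewrite lee_fin sqr_ge0.
Qed.

Lemma sqm_snd (F : T -> R) c : sqm Q F c -> sqm QQ (fun z => F z.2) c.
Proof.
move=> [mF lF]; split; first by apply: measurableT_comp => //; exact: measurable_snd.
rewrite (@ge0_integral_snd (fun x => (F x ^+ 2)%:E))//; first exact: measurable_sqrE.
by move=> x; rewrite lee_fin sqr_ge0.
Qed.

Lemma product_independent (A B : set T) : measurable A -> measurable B ->
  QQ (fst @^-1` A `&` snd @^-1` B) = (Q A * Q B)%E.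
Proof. by move=> mA mB; exact: product_measure1E. Qed.

Lemma product_fst (A : set T) : measurable A -> QQ (fst @^-1` A) = Q A.
Proof.
move=> mA; have := product_independent mA (@measurableT _ T).
by rewrite preimage_setT setIT probability_setT mule1.
Qed.

Lemma product_snd (A : set T) : measurable A -> QQ (snd @^-1` A) = Q A.
Proof.
move=> mA; have := product_independent (@measurableT _ T) mA.
by rewrite preimage_setT setTI probability_setT mul1e.
Qed.

Lemma Ex_fst (F : T -> R) : bmf F -> \int[QQ]_z F z.1 = \int[Q]_x F x.
Proof.
move=> [mF [M FM]].
have b1 : bmf (fun z : T * T => F z.1).
  by split; [apply: measurableT_comp => //; exact: measurable_fst|exists M => z].
have b2 : bmf F by split => //; exists M.
have bM U (m : measurableType U) : bmf (fun _ : m => M) by exact: bmf_cst.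
(* Adding [M] makes the function nonnegative. *)
have : \int[QQ]_z (F z.1 + M) = \int[Q]_x (F x + M).
  rewrite /Rintegral; congr fine.
  apply: (@ge0_integral_fst (fun x => (F x + M)%:E)).
    by apply/measurable_EFinP; exact: measurable_funD.
  by move=> x; rewrite lee_fin; have := FM x; rewrite ler_norml => /andP[h _]; lra.
rewrite (@ExD _ _ _ QQ (fun z => F z.1) (fun=> M))// (@ExD _ _ _ Q F (fun=> M))//.
by rewrite !Ex_cst => /addIr.
Qed.

Lemma Ex_snd (F : T -> R) : bmf F -> \int[QQ]_z F z.2 = \int[Q]_x F x.
Proof.
move=> [mF [M FM]].
have b1 : bmf (fun z : T * T => F z.2).
  by split; [apply: measurableT_comp => //; exact: measurable_snd|exists M => z].
have b2 : bmf F by split => //; exists M.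
have bM U (m : measurableType U) : bmf (fun _ : m => M) by exact: bmf_cst.
have : \int[QQ]_z (F z.2 + M) = \int[Q]_x (F x + M).
  rewrite /Rintegral; congr fine.
  apply: (@ge0_integral_snd (fun x => (F x + M)%:E)).
    by apply/measurable_EFinP; exact: measurable_funD.
  by move=> x; rewrite lee_fin; have := FM x; rewrite ler_norml => /andP[h _]; lra.
rewrite (@ExD _ _ _ QQ (fun z => F z.2) (fun=> M))// (@ExD _ _ _ Q F (fun=> M))//.
by rewrite !Ex_cst => /addIr.
Qed.

Lemma Ex_prod (F G : T -> R) : bmf F -> bmf G ->
  \int[QQ]_z (F z.1 * G z.2) = \int[Q]_x F x * \int[Q]_x G x.
Proof.
move=> bF bG; have [mF [M FM]] := bF; have [mG [L GL]] := bG.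
have m1 : measurable_fun setT (fun z : T * T => F z.1).
  by apply: measurableT_comp => //; exact: measurable_fst.
have m2 : measurable_fun setT (fun z : T * T => G z.2).
  by apply: measurableT_comp => //; exact: measurable_snd.
rewrite (@indep_ExM _ _ _ QQ (fun z => F z.1) (fun z => G z.2)).
- by rewrite Ex_fst// Ex_snd.
- by split => //; exists M.
- by split => //; exists L.
move=> B C mB mC; rewrite /indep_sets.
have mFB : measurable (F @^-1` B) by rewrite -[X in measurable X]setTI; exact: mF.
have mGC : measurable (G @^-1` C) by rewrite -[X in measurable X]setTI; exact: mG.
have := product_independent mFB mGC.
by rewrite -(product_fst mFB) -(product_snd mGC).
Qed.

(** The formulas for all shifts encode both the value of E[cos] and the
    vanishing of E[sin], at [psi = - (pi / 2)]. *)
Lemma Ex_prod_cos (F G : T -> R) (a b phi : R) : measurable_fun setT F -> measurable_fun setT G ->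
  (forall psi, \int[Q]_x cos (F x + psi) = a * cos psi) ->
  (forall psi, \int[Q]_x cos (G x + psi) = b * cos psi) ->
  \int[QQ]_z cos (F z.1 + G z.2 + phi) = a * b * cos phi.
Proof.
move=> mF mG aF bG.
have mGp : measurable_fun setT (fun x => G x + phi) by exact: measurable_funD.
have b1 := bmf_cos mF; have b2 := bmf_sin mF; have b3 := bmf_cos mGp; have b4 := bmf_sin mGp.
have m1 (U : T -> R) : bmf U -> bmf (fun z : T * T => U z.1).
  by move=> [mU [M UM]]; split; [apply: measurableT_comp => //; exact: measurable_fst|exists M => z].
have m2 (U : T -> R) : bmf U -> bmf (fun z : T * T => U z.2).
  by move=> [mU [M UM]]; split; [apply: measurableT_comp => //; exact: measurable_snd|exists M => z].
rewrite (_ : (fun z => cos _) = fun z => cos (F z.1) * cos (G z.2 + phi) - sin (F z.1) * sin (G z.2 + phi)); last first.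
  by apply/funext => z; rewrite -cosD addrA.
rewrite ExB; [|apply: bmfM; [exact: (m1 _ b1)|exact: (m2 _ b3)]|apply: bmfM; [exact: (m1 _ b2)|exact: (m2 _ b4)]].
rewrite (Ex_prod b1 b3) (Ex_prod b2 b4) bG.
have -> : \int[Q]_x cos (F x) = a.
  by rewrite -[RHS]mulr1 -cos0 -aF; apply: eq_Rintegral => x _; rewrite addr0.
have -> : \int[Q]_x sin (F x) = 0.
  have := aF (- (pi / 2)); rewrite cosN cos_pihalf mulr0 => <-.
  by apply: eq_Rintegral => x _; rewrite cosBpihalf.
by rewrite mul0r subr0 mulrA.
Qed.

End ProductSpace.

(** * The square bound on the half-line *)

Section SquareBound.
Context (R : realType) d (Omega : measurableType d) (P : probability Omega R).
Variable N : R -> {RV P >-> nat}.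
Hypothesis hN : standard_poisson_process N.
Variable theta : R.
Hypothesis ct1 : cos theta != 1.
Notation mu := (@lebesgue_measure R).
Notation halfline := (`[(0 : R), +oo[%classic).

Lemma abs_le_1sqr (x : R) : `|x| <= 1 + x ^+ 2.
Proof. by have := abs_le_sqr x ltr01; rewrite invr1 mul1r. Qed.

Lemma integrable_segment (f : R -> R) (r : R) : measurable_fun setT f ->
  mu.-integrable halfline (EFin \o (fun x => f x ^+ 2)) -> mu.-integrable `[0, r] (EFin \o f).
Proof.
move=> mf i2.
have sub : `[0, r]%classic `<=` halfline by move=> x /=; rewrite !in_itv/= => /andP[->].
have i2r : mu.-integrable `[0, r] (EFin \o (fun x => f x ^+ 2)) by apply: integrableS i2.
have i1 : mu.-integrable `[0, r] (EFin \o (fun x : R => (1 : R))).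
  apply: continuous_compact_integrable; first exact: segment_compact.
  by apply: continuous_subspaceT => x; exact: cvg_cst.
apply: integrable_bounded_by (integrable_add _ i1 i2r) => //; first exact: measurable_funTS.
by move=> x _; exact: abs_le_1sqr.
Qed.

(** The integrals over [0, r] have second moments bounded uniformly in [r],
    and their L2 limit inherits the bound. *)
Lemma poisson_L2 (phi eps : R) (f : R -> R) (U : R -> Omega -> R) (V : Omega -> R) : 0 < eps ->
  measurable_fun setT f -> mu.-integrable halfline (EFin \o (fun x => f x ^+ 2)) ->
  measurable_fun setT V -> L2_cvg P setT +oo U V ->
  (\forall r \near +oo, U r = poisson_int N theta phi f eps r) ->
  sqm P V (32 / gap theta * \int[mu]_(x in halfline) (f x ^+ 2)).
Proof.
move=> e0 mf i2 mV cU UE.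
rewrite (_ : 32 = 2 * 16 :> R); last by rewrite -natrM.
rewrite -(mulrA 2) -(mulrA 2); apply: (@sqm_L2_limit _ _ _ P _ _ _ _ _ _ mV cU); near=> r.
have r0 : 0 < r by near: r; apply: nbhs_pinfty_gt; exact: num_real.
have -> : U r = poisson_int N theta phi f eps r by near: r.
have sub : `[0, r]%classic `<=` halfline by move=> x /=; rewrite !in_itv/= => /andP[->].
have i2r : mu.-integrable `[0, r] (EFin \o (fun x => f x ^+ 2)) by apply: integrableS i2.
have [bp le] := poisson_int_L2 hN ct1 phi e0 r0 (integrable_segment r mf i2) i2r.
have bp2 : P.-integrable setT (EFin \o (fun w => poisson_int N theta phi f eps r w ^+ 2)).
  by apply: (bmf_integrable P); apply: bmfM.
split; first by case: bp.
rewrite -[leLHS]fineK; last by apply: integrable_fin_num.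
rewrite lee_fin; apply: le_trans le _.
rewrite ler_wpM2l ?divr_ge0 ?(ltW (gap_gt0 ct1))//.
rewrite /Rintegral fine_le ?integrable_fin_num//.
apply: ge0_subset_integral => //.
- by apply: (measurable_int mu).
- by move=> x _; rewrite lee_fin sqr_ge0.
Unshelve. all: by end_near. Qed.

Lemma L2_cvgB (I : Type) (A : set_system I) (FA : Filter A) (u u' : I -> Omega -> R) (v v' : Omega -> R) :
  (\forall i \near A, measurable_fun setT (u i)) -> (\forall i \near A, measurable_fun setT (u' i)) ->
  measurable_fun setT v -> measurable_fun setT v' ->
  L2_cvg P setT A u v -> L2_cvg P setT A u' v' ->
  L2_cvg P setT A (fun i w => u i w - u' i w) (fun w => v w - v' w).
Proof.
move=> mu_ mu' mv mv' cu cu'; rewrite /L2_cvg.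
pose B i := (2%:E * \int[P]_w ((u i w - v w) ^+ 2)%:E + 2%:E * \int[P]_w ((u' i w - v' w) ^+ 2)%:E)%E.
apply: (@squeeze_cvge _ _ _ _ (fun=> 0%E) _ B).
- apply: filterS2 mu_ mu' => i mi mi'; apply/andP; split.
    by apply: integral_ge0 => w _; rewrite lee_fin sqr_ge0.
  have m1 : measurable_fun setT (fun w => u i w - v w) by exact: measurable_funB.
  have m2 : measurable_fun setT (fun w => u' i w - v' w) by exact: measurable_funB.
  rewrite /B -!ge0_integralZl_EFin//; do ?[by move=> w _; rewrite lee_fin sqr_ge0|exact: measurable_sqrE].
  rewrite -ge0_integralD//; last 4 first.
  + by move=> w _; rewrite mule_ge0 ?lee_fin ?sqr_ge0.
  + by apply: measurable_funeM; exact: measurable_sqrE.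
  + by move=> w _; rewrite mule_ge0 ?lee_fin ?sqr_ge0.
  + by apply: measurable_funeM; exact: measurable_sqrE.
  apply: ge0_le_integral => //.
  + by move=> w _; rewrite lee_fin sqr_ge0.
  + by apply: measurable_sqrE; apply: measurable_funB; exact: measurable_funB.
  + by apply: emeasurable_funD; apply: measurable_funeM; exact: measurable_sqrE.
  + move=> w _; rewrite -!EFinM -EFinD lee_fin.
    by have := sqr_ge0 ((u i w - v w) + (u' i w - v' w)); nra.
- exact: cvg_cst.
- rewrite -[X in _ --> X]adde0; apply: cvgeD => //.
    by rewrite -[X in _ --> X](mule0 2%:E); apply: cvgeZl.
  by rewrite -[X in _ --> X](mule0 2%:E); apply: cvgeZl.
Qed.

(** A trajectory of the Poisson process is monotone, so its level sets are
    intervals; replacing negative times by 0 makes it monotone on the whole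
    line. *)
Lemma measurable_path (g : R -> R) (eps : R) (D : set R) w : continuous g -> 0 < eps ->
  measurable D -> D `<=` halfline ->
  measurable_fun D (fun s => g (angle N theta (tick eps s) w)).
Proof.
move=> cg e0 mD D0.
pose M s := N (tick eps (Num.max 0 s)) w.
have hM : {homo M : s t / s <= t >-> (s <= t)%N}.
  move=> s t st; apply: hN.1.(poisson_nondecreasing).
    by apply: tick_ge0 => //; rewrite le_max lexx.
  apply: ler_tick => //; rewrite ge_max le_max lexx /= le_max; apply/orP; right; exact: st.
have mM : measurable_fun setT M.
  move=> _ B _; rewrite setTI.
  rewrite (_ : M @^-1` B = \bigcup_(k in B) (M @^-1` [set k])).
    apply: bigcup_measurable => k _; apply: is_interval_measurable => s t /= Ms Mt u /andP[su ut].
    apply/eqP; rewrite eqn_leq; apply/andP; split; [rewrite -Mt|rewrite -Ms]; exact: hM.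
  by apply/seteqP; split => s /=; [move=> Bs; exists (M s)|move=> [k Bk]; rewrite /preimage /= => ->].
have mg : measurable_fun D (fun s => g (theta * (M s)%:R)).
  apply: measurable_funTS; apply: (continuous_measurableT cg).
  apply: measurable_funM => //.
  by apply: (@measurableT_comp _ _ _ _ _ _ (fun k : nat => k%:R : R) _ M) => //.
apply: eq_measurable_fun mg => s; rewrite inE => Ds.
have s0 : 0 <= s by have := D0 _ Ds; rewrite /= in_itv/= andbT.
by rewrite /angle /M max_r.
Qed.

Lemma path_integrable (g : R -> R) (eps : R) (D : set R) (h : R -> R) w : continuous g ->
  (forall x, `|g x| <= 1) -> 0 < eps -> measurable D -> D `<=` halfline ->
  mu.-integrable D (EFin \o h) ->
  mu.-integrable D (EFin \o (fun s => h s * g (angle N theta (tick eps s) w))).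
Proof.
move=> cg g1 e0 mD D0 hi; apply: integrable_bounded_by (integrable_abs _ hi) => //.
  by apply: measurable_funM => //; [exact: integrable_measurable hi|exact: measurable_path].
by move=> s _; rewrite normrM ler_piMr.
Qed.

Lemma continuous_shift_cos (phi : R) : continuous (fun x : R => cos (x + phi)).
Proof. by move=> x; apply: continuous_comp; [exact: cvgD cvg_id (cvg_cst _)|exact: continuous_cos]. Qed.

Lemma segment_halfline (r : R) : `[0, r]%classic `<=` halfline.
Proof. by move=> x /=; rewrite !in_itv/= => /andP[->]. Qed.

Lemma poisson_intB (phi eps r : R) (f g : R -> R) w : 0 < eps ->
  mu.-integrable `[0, r] (EFin \o f) -> mu.-integrable `[0, r] (EFin \o g) ->
  poisson_int N theta phi f eps r w - poisson_int N theta phi g eps r w =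
  poisson_int N theta phi (fun x => f x - g x) eps r w.
Proof.
move=> e0 fi gi.
have ic (h : R -> R) : mu.-integrable `[0, r] (EFin \o h) ->
    mu.-integrable `[0, r] (EFin \o (fun s => h s * cos (angle N theta (tick eps s) w + phi))).
  move=> hi; apply: (path_integrable (g := fun x => cos (x + phi))) => //.
  - exact: continuous_shift_cos.
  - by move=> x; exact: cos_max.
  - exact: segment_halfline.
rewrite /poisson_int -mulrBr; congr (_ * _).
rewrite -RintegralB//; [|exact: ic|exact: ic].
by apply: eq_Rintegral => s _; rewrite mulrBl.
Qed.

Lemma integrable_cst_segment (c x y : R) : mu.-integrable `[x, y] (EFin \o (fun _ : R => c)).
Proof.
apply: continuous_compact_integrable; first exact: segment_compact.
by apply: continuous_subspaceT => z; exact: cvg_cst.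
Qed.

(** A primitive of the oscillating noise: the integral of a step function is
    a sum of its increments. *)
Definition running (phi eps : R) (w : Omega) (y : R) := poisson_int N theta phi (fun=> 1) eps y w.

Lemma running_increment (phi eps x y : R) w : 0 < eps -> 0 <= x -> x <= y ->
  running phi eps w y - running phi eps w x =
  2 / eps * \int[mu]_(s in `[x, y]) cos (angle N theta (tick eps s) w + phi).
Proof.
move=> e0 x0 xy; rewrite /running /poisson_int -mulrBr; congr (_ * _).
under eq_Rintegral do rewrite mul1r.
under [X in _ - X]eq_Rintegral do rewrite mul1r.
have ic (D : set R) : measurable D -> D `<=` halfline -> mu.-integrable D (EFin \o (fun _ : R => (1 : R))) ->
    mu.-integrable D (EFin \o (fun s => cos (angle N theta (tick eps s) w + phi))).
  move=> mD D0 h1.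
  have := @path_integrable (fun x => cos (x + phi)) eps D (fun=> 1) w (@continuous_shift_cos phi) (fun x => cos_max _) e0 mD D0 h1.
  by congr (integrable _ _ _); apply/funext => s /=; rewrite mul1r.
have i0 : mu.-integrable `[0, y] (EFin \o (fun s => cos (angle N theta (tick eps s) w + phi))).
  by apply: ic; [exact: measurable_itv|exact: segment_halfline|exact: integrable_cst_segment].
rewrite (Rintegral_itvB i0) ?bnd_simp// Rintegral_itv_obnd_cbnd//.
by apply: integrableS i0 => // z /=; rewrite !in_itv/= => /andP[xz ->]; rewrite (le_trans x0 (ltW xz)).
Qed.

Lemma poisson_int_step (phi eps : R) n (s c : nat -> R) (r : R) w : 0 < eps ->
  0 <= s 0%N -> {homo s : i j / (i <= j)%N >-> i <= j} -> s n <= r ->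
  poisson_int N theta phi (step_fun n s c) eps r w = step_sum (running phi eps w) n s c.
Proof.
move=> e0 s0 hs snr.
have si i : 0 <= s i by apply: le_trans s0 (hs _ _ _).
have g1 (x : R) : `|cos (x + phi)| <= 1 by exact: cos_max.
pose Y x := cos (angle N theta (tick eps x) w + phi).
have iI (i : 'I_n) : mu.-integrable `[0, r] (EFin \o (fun x => c i * \1_(`]s i, s i.+1]) x * Y x)).
  apply: (path_integrable (g := fun x => cos (x + phi))) => //.
  - exact: continuous_shift_cos.
  - exact: segment_halfline.
  - apply: integrable_scale => //; apply: integrable_bounded_by (integrable_cst_segment 1 0 r) => //.
    by move=> x _; rewrite indicE; case: (_ \in _); rewrite ?normr1 ?normr0.
have [_ sumE] := @Rintegral_sum_int _ _ _ mu _ _ (index_enum 'I_n) _ (@measurable_itv _ `[0, r]) iI.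
rewrite /poisson_int (_ : \int[mu]_(x in _) _ = \sum_(i < n) \int[mu]_(x in `[0, r]) (c i * \1_(`]s i, s i.+1]) x * Y x)); last first.
  by rewrite -sumE; apply: eq_Rintegral => x _; rewrite /step_fun mulr_suml.
rewrite mulr_sumr; apply: eq_bigr => i _.
rewrite running_increment//; last exact: hs.
rewrite mulrCA; congr (_ * _).
have iY : mu.-integrable `[s i, s i.+1] (EFin \o Y).
  have h : `[s i, s i.+1]%classic `<=` halfline.
    by move=> x /=; rewrite !in_itv/= => /andP[h _]; rewrite (le_trans (si i) h).
  have := @path_integrable (fun x => cos (x + phi)) eps _ (fun=> 1) w (@continuous_shift_cos phi) g1 e0 (@measurable_itv _ `[s i, s i.+1]) h (integrable_cst_segment 1 _ _).
  by congr (integrable _ _ _); apply/funext => x /=; rewrite mul1r.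
have sub : `]s i, s i.+1]%classic `<=` `[0, r]%classic.
  move=> x /=; rewrite !in_itv/= => /andP[h1 h2]; rewrite (le_trans (si i) (ltW h1)).
  by rewrite (le_trans h2)// (le_trans _ snr)// hs.
rewrite -Rintegral_itv_obnd_cbnd; last first.
  by apply: integrableS iY => // x /=; rewrite !in_itv/= => /andP[/ltW -> ->].
rewrite -RintegralZl//; last by apply: integrableS iY => // x /=; rewrite !in_itv/= => /andP[/ltW -> ->].
rewrite [RHS]Rintegral_mkcond [LHS]Rintegral_mkcond; apply: eq_Rintegral => x _.
rewrite !patchE indicE.
have [h|h] := boolP (x \in `]s i, s i.+1]%classic).
  by rewrite mem_set ?mulr1//; apply: sub; rewrite inE in h.
by rewrite mulr0 mul0r; case: ifP.
Qed.

Lemma steps_intE (r a b : nat -> R) (eps phi : R) m w : 0 < eps -> 0 <= r 0%N ->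
  {homo r : i j / (i <= j)%N >-> i <= j} ->
  steps_int N theta r a b eps phi m w =
  step_sum (running 0 eps w) m r a + step_sum (running (- (pi / 2)) eps w) m r b + phi.
Proof.
move=> e0 r0 hr.
have ri i : 0 <= r i by apply: le_trans r0 (hr _ _ _).
elim: m => [|m IH] /=; first by rewrite /step_sum !big_ord0 !add0r.
rewrite IH /step_sum !big_ord_recr /=.
have -> : segment_int N theta (a m) (b m) eps (r m) (r m.+1) w =
    a m * (running 0 eps w (r m.+1) - running 0 eps w (r m)) +
    b m * (running (- (pi / 2)) eps w (r m.+1) - running (- (pi / 2)) eps w (r m)).
  rewrite !running_increment// ?hr// /segment_int.
  have h : `[r m, r m.+1]%classic `<=` halfline.
    by move=> x /=; rewrite !in_itv/= => /andP[h _]; rewrite (le_trans (ri m) h).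
  have ic phi' c : mu.-integrable `[r m, r m.+1] (EFin \o (fun x => c * cos (angle N theta (tick eps x) w + phi'))).
    exact: (@path_integrable (fun x => cos (x + phi')) eps _ (fun=> c) w (@continuous_shift_cos phi') (fun x => cos_max _) e0 (@measurable_itv _ `[r m, r m.+1]) h (integrable_cst_segment c _ _)).
  have ic1 phi' : mu.-integrable `[r m, r m.+1] (EFin \o (fun x => cos (angle N theta (tick eps x) w + phi'))).
    have := ic phi' 1; congr (integrable _ _ _); apply/funext => x /=; by rewrite mul1r.
  rewrite mulrCA (mulrCA (b m)) -mulrDr; congr (_ * _).
  rewrite -!RintegralZl// -RintegralD//; last first.
  apply: eq_Rintegral => x _; by rewrite /lobs addr0 cosBpihalf.
by rewrite -!/(step_sum _ _ _ _); lra.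
Qed.

End SquareBound.

(** * Convergence of the finite-dimensional distributions *)

Lemma near_all_lt (p : nat) (Pr : nat -> nat -> Prop) :
  (forall i, (i < p)%N -> \forall m \near \oo, Pr i m) ->
  \forall m \near \oo, forall i, (i < p)%N -> Pr i m.
Proof.
elim: p => [|p IH] h; first by apply: nearW.
have := IH (fun i ip => h i (ltnW ip)); have := h p (ltnSn p).
apply: filterS2 => m hp hm i; rewrite ltnS leq_eqVlt => /predU1P[->//|]; exact: hm.
Qed.

Section FiniteDimensional.
Context (R : realType) d (Omega : measurableType d) (P : probability Omega R).
Variable N : R -> {RV P >-> nat}.
Hypothesis hN : standard_poisson_process N.
Variables (theta H T : R).
Hypotheses (ct1 : cos theta != 1) (ct2 : cos (theta *+ 2) != 1).
Hypotheses (H02 : 0 < H < 2) (T0 : 0 < T).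
Notation mu := (@lebesgue_measure R).
Notation halfline := (`[(0 : R), +oo[%classic).
Notation K := (laplace_kernel H).

Lemma truncated_cosE eps t :
  truncated_integral cos H theta N eps t = fun r => poisson_int N theta 0 (K t) eps r.
Proof.
apply/funext => r; apply/funext => w; rewrite /truncated_integral /poisson_int; congr (_ * _).
by apply: eq_Rintegral => s _; rewrite addr0.
Qed.

Lemma truncated_sinE eps t :
  truncated_integral sin H theta N eps t = fun r => poisson_int N theta (- (pi / 2)) (K t) eps r.
Proof.
apply/funext => r; apply/funext => w; rewrite /truncated_integral /poisson_int; congr (_ * _).
by apply: eq_Rintegral => s _; rewrite cosBpihalf.
Qed.

Lemma integrable_cst1 (y : R) : mu.-integrable `[0, y] (EFin \o (fun x : R => (1 : R) ^+ 2)).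
Proof. by rewrite expr1n; exact: integrable_cst_segment. Qed.

Lemma measurable_running phi eps y : 0 < eps -> 0 <= y ->
  measurable_fun setT (fun w => running N theta phi eps w y).
Proof.
move=> e0; rewrite le_eqVlt => /predU1P[<-|y0].
  rewrite /running /poisson_int; under eq_fun do rewrite set_itv1 Rintegral_set1 mulr0.
  exact: measurable_cst.
by have [[]] := poisson_int_L2 hN ct1 phi e0 y0 (integrable_cst_segment 1 0 y) (integrable_cst1 y).
Qed.

Lemma measurable_step_running phi eps n (s c : nat -> R) : 0 < eps -> 0 <= s 0%N ->
  {homo s : i j / (i <= j)%N >-> i <= j} ->
  measurable_fun setT (fun w => step_sum (running N theta phi eps w) n s c).
Proof.
move=> e0 s0 hs; apply: measurable_sum => i; apply: measurable_funM => //.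
have si j : 0 <= s j by apply: le_trans s0 (hs _ _ _).
by apply: measurable_funB; exact: measurable_running.
Qed.

Lemma measurable_step_fun n (s c : nat -> R) : measurable_fun setT (step_fun n s c).
Proof.
by apply: measurable_sum => i; apply: measurable_funM => //; apply: measurable_indic; exact: measurable_itv.
Qed.

(** Replacing the kernel by a step function costs, uniformly in [eps], at
    most a constant times the squared L2 distance. *)
Lemma step_gap (phi eps t delta : R) (V : Omega -> R) n (s c : nat -> R) : 0 < eps ->
  0 <= t <= T -> measurable_fun setT V ->
  L2_cvg P setT +oo (fun r => poisson_int N theta phi (K t) eps r) V ->
  0 <= s 0%N -> {homo s : i j / (i <= j)%N >-> i <= j} ->
  (\int[mu]_(x in halfline) ((step_fun n s c x - K t x) ^+ 2)%:E <= delta%:E)%E ->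
  sqm P (fun w => V w - step_sum (running N theta phi eps w) n s c) (32 / gap theta * delta).
Proof.
move=> e0 tT mV cV s0 hs le.
pose f x := K t x - step_fun n s c x.
have mf : measurable_fun setT f.
  by apply: measurable_funB; [exact: measurable_kernel|exact: measurable_step_fun].
have f2E : (fun x => (f x ^+ 2)%:E) = (fun x => ((step_fun n s c x - K t x) ^+ 2)%:E).
  by apply/funext => x; rewrite -sqrrN opprB.
have le' : (\int[mu]_(x in halfline) (f x ^+ 2)%:E <= delta%:E)%E by rewrite f2E.
have i2 : mu.-integrable halfline (EFin \o (fun x => f x ^+ 2)).
  apply/integrableP; split; first by apply/measurable_EFinP; apply: measurable_funTS; exact: measurable_funX.
  under eq_integral do rewrite /= ger0_norm ?sqr_ge0//.
  exact: le_lt_trans le' (ltry _).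
have iK := kernel_sqr_integrable H02 T0 tT.
have mS : measurable_fun setT (fun w => step_sum (running N theta phi eps w) n s c).
  exact: measurable_step_running.
pose U r w := poisson_int N theta phi (K t) eps r w - step_sum (running N theta phi eps w) n s c.
have := @poisson_L2 _ _ _ _ _ hN theta ct1 phi eps f U (fun w => V w - step_sum (running N theta phi eps w) n s c) e0 mf i2.
move=> h; apply: sqmW (h _ _ _) _.
- exact: measurable_funB.
- have E x y z' : (x - z') - (y - z') = x - y :> R by ring.
  rewrite /L2_cvg /U; under eq_fun do under eq_integral do rewrite E.
  exact: cV.
- near=> r; apply/funext => w; rewrite /U -(poisson_int_step (r := r) hN theta phi c w e0 s0 hs); last first.
    by near: r; apply: nbhs_pinfty_ge; exact: num_real.
  apply: poisson_intB => //; first by apply: integrable_segment => //; exact: measurable_kernel.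
  rewrite (_ : step_fun n s c = fun x => \sum_(i < n) (c i * \1_(`]s i, s i.+1]) x)); last by [].
  have iI (i : 'I_n) : mu.-integrable `[0, r] (EFin \o (fun x => c i * \1_(`]s i, s i.+1]) x)).
    apply: integrable_scale => //; apply: integrable_bounded_by (integrable_cst_segment 1 0 r) => //.
    by move=> x _; rewrite indicE; case: (_ \in _); rewrite ?normr1 ?normr0.
  by have [] := @Rintegral_sum_int _ _ _ mu _ _ (index_enum 'I_n) _ (@measurable_itv _ `[0, r]) iI.
- rewrite ler_wpM2l ?divr_ge0 ?(ltW (gap_gt0 ct1))//.
  rewrite -lee_fin /Rintegral fineK//; exact: integrable_fin_num.
Unshelve. all: by end_near. Qed.

Context d' (Omega' : measurableType d') (Q : probability Omega' R).
Variable W : R -> {RV Q >-> R}.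
Hypothesis hW : standard_brownian_motion W.

Variables (p : nat) (t : nat -> R).
Hypothesis ht : forall i, 0 <= t i <= T.
Variables (XV YV : R -> nat -> Omega -> R) (B : nat -> Omega' -> R).
Hypothesis hX : forall eps i, 0 < eps -> measurable_fun setT (XV eps i) /\
  L2_cvg P setT +oo (truncated_integral cos H theta N eps (t i)) (XV eps i).
Hypothesis hY : forall eps i, 0 < eps -> measurable_fun setT (YV eps i) /\
  L2_cvg P setT +oo (truncated_integral sin H theta N eps (t i)) (YV eps i).
Hypothesis hB : forall i, wiener_integral W (K (t i)) (B i).

(** The step functions that define the Wiener integrals of the kernels are
    put in place of the kernels on both sides, at a cost [e / 4] each. On a
    common subdivision the linear combination is then given by one pair of
    step functions, with coefficients [al] and [be], for which the limit [L]
    is known from [steps_limit]. *)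
Lemma fdd_cos (u v : nat -> R) (phi : R) :
  \int[P]_w cos (\sum_(i < p) (u i * XV eps i w + v i * YV eps i w) + phi) @[eps --> 0^'+]
  --> \int[(Q \x Q)%E]_z cos (\sum_(i < p) (u i * B i z.1 + v i * B i z.2) + phi).
Proof.
have hB' i : exists z : (nat -> nat) * (nat -> nat -> R) * (nat -> nat -> R),
    [/\ forall m, 0 <= z.1.2 m 0%N /\ {homo z.1.2 m : i j / (i <= j)%N >-> i <= j},
        L2_cvg mu halfline \oo (fun m => step_fun (z.1.1 m) (z.1.2 m) (z.2 m)) (K (t i)) &
        L2_cvg Q setT \oo (fun m => step_integral W (z.1.1 m) (z.1.2 m) (z.2 m)) (B i)].
  by have [_ [n [s [c h]]]] := hB i; exists (n, s, c).
have [z hz] := choice hB'.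
have mB i : measurable_fun setT (B i) by have [] := hB i.
apply/cvgrPdist_lt => e e0.
pose A := \sum_(i < p) (`|u i| + `|v i|) + 1.
have S0 : 0 <= \sum_(i < p) (`|u i| + `|v i|) by apply: sumr_ge0 => i _; exact: addr_ge0.
have A0 : 0 < A by rewrite /A ltr_pwDr.
pose eta := e / (8 * A).
have eta0 : 0 < eta by rewrite divr_gt0// mulr_gt0.
have g0 := gap_gt0 ct1.
pose delta := Num.min (eta ^+ 2) (eta ^+ 2 * gap theta / 32).
have delta0 : 0 < delta by rewrite lt_min exprn_gt0// divr_gt0// mulr_gt0// exprn_gt0.
have bnd c : c <= eta ^+ 2 -> \sum_(i < p) (`|u i| + `|v i|) * (eta + eta^-1 * c) <= e / 4.
  move=> ce; rewrite -mulr_suml.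
  have h : eta + eta^-1 * c <= 2 * eta.
    rewrite mulr_natl mulr2n lerD2l ler_pdivrMl//.
  apply: le_trans (ler_wpM2l S0 h) _.
  apply: (@le_trans _ _ (A * (2 * eta))); first by apply: ler_wpM2r; [rewrite mulr_ge0// ltW|rewrite /A lerDl].
  by rewrite /eta le_eqVlt; apply/orP; left; apply/eqP; field; rewrite gt_eqF.
have [m hm] : exists m, forall i, (i < p)%N ->
    (\int[mu]_(x in halfline) ((step_fun ((z i).1.1 m) ((z i).1.2 m) ((z i).2 m) x - K (t i) x) ^+ 2)%:E <= delta%:E)%E /\
    sqm Q (fun w => B i w - step_integral W ((z i).1.1 m) ((z i).1.2 m) ((z i).2 m) w) delta.
  have : \forall m \near \oo, forall i, (i < p)%N ->
    (\int[mu]_(x in halfline) ((step_fun ((z i).1.1 m) ((z i).1.2 m) ((z i).2 m) x - K (t i) x) ^+ 2)%:E <= delta%:E)%E /\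
    sqm Q (fun w => B i w - step_integral W ((z i).1.1 m) ((z i).1.2 m) ((z i).2 m) w) delta.
    apply: near_all_lt => i _; have [_ c1 c2] := hz i.
    have lt_near (h : nat -> \bar R) : h m @[m --> \oo] --> 0%E -> \forall m \near \oo, (h m <= delta%:E)%E.
      move=> ch.
      have hn : nbhs (0%E : \bar R) [set x : \bar R | (x < delta%:E)%E].
        by apply: open_nbhs_nbhs; split => //=; exact: open_ereal_lt_ereal.
      have hh : \forall m \near \oo, (h m < delta%:E)%E := ch _ hn.
      by apply: filterS hh => k /ltW.
    apply: filterS2 (lt_near _ c1) (lt_near _ c2) => k h1 h2; split => //.
    split; first by apply: measurable_funB => //; apply: measurable_sum => j; apply: measurable_funM => //; exact: measurable_funB.
    by under eq_integral do rewrite -sqrrN opprB.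
  by case=> k _ hk; exists k; exact: (hk k (leqnn k)).
have hs i : 0 <= (z i).1.2 m 0%N /\ {homo (z i).1.2 m : i j / (i <= j)%N >-> i <= j}.
  by have [h _ _] := hz i; exact: h.
have [M [r [c' [r0 hr ref]]]] := @common_refinement R p (fun i => (z i).1.1 m) (fun i => (z i).1.2 m) (fun i => (z i).2 m) hs.
pose al k := \sum_(i < p) u i * c' i k.
pose be k := \sum_(i < p) v i * c' i k.
have comb (V V' : R -> R) : \sum_(i < p) (u i * step_sum V ((z i).1.1 m) ((z i).1.2 m) ((z i).2 m) +
    v i * step_sum V' ((z i).1.1 m) ((z i).1.2 m) ((z i).2 m)) = step_sum V M r al + step_sum V' M r be.
  have one (a : nat -> R) (U : R -> R) : \sum_(i < p) a i * step_sum U ((z i).1.1 m) ((z i).1.2 m) ((z i).2 m) =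
      step_sum U M r (fun k => \sum_(i < p) a i * c' i k).
    under eq_bigr do rewrite ref// /step_sum mulr_sumr.
    rewrite exchange_big /=; apply: eq_bigr => k _; rewrite mulr_suml.
    by apply: eq_bigr => i _; rewrite mulrA.
  by rewrite big_split /= !one.
have [C hC] := steps_limit hN ct1 ct2 al be phi M r0 hr.
pose L := expR (- (\sum_(k < M) (al k ^+ 2 + be k ^+ 2) * (r k.+1 - r k)) / 2) * cos phi.
(* Evaluated at the step functions, the Brownian expectation is exactly [L]. *)
have mW n (s c : nat -> R) : measurable_fun setT (step_integral W n s c).
  by apply: measurable_sum => j; apply: measurable_funM => //; exact: measurable_funB.
have m1 (U : Omega' -> R) : measurable_fun setT U -> measurable_fun setT (fun z : Omega' * Omega' => U z.1).
  by move=> mU; apply: measurableT_comp => //; exact: measurable_fst.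
have m2 (U : Omega' -> R) : measurable_fun setT U -> measurable_fun setT (fun z : Omega' * Omega' => U z.2).
  by move=> mU; apply: measurableT_comp => //; exact: measurable_snd.
have limQ : \int[(Q \x Q)%E]_z cos (step_integral W M r al z.1 + step_integral W M r be z.2 + phi) = L.
  rewrite (@Ex_prod_cos _ _ _ Q (step_integral W M r al) (step_integral W M r be) _ _ phi (mW _ _ _) (mW _ _ _)
    (fun psi => brownian_steps_cos hW M al psi r0 hr) (fun psi => brownian_steps_cos hW M be psi r0 hr)).
  rewrite /L -expRD; congr (expR _ * _).
  have -> : \sum_(k < M) (al k ^+ 2 + be k ^+ 2) * (r k.+1 - r k) =
      \sum_(k < M) al k ^+ 2 * (r k.+1 - r k) + \sum_(k < M) be k ^+ 2 * (r k.+1 - r k).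
    by rewrite -big_split; apply: eq_bigr => k _; rewrite mulrDl.
  by rewrite /=; lra.
have dQ : `|\int[(Q \x Q)%E]_z cos (\sum_(i < p) (u i * B i z.1 + v i * B i z.2) + phi) - L| <= e / 4.
  rewrite -limQ; apply: le_trans (_ : _ <= \sum_(i < p) (`|u i| + `|v i|) * (eta + eta^-1 * delta)) _; last first.
    by apply: bnd; rewrite /delta ge_min lexx.
  pose D i w := B i w - step_integral W ((z i).1.1 m) ((z i).1.2 m) ((z i).2 m) w.
  apply: (@cos_diff_bound _ _ _ (Q \x Q)%E _ _ p u v (fun i z => D i z.1) (fun i z => D i z.2)) => //.
  - apply: measurable_funD => //; apply: measurable_sum => i.
    by apply: measurable_funD; apply: measurable_funM => //; [exact: m1|exact: m2].
  - by apply: measurable_funD => //; apply: measurable_funD; [apply: m1|apply: m2].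
  - move=> w; rewrite -(comb (fun y => W y w.1) (fun y => W y w.2)) opprD addrACA subrr addr0.
    by rewrite -sumrB; apply: eq_bigr => i _; rewrite /D /step_integral /step_sum; ring.
  - by move=> i ip; apply: sqm_fst; have [] := hm i ip.
  - by move=> i ip; apply: sqm_snd; have [] := hm i ip.
have dP eps : 0 < eps -> `|\int[P]_w cos (\sum_(i < p) (u i * XV eps i w + v i * YV eps i w) + phi) -
    \int[P]_w cos (steps_int N theta r al be eps phi M w)| <= e / 4.
  move=> ep0; apply: le_trans (_ : _ <= \sum_(i < p) (`|u i| + `|v i|) * (eta + eta^-1 * (32 / gap theta * delta))) _; last first.
    have h : delta <= eta ^+ 2 * gap theta / 32 by rewrite /delta ge_min lexx orbT.
    apply: bnd; apply: le_trans (ler_wpM2l (divr_ge0 _ (ltW g0)) h) _ => //.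
    by rewrite le_eqVlt; apply/orP; left; apply/eqP; field; rewrite gt_eqF.
  have mX i : measurable_fun setT (XV eps i) by have [] := @hX eps i ep0.
  have mY i : measurable_fun setT (YV eps i) by have [] := @hY eps i ep0.
  pose D psi (V : nat -> Omega -> R) i w := V i w - step_sum (running N theta psi eps w) ((z i).1.1 m) ((z i).1.2 m) ((z i).2 m).
  apply: (@cos_diff_bound _ _ _ P _ _ p u v (D 0 (XV eps)) (D (- (pi / 2)) (YV eps))) => //.
  - apply: measurable_funD => //; apply: measurable_sum => i.
    by apply: measurable_funD; exact: measurable_funM.
  - by have := past_measurableW (past_steps (m := M) hN theta al be phi ep0 r0 hr).
  - move=> w; rewrite steps_intE// -comb opprD addrACA subrr addr0.
    by rewrite -sumrB; apply: eq_bigr => i _; rewrite /D; ring.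
  - move=> i ip; have [h1 h2] := hs i; have [h3 _] := hm i ip; apply: (step_gap (t := t i)) => //.
    by have [_] := @hX eps i ep0; rewrite truncated_cosE.
  - move=> i ip; have [h1 h2] := hs i; have [h3 _] := hm i ip; apply: (step_gap (t := t i)) => //.
    by have [_] := @hY eps i ep0; rewrite truncated_sinE.
have C1 : 0 < `|C| + 1 by rewrite ltr_pwDr.
near=> eps.
have ep0 : 0 < eps by near: eps; exact: nbhs_right_gt.
have ep1 : eps <= 1 by near: eps; exact: nbhs_right_le.
have epC : eps < e / 4 / (`|C| + 1) by near: eps; apply: nbhs_right_lt; rewrite !divr_gt0.
have hL : `|\int[P]_w cos (steps_int N theta r al be eps phi M w) - L| <= C * eps by apply: hC; rewrite ep0 ep1.
have {}hL : `|\int[P]_w cos (steps_int N theta r al be eps phi M w) - L| <= e / 4.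
  apply: le_trans hL _; apply: le_trans (ler_wpM2r (ltW ep0) (ler_norm C)) _.
  rewrite ltr_pdivlMr// in epC; apply: le_trans (ltW epC).
  by rewrite mulrC ler_wpM2l// ?(ltW ep0)// lerDl.
have h1 := dP eps ep0.
move: dQ hL h1; set I1 := \int[_]_z _; set I2 := \int[P]_w _; set I3 := \int[P]_w _.
rewrite !ler_norml ltr_norml => /andP[? ?] /andP[? ?] /andP[? ?]; apply/andP; split; lra.
Unshelve. all: by end_near. Qed.

End FiniteDimensional.

(** * Trigonometric approximation *)

Section Fejer.
Context (R : realType).
Implicit Types (z x : R) (n : nat).

Definition csum n z : R := \sum_(k < n) cos (k%:R * z).
Definition ssum n z : R := \sum_(k < n) sin (k%:R * z).
(** The squared modulus of the sum of the exp(i k z) for k < n, which is [n]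
    times the Fejer kernel. *)
Definition fejer n z : R := csum n z ^+ 2 + ssum n z ^+ 2.

Lemma fejer_ge0 n z : 0 <= fejer n z.
Proof. by rewrite addr_ge0 ?sqr_ge0. Qed.

(** Half the squared modulus of the identity (exp(i z) - 1) * sum = exp(i n
    z) - 1. *)
Lemma fejer_one_sub_cos n z : (1 - cos z) * fejer n z = 1 - cos (n%:R * z).
Proof.
have h1 : (1 - cos z) * csum n z + sin z * ssum n z = 1 - cos (n%:R * z).
  elim: n => [|n IH]; first by rewrite /csum /ssum !big_ord0 mul0r cos0; ring.
  rewrite /csum /ssum !big_ord_recr /= -/(csum n z) -/(ssum n z).
  have -> : n.+1%:R * z = n%:R * z + z by rewrite -natr1; ring.
  by rewrite cosD; lra.
have h2 : (1 - cos z) * ssum n z - sin z * csum n z = - sin (n%:R * z).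
  elim: n {h1} => [|n IH]; first by rewrite /csum /ssum !big_ord0 mul0r sin0; ring.
  rewrite /csum /ssum !big_ord_recr /= -/(csum n z) -/(ssum n z).
  have -> : n.+1%:R * z = n%:R * z + z by rewrite -natr1; ring.
  by rewrite sinD; lra.
have c1 := cos2Dsin2 z; have c2 := cos2Dsin2 (n%:R * z).
have : ((1 - cos z) ^+ 2 + sin z ^+ 2) * fejer n z = (1 - cos (n%:R * z)) ^+ 2 + sin (n%:R * z) ^+ 2.
  by rewrite -h1 -[sin (_ * _)]opprK -h2 /fejer; ring.
have -> : (1 - cos z) ^+ 2 + sin z ^+ 2 = 2 * (1 - cos z) by lra.
have -> : (1 - cos (n%:R * z)) ^+ 2 + sin (n%:R * z) ^+ 2 = 2 * (1 - cos (n%:R * z)) by lra.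
by rewrite -mulrA => /mulfI; apply; rewrite pnatr_eq0.
Qed.

Lemma fejerE n z : fejer n z = \sum_(k < n) \sum_(l < n) cos ((k%:R - l%:R) * z).
Proof.
rewrite /fejer !expr2 /csum /ssum !big_distrlr /= -big_split /=; apply: eq_bigr => k _.
by rewrite -big_split /=; apply: eq_bigr => l _; rewrite mulrBl cosB.
Qed.

Lemma sin_natD2pi x n : sin (x + pi *+ 2 *+ n) = sin x.
Proof. by elim: n => [|n IH]; rewrite ?mulr0n ?addr0// mulrSr addrA sinD2pi IH. Qed.

(** A nontrivial character sums to 0 over the [n]-th roots of unity.
    Multiplication by [2 * sin a] makes the sum telescope. *)
Lemma cos_roots_sum n (k l : 'I_n) z : k != l ->
  \sum_(j < n) cos ((k%:R - l%:R) * (z - 2 * pi * j%:R / n%:R)) = 0.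
Proof.
move=> kl; have n0 : 0 < n%:R :> R by rewrite ltr0n (leq_ltn_trans _ (ltn_ord k)).
set m : R := k%:R - l%:R.
pose a := m * pi / n%:R.
have sa : sin a != 0.
  have pos (i j : 'I_n) : (i < j)%N -> 0 < sin ((j%:R - i%:R) * pi / n%:R :> R).
    move=> ij; apply: sin_gt0_pi; apply/andP; split.
      by rewrite divr_gt0// mulr_gt0 ?pi_gt0// subr_gt0 ltr_nat.
    rewrite ltr_pdivrMr// mulrC ltr_pM2l ?pi_gt0//.
    by apply: (@le_lt_trans _ _ j%:R); rewrite ?ltr_nat// gerBl.
  rewrite /a /m; have [h|h|h] := ltngtP k l.
  - by rewrite (_ : _ / _ = - ((l%:R - k%:R) * pi / n%:R)) ?sinN ?oppr_eq0 ?gt_eqF ?pos//; ring.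
  - by rewrite gt_eqF// pos.
  - by move: kl; rewrite (ord_inj h) eqxx.
apply: (mulfI (mulf_neq0 (_ : 2 != 0 :> R) sa)); first by rewrite pnatr_eq0.
rewrite mulr0 mulr_sumr.
pose g j : R := sin (m * z - 2 * j%:R * a + a).
rewrite (eq_bigr (fun j : 'I_n => g j - g j.+1)) => [|j _]; last first.
  have -> : m * (z - 2 * pi * j%:R / n%:R) = m * z - 2 * j%:R * a.
    by rewrite /a; field; rewrite gt_eqF.
  rewrite /g; have -> : m * z - 2 * j.+1%:R * a + a = m * z - 2 * j%:R * a - a by rewrite -natr1; ring.
  have key (X Y : R) : 2 * sin Y * cos X = sin (X + Y) - sin (X - Y) by rewrite sinB sinD; ring.
  exact: key.
rewrite -(big_mkord xpredT (fun j => g j - g j.+1)).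
have -> : \sum_(0 <= j < n) (g j - g j.+1) = - (g n - g 0%N).
  by rewrite -telescope_sumr// -sumrN; apply: eq_bigr => j _; rewrite opprB.
apply/eqP; rewrite oppr_eq0 subr_eq0; apply/eqP; rewrite /g.
rewrite -(sin_natD2pi (m * z - 2 * n%:R * a + a) k).
rewrite -(sin_natD2pi (m * z - 2 * 0%:R * a + a) l).
have e1 (i : nat) : pi *+ 2 *+ i = 2 * i%:R * pi :> R by rewrite -(mulr_natr (pi *+ 2)) -(mulr_natr pi); ring.
have e2 : 2 * n%:R * a = 2 * m * pi by rewrite /a; field; rewrite gt_eqF.
rewrite !e1 e2; clearbody a; congr sin; rewrite /m; ring.
Qed.

Lemma fejer_roots_sum n z : \sum_(j < n) fejer n (z - 2 * pi * j%:R / n%:R) = n%:R ^+ 2.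
Proof.
under eq_bigr do rewrite fejerE.
rewrite exchange_big /=.
under eq_bigr do rewrite exchange_big /=.
rewrite (eq_bigr (fun k : 'I_n => n%:R)) => [|k _].
  by rewrite sumr_const card_ord expr2 mulr_natr.
rewrite (bigD1 k)//= [X in _ + X]big1 => [|l lk]; last first.
  by apply: cos_roots_sum; rewrite eq_sym.
rewrite addr0; under eq_bigr do rewrite subrr mul0r cos0.
by rewrite sumr_const card_ord.
Qed.

Definition trig_poly (f : R -> R) :=
  exists s : seq (R * R * R), forall x, f x = \sum_(t <- s) t.1.1 * cos (t.1.2 * x + t.2).

Lemma trig_poly_sum (I : Type) (r : seq I) (f : I -> R -> R) :
  (forall i, trig_poly (f i)) -> trig_poly (fun x => \sum_(i <- r) f i x).
Proof.
move=> h; elim: r => [|i r [s hs]]; first by exists [::] => x; rewrite !big_nil.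
have [s' hs'] := h i; exists (s' ++ s) => x.
by rewrite big_cons big_cat /= hs hs'.
Qed.

(** The nodes divide one period [2 * L] evenly, and [weight] is a Fejer
    kernel centred at a node, normalized so that the weights sum to 1. *)
Definition fejer_node (L : R) n (j : nat) : R := - L + 2 * L * j%:R / n%:R.
Definition weight (L : R) n (j : nat) x : R :=
  fejer n (pi / L * x + pi - 2 * pi * j%:R / n%:R) / n%:R ^+ 2.

Section Weights.
Variables (L : R) (n : nat).
Hypotheses (L0 : 0 < L) (n0 : (0 < n)%N).

Let nR : 0 < n%:R :> R. Proof. by rewrite ltr0n. Qed.

Lemma weight_ge0 j x : 0 <= weight L n j x.
Proof. by rewrite divr_ge0 ?fejer_ge0 ?sqr_ge0. Qed.

Lemma weight_sum x : \sum_(j < n) weight L n j x = 1.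
Proof. by rewrite -mulr_suml fejer_roots_sum divff// expf_neq0// gt_eqF. Qed.

Lemma weight_trig j : trig_poly (weight L n j).
Proof.
pose c : R := pi - 2 * pi * j%:R / n%:R.
have -> : weight L n j = fun x => \sum_(k < n) \sum_(l < n)
    ((n%:R ^+ 2)^-1 * cos ((k%:R - l%:R) * (pi / L) * x + (k%:R - l%:R) * c)).
  apply/funext => x; rewrite /weight fejerE mulrC mulr_sumr; apply: eq_bigr => k _.
  rewrite mulr_sumr; apply: eq_bigr => l _; congr (_ * cos _); rewrite /c; ring.
apply: trig_poly_sum => k; apply: trig_poly_sum => l.
by exists [:: ((n%:R ^+ 2)^-1, (k%:R - l%:R) * (pi / L), (k%:R - l%:R) * c)] => x; rewrite big_seq1.
Qed.

Lemma cos_le_far (delta z : R) : 0 <= delta <= pi -> delta <= `|z| <= pi *+ 2 - delta -> cos z <= cos delta.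
Proof.
move=> /andP[d0 dpi] /andP[dz zd].
have mono (y : R) : delta <= y <= pi -> cos y <= cos delta.
  move=> /andP[dy ypi]; move: dy; rewrite le_eqVlt => /predU1P[->//|dy].
  by apply: ltW; rewrite ltr_cos// in_itv/= ?d0 ?dpi ?ypi ?(le_trans d0 (ltW dy)).
rewrite -cos_norm; have [zpi|piz] := lerP `|z| pi; first by apply: mono; rewrite dz.
rewrite -cosN -cosD2pi; apply: mono; rewrite mulr2n in zd *; apply/andP; split; lra.
Qed.

(** Away from the node [1 - cos z] is bounded below, and [fejer_one_sub_cos]
    makes the weight of order [n ^- 2]; the [n] weights of distant nodes then
    sum to order [1 / n]. The condition on [x] keeps it away from the
    translates of the node by a period. *)
Lemma weight_far (delta x : R) (j : 'I_n) : 0 < delta <= pi / 2 -> `|x| <= L / 2 ->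
  L * delta / pi < `|x - fejer_node L n j| ->
  weight L n j x <= 2 / ((1 - cos delta) * n%:R ^+ 2).
Proof.
move=> /andP[d0 dpi] xL far.
have pi0 := @pi_gt0 R.
have c1 : 0 < 1 - cos delta.
  rewrite subr_gt0 -cos0 ltr_cos// in_itv/= ?lexx ?ltW//; lra.
pose z := pi / L * x + pi - 2 * pi * j%:R / n%:R.
have zE : z = pi / L * (x - fejer_node L n j) by rewrite /z /fejer_node; field; rewrite !gt_eqF.
have nd : `|fejer_node L n j| <= L.
  rewrite /fejer_node ler_norml; apply/andP; split.
    by rewrite lerDl divr_ge0 ?mulr_ge0 ?(ltW L0) ?(ltW nR).
  have : 2 * L * j%:R / n%:R <= 2 * L.
    by rewrite ler_pdivrMr// ler_wpM2l ?mulr_ge0 ?(ltW L0)// ler_nat ltnW.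
  lra.
have cz : cos z <= cos delta.
  apply: cos_le_far; first by apply/andP; split; lra.
  rewrite zE normrM ger0_norm ?divr_ge0 ?(ltW pi0) ?(ltW L0)//; apply/andP; split.
    by rewrite mulrAC ler_pdivlMr//; move: (ltW far); rewrite ler_pdivrMr// (mulrC L) (mulrC _ pi).
  have h : `|x - fejer_node L n j| <= L / 2 + L by apply: le_trans (ler_normB _ _) _; exact: lerD.
  apply: le_trans (ler_wpM2l (divr_ge0 (ltW pi0) (ltW L0)) h) _.
  have -> : pi / L * (L / 2 + L) = pi / 2 + pi by field; rewrite gt_eqF.
  by rewrite (mulr2n pi); lra.
rewrite /weight -/z.
have h := fejer_one_sub_cos n z.
have hc := cos_geN1 (n%:R * z).
have f0 := fejer_ge0 n z.
have h2 : (1 - cos delta) * fejer n z <= 2.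
  by apply: (@le_trans _ _ ((1 - cos z) * fejer n z)); [apply: ler_wpM2r => //; lra|rewrite h; lra].
rewrite (invfM (1 - cos delta)) mulrA ler_pM2r ?invr_gt0 ?exprn_gt0//.
by rewrite ler_pdivlMr// mulrC.
Qed.

End Weights.

(** Nodes and weights are chosen before [g], because in [lipschitz_conv_cos]
    the function [g] depends on the other coordinates. *)
Lemma fejer_approx (M Lip L e : R) : 0 <= M -> 0 <= Lip -> 0 < L -> 0 < e ->
  exists n (y : nat -> R) (w : nat -> R -> R), [/\ forall j, trig_poly (w j) &
   forall g : R -> R, (forall x, `|g x| <= M) -> (forall x x', `|g x - g x'| <= Lip * `|x - x'|) ->
    (forall x, `|x| <= L / 2 -> `|g x - \sum_(j < n) g (y j) * w j x| <= e) /\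
    (forall x, `|g x - \sum_(j < n) g (y j) * w j x| <= 2 * M)].
Proof.
move=> M0 Lip0 L0 e0; have pi0 := @pi_gt0 R.
pose delta := Num.min (pi / 2) (e / 2 / ((Lip + 1) * L) * pi).
have d0 : 0 < delta by rewrite lt_min !(divr_gt0, mulr_gt0)// ltr_pwDr.
have dpi : delta <= pi / 2 by rewrite ge_min lexx.
have dL : Lip * (L * delta / pi) <= e / 2.
  have h : delta <= e / 2 / ((Lip + 1) * L) * pi by rewrite ge_min lexx orbT.
  have L1 : 0 < Lip + 1 by rewrite ltr_pwDr.
  apply: (@le_trans _ _ ((Lip + 1) * (L * delta / pi))).
    by apply: ler_wpM2r; rewrite ?lerDl// divr_ge0 ?mulr_ge0 ?ltW.
  rewrite -ler_pdivlMl// ler_pdivrMr// mulrC -ler_pdivlMr// mulrAC; apply: le_trans h _.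
  rewrite le_eqVlt; apply/orP; left; apply/eqP; field; by rewrite !gt_eqF.
have c1 : 0 < 1 - cos delta.
  rewrite subr_gt0 -cos0 ltr_cos// in_itv/= ?lexx ?ltW//; lra.
pose q := 8 * M / ((1 - cos delta) * e).
have q0 : 0 <= q by rewrite divr_ge0// ?mulr_ge0// ltW.
pose n := (Num.truncn q).+1.
have nq : q < n%:R := truncnS_gt q.
have n0 : (0 < n)%N by [].
have nR : 0 < n%:R :> R by rewrite ltr0n.
exists n, (fejer_node L n), (weight L n); split; first by move=> j; exact: weight_trig.
move=> g gM gL.
have diff x : g x - \sum_(j < n) g (fejer_node L n j) * weight L n j x =
    \sum_(j < n) (g x - g (fejer_node L n j)) * weight L n j x.
  rewrite -{1}[g x]mulr1 -(weight_sum L n0 x) mulr_sumr -sumrB.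
  by apply: eq_bigr => j _; rewrite mulrBl.
have gB x x' : `|g x - g x'| <= 2 * M.
  by apply: le_trans (ler_normB _ _) _; have := gM x; have := gM x'; lra.
split=> x; last first.
  rewrite diff; apply: le_trans (ler_norm_sum _ _ _) _.
  have -> : 2 * M = \sum_(j < n) 2 * M * weight L n j x by rewrite -mulr_sumr weight_sum// mulr1.
  apply: ler_sum => j _.
  by rewrite normrM (ger0_norm (weight_ge0 _ _ _ _)) ler_wpM2r// weight_ge0.
move=> xL; rewrite diff; apply: le_trans (ler_norm_sum _ _ _) _.
apply: (@le_trans _ _ (\sum_(j < n) (e / 2 * weight L n j x + 2 * M * (2 / ((1 - cos delta) * n%:R ^+ 2))))).
  apply: ler_sum => j _; rewrite normrM (ger0_norm (weight_ge0 _ _ _ _)).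
  have w0 := weight_ge0 L n j x.
  have t0 : 0 <= 2 / ((1 - cos delta) * n%:R ^+ 2) by rewrite divr_ge0// mulr_ge0 ?sqr_ge0// ltW.
  have [near|far] := lerP `|x - fejer_node L n j| (L * delta / pi).
    rewrite -[leLHS]addr0; apply: lerD; last by rewrite mulr_ge0// mulr_ge0.
    by apply: ler_wpM2r => //; apply: le_trans (gL _ _) _; apply: le_trans dL; exact: ler_wpM2l.
  rewrite -[leLHS]add0r; apply: lerD; first by rewrite mulr_ge0// divr_ge0// ltW.
  by apply: ler_pM => //; apply: (@weight_far L n L0 n0 delta x j) => //; rewrite d0 dpi.
rewrite big_split /= -mulr_sumr weight_sum// sumr_const card_ord -(mulr_natl (2 * M * _)) (mulr1 (e / 2)).
have -> : n%:R * (2 * M * (2 / ((1 - cos delta) * n%:R ^+ 2))) = 4 * M / (1 - cos delta) / n%:R.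
  by field; rewrite !gt_eqF.
suff : 4 * M / (1 - cos delta) / n%:R <= e / 2 by lra.
rewrite ler_pdivrMr//; apply: le_trans (_ : e / 2 * q <= _); last by rewrite ler_wpM2l ?(ltW nq)// divr_ge0// ltW.
rewrite le_eqVlt; apply/orP; left; apply/eqP; rewrite /q; field; by rewrite !gt_eqF.
Qed.

End Fejer.

(** * Lipschitz functions of finitely many coordinates *)

Section Convergence.
Context (R : realType) d (Omega : measurableType d) (P : probability Omega R).
Context d2 (Omega2 : measurableType d2) (P2 : probability Omega2 R).
Variables (q : nat) (U : R -> nat -> Omega -> R) (V : nat -> Omega2 -> R) (m2 : nat -> R).
Hypothesis sqU : forall eps i, 0 < eps -> sqm P (U eps i) (m2 i).
Hypothesis mV : forall i, measurable_fun setT (V i).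
Hypothesis cosU : forall (c : nat -> R) phi,
  \int[P]_w cos (\sum_(i < q) c i * U eps i w + phi) @[eps --> 0^'+]
  --> \int[P2]_w cos (\sum_(i < q) c i * V i w + phi).

Let mU eps i : 0 < eps -> measurable_fun setT (U eps i).
Proof. by move=> e0; have [] := sqU i e0. Qed.

(** The test functions for which the expectations converge. They form a
    vector space, contain the cosines of affine functions, and are stable
    under the limits of [conv_limit]. *)
Definition conv (F : (nat -> R) -> R) := [/\ exists M, forall x, `|F x| <= M,
  forall eps, 0 < eps -> measurable_fun setT (fun w => F (U eps ^~ w)),
  measurable_fun setT (fun w => F (V ^~ w)) &
  \int[P]_w F (U eps ^~ w) @[eps --> 0^'+] --> \int[P2]_w F (V ^~ w)].

Lemma conv_bmf F eps : conv F -> 0 < eps -> bmf (fun w => F (U eps ^~ w)).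
Proof. by move=> [[M FM] mF _ _] e0; split; [exact: mF|exists M => w]. Qed.

Lemma conv_bmf2 F : conv F -> bmf (fun w => F (V ^~ w)).
Proof. by move=> [[M FM] _ mF _]; split => //; exists M => w. Qed.

Lemma conv_ext F G : F =1 G -> conv F -> conv G.
Proof. by move=> /funext ->. Qed.

Lemma conv_cos (c : nat -> R) phi : conv (fun x => cos (\sum_(i < q) c i * x i + phi)).
Proof.
split=> [|eps e0||]; [by exists 1 => x; exact: cos_max| | |exact: cosU].
  apply: (bmf_cos _).1; apply: measurable_funD => //; apply: measurable_sum => i.
  by apply: measurable_funM => //; exact: mU.
apply: (bmf_cos _).1; apply: measurable_funD => //; apply: measurable_sum => i.
exact: measurable_funM.
Qed.

Lemma convZ F a : conv F -> conv (fun x => a * F x).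
Proof.
move=> cF; have [[M FM] mF mF2 c] := cF; split=> [|eps e0||].
- exists (`|a| * M) => x; rewrite normrM ler_wpM2l//.
- by apply: measurable_funM => //; exact: mF.
- exact: measurable_funM.
rewrite (ExZ P2 a (conv_bmf2 cF)).
have ca : a * \int[P]_w F (U eps ^~ w) @[eps --> 0^'+] --> a * \int[P2]_w F (V ^~ w) by apply: cvgMr.
apply: cvg_trans ca.
apply: near_eq_cvg; near=> eps.
have e0 : 0 < eps by near: eps; exact: nbhs_right_gt.
by rewrite (ExZ P a (conv_bmf cF e0)).
Unshelve. all: by end_near. Qed.

Lemma convD F G : conv F -> conv G -> conv (fun x => F x + G x).
Proof.
move=> cF cG; have [[M FM] mF mF2 c] := cF; have [[M' GM] mG mG2 c'] := cG; split=> [|eps e0||].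
- by exists (M + M') => x; apply: le_trans (ler_normD _ _) _; exact: lerD.
- by apply: measurable_funD; [exact: mF|exact: mG].
- exact: measurable_funD.
rewrite (ExD P2 (conv_bmf2 cF) (conv_bmf2 cG)).
apply: cvg_trans; last exact: (cvgD c c').
apply: near_eq_cvg; near=> eps.
have e0 : 0 < eps by near: eps; exact: nbhs_right_gt.
by rewrite [RHS](ExD P (conv_bmf cF e0) (conv_bmf cG e0)).
Unshelve. all: by end_near. Qed.

Lemma conv0 : conv (fun=> 0).
Proof. by apply: conv_ext (convZ 0 (conv_cos (fun=> 0) 0)) => x; rewrite mul0r. Qed.

Lemma conv_sum (I : Type) (r : seq I) (F : I -> (nat -> R) -> R) :
  (forall i, conv (F i)) -> conv (fun x => \sum_(i <- r) F i x).
Proof.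
move=> cF; elim: r => [|i r IH].
  by apply: conv_ext conv0 => x; rewrite big_nil.
by apply: conv_ext (convD (cF i) IH) => x; rewrite big_cons.
Qed.

(** A truncation of [`|y| / n.+1]. Its mean is small for [U] by the second
    moments, uniformly in [eps], and for [V] by dominated convergence, where
    no moment is assumed. *)
Let cut (n : nat) (y : R) : R := Num.min 1 (`|y| / n.+1%:R).

Let cut_le1 n y : `|cut n y| <= 1.
Proof. by rewrite ger0_norm /cut ?ge_min ?lexx// le_min ler01 divr_ge0. Qed.

Let measurable_cut n d' (T : measurableType d') (Y : T -> R) : measurable_fun setT Y ->
  measurable_fun setT (fun w => cut n (Y w)).
Proof.
move=> mY; apply: measurable_minr => //; apply: measurable_funM => //.
exact: measurableT_comp.
Qed.

Let cutU n eps k : 0 < eps -> \int[P]_w cut n (U eps k w) <= (1 + m2 k) / n.+1%:R.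
Proof.
move=> e0; have mUk := mU k e0.
have [i le] : intb P (fun w => n.+1%:R^-1 * (1 + 1^-1 * U eps k w ^+ 2)) (n.+1%:R^-1 * (1 + 1^-1 * m2 k)).
  by apply: intbZ => //; apply: intb_abs => //; exact: sqU.
apply: (@le_trans _ _ (n.+1%:R^-1 * (1 + 1^-1 * m2 k))); last by rewrite invr1 mul1r mulrC.
apply: le_trans le; apply: le_Rintegral => //.
  by apply: (bmf_integrable P); split; [exact: measurable_cut|exists 1 => w].
move=> w _; apply: (@le_trans _ _ (`|U eps k w| / n.+1%:R)); first by rewrite ge_min lexx orbT.
by rewrite mulrC ler_wpM2l//; exact: abs_le_sqr.
Qed.

Let cutV k : \int[P2]_w cut n (V k w) @[n --> \oo] --> 0.
Proof.
have [] := @Ex_bounded_cvg _ _ _ P2 (fun n w => cut n (V k w)) (fun=> 0) 1.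
- by move=> n; exact: measurable_cut.
- by move=> n w; exact: cut_le1.
- move=> w; apply: (@squeeze_cvgr _ _ _ _ (fun=> 0) (fun n => `|V k w| * n.+1%:R^-1)).
  + by apply: nearW => n; rewrite le_min ler01 divr_ge0//= ge_min lexx orbT.
  + exact: cvg_cst.
  + by rewrite -[X in _ --> X](mulr0 `|V k w|); apply: cvgMr; exact: cvg_harmonic.
by move=> _; rewrite Ex_cst.
Qed.

(** The approximation need not be uniform: an error that is large only for
    large [x k] is bounded by a multiple of [cut]. *)
Lemma conv_limit (k : nat) (F : (nat -> R) -> R) (Fn : nat -> (nat -> R) -> R) (M b : R) : 0 <= b ->
  (forall x, `|F x| <= M) -> (forall n, conv (Fn n)) ->
  (forall n x, `|F x - Fn n x| <= n.+1%:R^-1 + b * cut n (x k)) -> conv F.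
Proof.
move=> b0 FM cFn err.
have lim x : Fn n x @[n --> \oo] --> F x.
  apply/cvgrPdist_le => e e0.
  have h : n.+1%:R^-1 + b * (`|x k| * n.+1%:R^-1) @[n --> \oo] --> (0 + b * (`|x k| * 0) : R).
    by apply: cvgD; [exact: cvg_harmonic|apply: cvgMr; apply: cvgMr; exact: cvg_harmonic].
  rewrite !mulr0 addr0 in h.
  have /cvgr0Pnorm_lt/(_ _ e0) := h; apply: filterS => n hn.
  apply: le_trans (err n x) _; apply: le_trans (ltW hn); apply: le_trans (ler_norm _).
  by rewrite lerD2l ler_wpM2l// ge_min lexx orbT.
have mFU eps : 0 < eps -> measurable_fun setT (fun w => F (U eps ^~ w)).
  move=> e0; apply: (@measurable_fun_cvg _ _ _ _ (fun n w => Fn n (U eps ^~ w))) => [n|w _].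
    by have [_ h _ _] := cFn n; exact: h.
  exact: lim.
have mFV : measurable_fun setT (fun w => F (V ^~ w)).
  apply: (@measurable_fun_cvg _ _ _ _ (fun n w => Fn n (V ^~ w))) => [n|w _].
    by have [_ _ h _] := cFn n.
  exact: lim.
split => //; first by exists M.
have bFU eps : 0 < eps -> bmf (fun w => F (U eps ^~ w)) by move=> e0; split; [exact: mFU|exists M => w].
have bFV : bmf (fun w => F (V ^~ w)) by split => //; exists M => w.
have diffU n eps : 0 < eps -> `|\int[P]_w F (U eps ^~ w) - \int[P]_w Fn n (U eps ^~ w)| <= (1 + b * (1 + m2 k)) / n.+1%:R.
  move=> e0; have bn := conv_bmf (cFn n) e0.
  have bc : bmf (fun w => cut n (U eps k w)) by split; [apply: measurable_cut; exact: mU|exists 1 => w].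
  rewrite -ExB//; last exact: bFU.
  apply: (@intb_le _ _ _ P _ (fun w => n.+1%:R^-1 + b * cut n (U eps k w))).
  - by apply: measurable_funB; [exact: mFU|have [] := bn].
  - by move=> w; exact: err.
  - rewrite mulrDl mul1r; apply: intbD; first exact: intb_cst.
    by rewrite -mulrA; apply: intbZ => //; split; [exact: bmf_integrable|exact: cutU].
have diffV n : `|\int[P2]_w F (V ^~ w) - \int[P2]_w Fn n (V ^~ w)| <= n.+1%:R^-1 + b * \int[P2]_w cut n (V k w).
  have bn := conv_bmf2 (cFn n).
  have bc : bmf (fun w => cut n (V k w)) by split; [exact: measurable_cut|exists 1 => w].
  rewrite -ExB//.
  apply: (@intb_le _ _ _ P2 _ (fun w => n.+1%:R^-1 + b * cut n (V k w))).
  - by apply: measurable_funB => //; have [] := bn.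
  - by move=> w; exact: err.
  - apply: intbD; first exact: intb_cst.
    by apply: intbZ => //; split; [exact: bmf_integrable|].
apply/cvgrPdist_lt => e e0.
have e4 : 0 < e / 4 by rewrite divr_gt0.
have h1 : (1 + b * (1 + m2 k)) / n.+1%:R @[n --> \oo] --> (0 : R).
  by rewrite -[X in _ --> X](mulr0 (1 + b * (1 + m2 k))); apply: cvgMr; exact: cvg_harmonic.
have h2 : n.+1%:R^-1 + b * \int[P2]_w cut n (V k w) @[n --> \oo] --> (0 + b * 0 : R).
  by apply: cvgD; [exact: cvg_harmonic|apply: cvgMr; exact: cutV].
rewrite mulr0 addr0 in h2.
have [n [n1 n2]] : exists n, (1 + b * (1 + m2 k)) / n.+1%:R < e / 4 /\
    n.+1%:R^-1 + b * \int[P2]_w cut n (V k w) < e / 4.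
  have /cvgr0Pnorm_lt/(_ _ e4) a1 := h1; have /cvgr0Pnorm_lt/(_ _ e4) a2 := h2.
  have [j _ hj] := filterI a1 a2; exists j; have [] := hj j (leqnn j) => x1 x2.
  by split; apply: le_lt_trans (ler_norm _) _.
have [_ _ _ cn] := cFn n.
near=> eps.
have ep0 : 0 < eps by near: eps; exact: nbhs_right_gt.
have c1 : `|\int[P2]_w Fn n (V ^~ w) - \int[P]_w Fn n (U eps ^~ w)| < e / 4.
  by near: eps; move/cvgrPdist_lt : cn; apply.
have := diffU n _ ep0; have := diffV n; move: c1 n1 n2.
move: ((_ + _ * _) / _) (_^-1 + _ * _) => z1 z2.
rewrite !ltr_norml !ler_norml => /andP[? ?] ? ? /andP[? ?] /andP[? ?]; apply/andP; split; lra.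
Unshelve. all: by end_near. Qed.

(** A product of two cosines is half the sum of two cosines of affine
    functions. *)
Lemma conv_cos_shift (G : (nat -> R) -> R) (k : nat) (c : nat -> R) (phi b a : R) : (k < q)%N ->
  (forall (c : nat -> R) phi, conv (fun x => G x * cos (\sum_(i < q) c i * x i + phi))) ->
  conv (fun x => G x * (cos (b * x k + a) * cos (\sum_(i < q) c i * x i + phi))).
Proof.
move=> kq h.
have shift (b' : R) (x : nat -> R) : \sum_(i < q) (c i + (i == k :> nat)%:R * b') * x i = \sum_(i < q) c i * x i + b' * x k.
  under eq_bigr do rewrite mulrDl.
  rewrite big_split /=; congr (_ + _); rewrite (bigD1 (Ordinal kq))//= eqxx mul1r big1 ?addr0// => i.
  by rewrite -val_eqE /= => /negPf ->; rewrite !mul0r.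
have h1 := h (fun i => c i + (i == k)%:R * b) (phi + a).
have h2 := h (fun i => c i + (i == k)%:R * (- b)) (phi - a).
apply: conv_ext (convZ 2^-1 (convD h1 h2)) => x.
rewrite !shift.
set S := \sum_(i < q) c i * x i.
have -> : S + b * x k + (phi + a) = (S + phi) + (b * x k + a) by ring.
have -> : S + - b * x k + (phi - a) = (S + phi) - (b * x k + a) by ring.
by rewrite cosB cosD; field.
Qed.

Definition put (x : nat -> R) (k : nat) (v : R) (i : nat) := if i == k then v else x i.

(** Induction on the number [k] of coordinates on which [G] depends. In the
    last one, [G] is replaced by an average of its values at the nodes, which
    depend on one coordinate less, with trigonometric weights. The cosine
    factor of the statement is there to absorb these weights. *)
Lemma lipschitz_conv_cos (M Lip : R) (k : nat) (G : (nat -> R) -> R) (c : nat -> R) (phi : R) :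
  0 <= M -> 0 <= Lip -> (k <= q)%N -> (forall x, `|G x| <= M) ->
  (forall x y, `|G x - G y| <= Lip * \sum_(i < q) `|x i - y i|) ->
  (forall x y, (forall i, (i < k)%N -> x i = y i) -> G x = G y) ->
  conv (fun x => G x * cos (\sum_(i < q) c i * x i + phi)).
Proof.
move=> M0 Lip0; elim: k G c phi => [|k IH] G c phi kq GM GL Gk.
  apply: conv_ext (convZ (G (fun=> 0)) (conv_cos c phi)) => x.
  by rewrite (Gk x (fun=> 0)).
have putk (x : nat -> R) : put x k (x k) = x.
  by apply/funext => i; rewrite /put; case: eqP => // ->.
have app n : exists z : nat * (nat -> R) * (nat -> R -> R), (forall j, trig_poly (z.2 j)) /\
    (forall g : R -> R, (forall x, `|g x| <= M) -> (forall x x', `|g x - g x'| <= Lip * `|x - x'|) ->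
    (forall x, `|x| <= 2 * n.+1%:R / 2 -> `|g x - \sum_(j < z.1.1) g (z.1.2 j) * z.2 j x| <= n.+1%:R^-1) /\
    (forall x, `|g x - \sum_(j < z.1.1) g (z.1.2 j) * z.2 j x| <= 2 * M)).
  have n1 : 0 < n.+1%:R^-1 :> R by rewrite invr_gt0.
  have n2 : 0 < 2 * n.+1%:R :> R by rewrite mulr_gt0.
  have [m [y [w [h1 h2]]]] := @fejer_approx R M Lip _ _ M0 Lip0 n2 n1.
  by exists (m, y, w).
have [z hz] := choice app.
pose Gj n j x := G (put x k ((z n).1.2 j)).
have GjL n j x y : `|Gj n j x - Gj n j y| <= Lip * \sum_(i < q) `|x i - y i|.
  apply: le_trans (GL _ _) _; apply: ler_wpM2l => //; apply: ler_sum => i _.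
  by rewrite /put; case: ifP => //; rewrite subrr normr0.
have Gjk n j x y : (forall i, (i < k)%N -> x i = y i) -> Gj n j x = Gj n j y.
  move=> h; apply: Gk => i; rewrite ltnS leq_eqVlt /put => /predU1P[->|ik]; first by rewrite eqxx.
  by case: ifP => // _; exact: h.
have cj n j (c' : nat -> R) phi' : conv (fun x => Gj n j x * cos (\sum_(i < q) c' i * x i + phi')).
  by apply: IH; [exact: ltnW kq|move=> x; exact: GM|exact: GjL|exact: Gjk].
apply: (@conv_limit k _ (fun n x => \sum_(j < (z n).1.1) Gj n j x * ((z n).2 j (x k) * cos (\sum_(i < q) c i * x i + phi))) M (2 * M)).
- by rewrite mulr_ge0.
- move=> x; rewrite normrM -[leRHS]mulr1; apply: ler_pM => //; exact: cos_max.
- move=> n; apply: conv_sum => j; have [tp _] := hz n; have [s hs] := tp j.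
  apply: (@conv_ext (fun x => \sum_(t <- s) t.1.1 * (Gj n j x * (cos (t.1.2 * x k + t.2) * cos (\sum_(i < q) c i * x i + phi))))).
    move=> x; rewrite hs mulr_suml mulr_sumr; apply: eq_bigr => t _; ring.
  by apply: conv_sum => t; apply: convZ; apply: conv_cos_shift => //; exact: cj.
- move=> n x; have [_ /(_ (fun v => G (put x k v)))] := hz n.
  have gL v v' : `|G (put x k v) - G (put x k v')| <= Lip * `|v - v'|.
    apply: le_trans (GL _ _) _; apply: ler_wpM2l => //.
    rewrite (bigD1 (Ordinal kq))//= /put eqxx big1 ?addr0// => i.
    by rewrite -val_eqE /= => /negPf ->; rewrite subrr normr0.
  move=> /(_ (fun v => GM _) gL)[near far].
  have -> : G x * cos (\sum_(i < q) c i * x i + phi) -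
     \sum_(j < (z n).1.1) Gj n j x * ((z n).2 j (x k) * cos (\sum_(i < q) c i * x i + phi)) =
     (G (put x k (x k)) - \sum_(j < (z n).1.1) Gj n j x * (z n).2 j (x k)) * cos (\sum_(i < q) c i * x i + phi).
    rewrite putk mulrBl mulr_suml; congr (_ - _); apply: eq_bigr => j _; ring.
  rewrite normrM; apply: (@le_trans _ _ `|G (put x k (x k)) - \sum_(j < (z n).1.1) Gj n j x * (z n).2 j (x k)|).
    by rewrite ler_piMr// cos_max.
  have n1 : 0 < n.+1%:R :> R by rewrite ltr0n.
  have c0 : 0 <= cut n (x k) by rewrite le_min ler01 divr_ge0.
  have [xk|xk] := lerP `|x k| n.+1%:R.
    apply: (@le_trans _ _ n.+1%:R^-1); last by rewrite lerDl !mulr_ge0.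
    by apply: near; rewrite mulrAC mulfV ?mul1r.
  have -> : cut n (x k) = 1 by apply/min_idPl; rewrite ler_pdivlMr// mul1r ltW.
  by apply: le_trans (far _) _; rewrite mulr1 lerDr invr_ge0.
Qed.

Lemma lipschitz_conv (M Lip : R) (G : (nat -> R) -> R) : 0 <= Lip ->
  (forall x, `|G x| <= M) ->
  (forall x y, `|G x - G y| <= Lip * \sum_(i < q) `|x i - y i|) -> conv G.
Proof.
move=> Lip0 GM GL.
have M0 : 0 <= M by apply: le_trans (GM (fun=> 0)); exact: normr_ge0.
apply: conv_ext (@lipschitz_conv_cos M Lip q G (fun=> 0) 0 M0 Lip0 (leqnn q) GM GL _) => [x|x y h].
  by rewrite big1 ?addr0 ?cos0 ?mulr1// => i _; rewrite mul0r.
apply/eqP; rewrite -subr_eq0 -normr_le0; apply: le_trans (GL x y) _.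
by rewrite big1 ?mulr0// => i _; rewrite h// subrr normr0.
Qed.

End Convergence.

(** * Dyadic interpolation *)

Lemma uniform_continuity (R : realType) (f : R -> R) (a b e : R) : continuous f -> 0 < e ->
  exists2 delta, 0 < delta & forall x y, `[a, b]%classic x -> `|y - x| < delta -> `|f y - f x| <= e.
Proof.
move=> cf e0.
have /compact_near_coveringP cov := @segment_compact R a b.
have := cov R (0^'+) (fun delta x => forall y, `|y - x| < delta -> `|f y - f x| <= e) _.
have e2 : 0 < e / 2 by rewrite divr_gt0.
case=> [x _|d /= d0 hd].
  have /cvgrPdist_lt/(_ _ e2)/nbhs_ballP[r /= r0 hr] := cf x.
  exists (ball x (r / 2), [set d | d < r / 2]) => /=.
    split; first by apply: nbhsx_ballx; rewrite divr_gt0.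
    by apply: nbhs_right_lt; rewrite divr_gt0.
  move=> [x' d] /= [xx' dr] y yx'.
  have h1 : `|f x - f x'| < e / 2.
    apply: hr; rewrite /ball /= in xx' *; apply: lt_trans xx' _; lra.
  have h2 : `|f x - f y| < e / 2.
    apply: hr; rewrite /ball /= in xx' *.
    rewrite (_ : x - y = (x - x') - (y - x')); last by ring.
    by apply: le_lt_trans (ler_normB _ _) _; lra.
  rewrite (_ : f y - f x' = (f x - f x') - (f x - f y)); last by ring.
  by apply: le_trans (ler_normB _ _) _; lra.
exists (d / 2); first by rewrite divr_gt0.
move=> x y xab; apply: (hd (d / 2)) => //=.
  by rewrite sub0r normrN gtr0_norm ?divr_gt0//; lra.
by rewrite divr_gt0.
Qed.

Section Interpolation.
Context (R : realType) (T : R).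
Hypothesis T0 : 0 < T.
Implicit Types (v x : nat -> R) (n k : nat).

Definition mesh n : R := T / 2 ^+ n.
(** Capping at [T] makes the nodes monotone and within [0, T] for every
    index. *)
Definition node n k : R := Num.min T (k%:R * mesh n).
(** Divided by their sum, these tents make [interp] an average of the values
    at the nodes closer to [t] than the mesh, which is all that the estimates
    use. *)
Definition bump n k (t : R) : R := Num.max 0 (mesh n - `|t - node n k|).
Definition bump_sum n t : R := \sum_(k < (2 ^ n).+1) bump n k t.
Definition interp n v t : R := (\sum_(k < (2 ^ n).+1) v k * bump n k t) / bump_sum n t.

Lemma mesh_gt0 n : 0 < mesh n.
Proof. by rewrite divr_gt0// exprn_gt0. Qed.

Lemma meshS n : mesh n = 2 * mesh n.+1.
Proof. by rewrite /mesh exprS; field; rewrite expf_neq0. Qed.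

Lemma mesh_cvg0 e : 0 < e -> exists n, mesh n < e.
Proof.
move=> e0.
have h : T * (2^-1 ^+ n) @[n --> \oo] --> (T * 0 : R).
  by apply: cvgMr; apply: cvg_expr; rewrite ger0_norm// invf_lt1// ltr1n.
rewrite mulr0 in h; have /cvgr0Pnorm_lt/(_ _ e0)[n _ hn] := h.
exists n; apply: le_lt_trans (hn n (leqnn n)); apply: le_trans (ler_norm _).
by rewrite /mesh exprVn.
Qed.

Lemma mesh_total n : (2 ^ n)%:R * mesh n = T.
Proof. by rewrite /mesh natrX; field; rewrite expf_neq0. Qed.

Lemma node_in n k : 0 <= node n k <= T.
Proof. by rewrite /node le_min (ltW T0) mulr_ge0 ?(ltW (mesh_gt0 n))//= ge_min lexx. Qed.

Lemma nodeE n k : (k <= 2 ^ n)%N -> node n k = k%:R * mesh n.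
Proof.
move=> kn; apply/min_idPr; rewrite -(mesh_total n) ler_wpM2r ?(ltW (mesh_gt0 n))//.
by rewrite ler_nat.
Qed.

Lemma node_homo n : {homo node n : i j / (i <= j)%N >-> i <= j}.
Proof.
move=> i j ij; rewrite /node le_min ge_min lexx /= ge_min; apply/orP; right.
by rewrite ler_wpM2r ?(ltW (mesh_gt0 n))// ler_nat.
Qed.

Lemma node_step n k : node n k.+1 - node n k <= mesh n.
Proof.
have h := mesh_gt0 n; rewrite lerBlDr {2}/node.
have [c|c] := lerP T (k%:R * mesh n).
  by apply: (@le_trans _ _ T); [have /andP[] := node_in n k.+1|rewrite lerDr ltW].
by apply: (@le_trans _ _ (k.+1%:R * mesh n)); [rewrite ge_min lexx orbT|rewrite -natr1; lra].
Qed.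

Lemma node0 n : node n 0 = 0.
Proof. by rewrite /node mul0r; apply/min_idPr; exact: ltW. Qed.

Lemma node_double n k : (k <= 2 ^ n)%N -> node n k = node n.+1 (k.*2).
Proof.
move=> kn; rewrite !nodeE//; last by rewrite expnS mul2n leq_double.
by rewrite meshS -mul2n natrM; ring.
Qed.

Lemma bump_ge0 n k t : 0 <= bump n k t.
Proof. by rewrite le_max lexx. Qed.

Lemma bump_neq0 n k t : bump n k t != 0 -> `|t - node n k| < mesh n.
Proof.
move=> b0; rewrite ltNge; apply: contra b0 => h; rewrite /bump; apply/eqP/max_idPl; by rewrite subr_le0.
Qed.

Lemma bump_sum_gt0 n t : 0 <= t <= T -> 0 < bump_sum n t.
Proof.
move=> /andP[t0 tT]; have h0 := mesh_gt0 n.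
have q0 : 0 <= t / mesh n by rewrite divr_ge0// ltW.
pose k := Num.truncn (t / mesh n).
have /andP[k1 k2] : k%:R <= t / mesh n < k.+1%:R by apply: truncn_itv.
rewrite ler_pdivlMr// in k1; rewrite ltr_pdivrMr// in k2.
have kn : (k < (2 ^ n).+1)%N.
  rewrite ltnS -(ler_nat R) -(ler_pM2r h0) mesh_total; exact: le_trans k1 tT.
rewrite /bump_sum (bigD1 (Ordinal kn))//= ltr_pwDl//; last by apply: sumr_ge0 => i _; exact: bump_ge0.
rewrite lt_max; apply/orP; right; rewrite subr_gt0 nodeE// ger0_norm ?subr_ge0//.
by move: k2; rewrite -natr1; lra.
Qed.

Lemma interp_close n v t c e : 0 <= t <= T ->
  (forall k, (k <= 2 ^ n)%N -> `|t - node n k| < mesh n -> `|v k - c| <= e) ->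
  `|interp n v t - c| <= e.
Proof.
move=> tT h; have s0 := bump_sum_gt0 n tT.
have -> : interp n v t - c = (\sum_(k < (2 ^ n).+1) (v k - c) * bump n k t) / bump_sum n t.
  rewrite /interp -[c in LHS](mulfK (lt0r_neq0 s0)) -mulrBl; congr (_ / _).
  by rewrite mulr_sumr -sumrB; apply: eq_bigr => k _; rewrite mulrBl.
rewrite normrM normfV (gtr0_norm s0) ler_pdivrMr//.
apply: le_trans (ler_norm_sum _ _ _) _; rewrite mulr_sumr; apply: ler_sum => k _.
rewrite normrM (ger0_norm (bump_ge0 _ _ _)).
have [->|/bump_neq0 b0] := eqVneq (bump n k t) 0; first by rewrite !mulr0.
by rewrite ler_wpM2r ?bump_ge0// h// -ltnS.
Qed.

Lemma interp_lipschitz n v v' t : 0 <= t <= T ->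
  `|interp n v t - interp n v' t| <= \sum_(k < (2 ^ n).+1) `|v k - v' k|.
Proof.
move=> tT; have s0 := bump_sum_gt0 n tT.
rewrite /interp -mulrBl -sumrB normrM normfV (gtr0_norm s0) ler_pdivrMr//.
apply: le_trans (ler_norm_sum _ _ _) _; rewrite mulr_suml; apply: ler_sum => k _.
rewrite -mulrBl normrM (ger0_norm (bump_ge0 _ _ _)) ler_wpM2l//.
rewrite /bump_sum (bigD1 k)//= lerDl; apply: sumr_ge0 => i _; exact: bump_ge0.
Qed.

Lemma interp_cts n v t : 0 <= t <= T -> {for t, continuous (interp n v)}.
Proof.
move=> tT.
have cb k (s : R) : {for s, continuous (bump n k)}.
  apply: continuous_max; first exact: cvg_cst.
  apply: cvgB; first exact: cvg_cst.
  by apply: cvg_norm; apply: cvgB; [exact: cvg_id|exact: cvg_cst].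
have cs (g : nat -> R -> R) m (s : R) : (forall k, {for s, continuous (g k)}) ->
    {for s, continuous (fun t => \sum_(k < m) g k t)}.
  move=> hg; elim: m => [|m IH].
    by rewrite (_ : (fun t => _) = fun=> 0); [exact: cvg_cst|apply/funext => z; rewrite big_ord0].
  rewrite (_ : (fun t => _) = fun t => \sum_(k < m) g k t + g m t); last by apply/funext => z; rewrite big_ord_recr.
  by apply: cvgD => //; exact: hg.
apply: cvgM.
  by apply: (cs (fun k t => v k * bump n k t)) => k; apply: cvgM; [exact: cvg_cst|exact: cb].
apply: cvgV; first by rewrite gt_eqF// bump_sum_gt0.
by apply: (cs (bump n)).
Qed.

Lemma increments_le n (x : R -> R) B i m : (i + m <= 2 ^ n)%N ->
  (forall k, (k < 2 ^ n)%N -> `|x (node n k.+1) - x (node n k)| <= B) ->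
  `|x (node n (i + m)) - x (node n i)| <= m%:R * B.
Proof.
move=> im h; elim: m im => [|m IH] im; first by rewrite addn0 subrr normr0 mul0r.
rewrite addnS in im *.
rewrite (_ : x (node n (i + m).+1) - x (node n i) =
  (x (node n (i + m).+1) - x (node n (i + m))) + (x (node n (i + m)) - x (node n i))); last by ring.
apply: le_trans (ler_normD _ _) _; rewrite -natr1 mulrDl mul1r addrC.
by apply: lerD; [exact: IH (ltnW im)|exact: h].
Qed.

Lemma increments_le2 n (x : R -> R) B i j : (i <= 2 ^ n)%N -> (j <= 2 ^ n)%N ->
  `|node n i - node n j| < 3 * mesh n -> 0 <= B ->
  (forall k, (k < 2 ^ n)%N -> `|x (node n k.+1) - x (node n k)| <= B) ->
  `|x (node n i) - x (node n j)| <= 2 * B.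
Proof.
wlog ji : i j / (j <= i)%N.
  move=> wl iN jN; have [h|h] := leqP j i; first exact: wl.
  by rewrite distrC (distrC (x _)); apply: wl => //; exact: ltnW.
move=> iN jN; rewrite !nodeE// -mulrBl -natrB// normrM ger0_norm// (gtr0_norm (mesh_gt0 n)).
rewrite ltr_pM2r ?mesh_gt0// ltr_nat ltnS => d2 B0 h.
have := @increments_le n x B j (i - j).
rewrite subnKC// => /(_ iN h); rewrite !nodeE// => /le_trans; apply.
by rewrite ler_wpM2r// ler_nat.
Qed.

(** A node of level [n] and one of level [n.+1] that both act at [t] are less
    than [3 * mesh n.+1] apart, hence at most two steps of the level [n.+1].
    *)
Lemma interp_refine n (x : R -> R) B t : 0 <= t <= T -> 0 <= B ->
  (forall k, (k < 2 ^ n.+1)%N -> `|x (node n.+1 k.+1) - x (node n.+1 k)| <= B) ->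
  `|interp n.+1 (fun k => x (node n.+1 k)) t - interp n (fun k => x (node n k)) t| <= 2 * B.
Proof.
move=> tT B0 h; apply: interp_close => // k kn tk.
rewrite distrC; apply: interp_close => // l ln tl.
rewrite (node_double ln); apply: increments_le2 => //.
  by rewrite expnS mul2n leq_double.
rewrite -(node_double ln) (_ : node n l - node n.+1 k = (t - node n.+1 k) - (t - node n l)); last by ring.
apply: le_lt_trans (ler_normB _ _) _; rewrite meshS in tl; lra.
Qed.

Lemma interp_cvg (x : R -> R) e : continuous x -> 0 < e ->
  exists m, forall n t, (m <= n)%N -> 0 <= t <= T -> `|interp n (fun k => x (node n k)) t - x t| <= e.
Proof.
move=> cx e0; have [d d0 hd] := uniform_continuity 0 T cx e0.
have [m md] := mesh_cvg0 d0; exists m => n t mn tT.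
apply: interp_close => // k kn tk; apply: hd; first by rewrite /= in_itv.
rewrite distrC; apply: lt_trans tk _; apply: le_lt_trans md.
by rewrite /mesh ler_pM2l// lef_pV2 ?posrE ?exprn_gt0// ler_eXn2l// ltr1n.
Qed.

End Interpolation.

(** * The space of continuous paths *)

Section Paths.
Context (R : realType) (T : R).
Hypothesis T0 : 0 < T.

Definition clamp (r : R) : R := Num.max 0 (Num.min T r).

Lemma clamp_in r : 0 <= clamp r <= T.
Proof. by rewrite /clamp le_max lexx /= ge_max (ltW T0) ge_min lexx. Qed.

Lemma clampE r : 0 <= r <= T -> clamp r = r.
Proof. by move=> /andP[r0 rT]; rewrite /clamp (min_r rT) (max_r r0). Qed.

Lemma clamp_set r : clamp r \in `[0, T]%classic.
Proof. by rewrite inE /= in_itv; exact: clamp_in. Qed.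

Definition pt (r : R) : set_type `[0, T] := exist _ (clamp r) (clamp_set r).

Lemma pt_val (t : set_type `[0, T]) : pt (\val t) = t.
Proof.
apply: val_inj => /=; apply: clampE.
by case: t => /= t; rewrite inE /= in_itv.
Qed.

Lemma clamp_continuous : continuous clamp.
Proof.
move=> r; apply: continuous_max; first exact: cvg_cst.
by apply: continuous_min; [exact: cvg_cst|exact: cvg_id].
Qed.

Lemma pt_continuous : continuous pt.
Proof.
apply: continuous_comp_initial.
exact: clamp_continuous.
Qed.

(** Evaluation at any real number, through its projection to [0, T],
    dispenses with membership proofs. *)
Definition ev (x : contT T) (r : R) : R := x (pt r).

Lemma contT_continuous (x : contT T) : continuous (x : set_type `[0, T] -> R).
Proof. exact: cts_fun. Qed.

Lemma ev_continuous (x : contT T) : continuous (ev x).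
Proof.
move=> r; apply: continuous_comp; first exact: pt_continuous.
exact: contT_continuous.
Qed.

Lemma restrict_continuous (g : R -> R) : (forall t, 0 <= t <= T -> {for t, continuous g}) ->
  continuous (fun t : set_type `[0, T] => g (\val t)).
Proof.
move=> cg t; apply: continuous_comp; first exact: initial_continuous.
by apply: cg; case: t => /= t; rewrite inE /= in_itv.
Qed.

Definition path_of (g : R -> R) (cg : forall t, 0 <= t <= T -> {for t, continuous g}) : contT T :=
  mkcts (restrict_continuous cg).

Definition project (n : nat) (v : nat -> R) : contT T := path_of (interp_cts T0 (n := n) (v := v)).

(** The uniform distance enters only through its upper bounds, so that no
    supremum is taken. *)
Definition close (x y : contT T) (c : R) := forall r, `|ev x r - ev y r| <= c.

Lemma close_ball (x y : contT T) (e : R) : 0 < e -> close x y (e / 2) -> ball x e y.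
Proof.
move=> e0 h.
have h' (t : set_type `[0, T]) : `|x t - y t| < e.
  have := h (\val t); rewrite /ev pt_val => /le_lt_trans; apply.
  by rewrite ltr_pdivrMr// ltr_pMr// ltr1n.
exact: h'.
Qed.

Lemma nbhs_close (z : contT T * contT T) (A : set (contT T * contT T)) : nbhs z A ->
  exists2 e, 0 < e & forall y, close z.1 y.1 e -> close z.2 y.2 e -> A y.
Proof.
move=> /nbhs_ballP[e /= e0 h]; exists (e / 2); first by rewrite divr_gt0.
by move=> y h1 h2; apply: h; split; exact: close_ball.
Qed.

Lemma nbhs_close1 (z : contT T) (A : set (contT T)) : nbhs z A ->
  exists2 e, 0 < e & forall y, close z y e -> A y.
Proof.
move=> /nbhs_ballP[e /= e0 h]; exists (e / 2); first by rewrite divr_gt0.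
by move=> y h1; apply: h; exact: close_ball.
Qed.

Lemma ev_project n v r : ev (project n v) r = interp T n v (clamp r).
Proof. by []. Qed.

End Paths.

Arguments ev : simpl never.
Arguments project : simpl never.

(** * From Lipschitz to continuous functionals *)

Section InfConvolution.
Context (R : realType) (T : R).
Hypothesis T0 : 0 < T.
Notation ev := (ev T0).
Notation close := (close T0).
Notation S := (contT T * contT T)%type.

Definition close2 (z y : S) c := close z.1 y.1 c /\ close z.2 y.2 c.

Definition lipschitz2 (f : S -> R) (k : R) := forall z y c, close2 z y c -> `|f z - f y| <= k * c.

Lemma close2_refl z : close2 z z 0.
Proof. by split=> r; rewrite subrr normr0. Qed.

Lemma close2_sym z y c : close2 z y c -> close2 y z c.
Proof. by move=> [h1 h2]; split=> r; rewrite distrC. Qed.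

Lemma close2_trans z y x c c' : close2 z y c -> close2 y x c' -> close2 z x (c + c').
Proof.
move=> [h1 h2] [h3 h4]; split=> r.
  by apply: le_trans (ler_distD (ev y.1 r) _ _) _; exact: lerD.
by apply: le_trans (ler_distD (ev y.2 r) _ _) _; exact: lerD.
Qed.

Lemma close2_ge0 z y c : close2 z y c -> 0 <= c.
Proof. by move=> [h _]; apply: le_trans (h 0); exact: normr_ge0. Qed.

Variables (f : S -> R) (M : R).
Hypothesis fM : forall z, `|f z| <= M.

(** The largest [k]-Lipschitz function below [f]; the distance is replaced by
    its upper bounds [c]. *)
Definition inf_conv (k : R) (z : S) : R :=
  inf [set v | exists y c, close2 z y c /\ v = f y + k * c].

Let bnd k z : 0 <= k -> has_inf [set v | exists y c, close2 z y c /\ v = f y + k * c].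
Proof.
move=> k0; split.
  by exists (f z + k * 0), z, 0; split => //; exact: close2_refl.
exists (- M) => v [y [c [zy ->]]].
have c0 := close2_ge0 zy; have := fM y; rewrite ler_norml => /andP[h _].
by rewrite -[- M]addr0; apply: lerD => //; exact: mulr_ge0.
Qed.

Lemma inf_conv_le_at k z y c : 0 <= k -> close2 z y c -> inf_conv k z <= f y + k * c.
Proof.
move=> k0 zy; apply: ge_inf; first by case: (bnd z k0).
by exists y, c.
Qed.

Lemma inf_conv_le k z : 0 <= k -> inf_conv k z <= f z.
Proof. by move=> k0; have := inf_conv_le_at k0 (close2_refl z); rewrite mulr0 addr0. Qed.

Lemma le_inf_conv k z b : 0 <= k -> (forall y c, close2 z y c -> b <= f y + k * c) -> b <= inf_conv k z.
Proof.
move=> k0 h; apply: lb_le_inf; first by case: (bnd z k0).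
by move=> v [y [c [zy ->]]]; exact: h.
Qed.

Lemma inf_conv_bounded k z : 0 <= k -> `|inf_conv k z| <= M.
Proof.
move=> k0; rewrite ler_norml; apply/andP; split.
  apply: le_inf_conv => // y c zy; have c0 := close2_ge0 zy.
  have := fM y; rewrite ler_norml => /andP[h _].
  by rewrite -[- M]addr0; apply: lerD => //; exact: mulr_ge0.
by apply: le_trans (inf_conv_le z k0) _; apply: le_trans (ler_norm _) (fM z).
Qed.

Lemma inf_conv_lipschitz k : 0 <= k -> lipschitz2 (inf_conv k) k.
Proof.
move=> k0.
have half z y c : close2 z y c -> inf_conv k z - k * c <= inf_conv k y.
  move=> zy; apply: le_inf_conv => // x c' yx; rewrite lerBlDr.
  by have := inf_conv_le_at k0 (close2_trans zy yx); lra.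
move=> z y c zy; have h1 := half _ _ _ zy; have h2 := half _ _ _ (close2_sym zy).
by rewrite ler_norml; apply/andP; split; lra.
Qed.

(** Points beyond [delta] pay at least [k * delta >= 2 * M], more than [f]
    can vary. *)
Lemma inf_conv_near z delta e : 0 < delta -> 0 <= e ->
  (forall y, close2 z y delta -> `|f z - f y| <= e) ->
  forall k, 2 * M / delta <= k -> f z - e <= inf_conv k z.
Proof.
move=> d0 e0 h k hk.
have M0 : 0 <= M by apply: le_trans (fM z); exact: normr_ge0.
have k0 : 0 <= k by apply: le_trans hk; rewrite divr_ge0 ?mulr_ge0// ltW.
apply: le_inf_conv => // y c zy; have c0 := close2_ge0 zy.
have [cd|dc] := lerP c delta.
  have zy' : close2 z y delta by case: zy => h1 h2; split=> r; apply: le_trans cd.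
  have := h _ zy'; rewrite ler_norml => /andP[_ h1].
  have := mulr_ge0 k0 c0; lra.
have kd : 2 * M <= k * c.
  apply: (@le_trans _ _ (k * delta)); first by rewrite -ler_pdivrMr.
  by rewrite ler_wpM2l// ltW.
have := fM z; have := fM y; rewrite !ler_norml => /andP[? ?] /andP[? ?]; lra.
Qed.

Lemma inf_conv_cvg : continuous f -> forall z, inf_conv n%:R z @[n --> \oo] --> f z.
Proof.
move=> cf z; apply/cvgrPdist_le => e e0.
have /cvgrPdist_le/(_ _ e0)/nbhs_close -/(_ T0)[d d0 hd] := cf z.
have h y : close2 z y d -> `|f z - f y| <= e by move=> [h1 h2]; exact: hd.
exists (Num.truncn (2 * M / d)).+1 => // n /= hn.
have hk : 2 * M / d <= n%:R.
  by apply: ltW; apply: lt_le_trans (truncnS_gt _) _; rewrite ler_nat.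
have h1 := inf_conv_near d0 (ltW e0) h hk.
have h2 := inf_conv_le z (ler0n R n).
by rewrite ler_norml; apply/andP; split; lra.
Qed.

End InfConvolution.

Section Portmanteau.
Context (R : realType) (T : R).
Hypothesis T0 : 0 < T.
Notation ev := (ev T0).
Notation S := (contT T * contT T)%type.
Context d (Omega : measurableType d) (P : probability Omega R).
Context d2 (Omega2 : measurableType d2) (P2 : probability Omega2 R).
Variables (X : R -> Omega -> S) (Z : Omega2 -> S).

(** The two paths are sampled into one vector, the second after the first,
    with the [2 ^ n + 1] nodes of level [n] each. *)
Definition coords (n : nat) (z : S) (i : nat) : R :=
  if (i < (2 ^ n).+1)%N then ev z.1 (node T n i) else ev z.2 (node T n (i - (2 ^ n).+1)).

Hypothesis coords_conv : forall n (G : (nat -> R) -> R) M Lip, 0 <= Lip -> (forall v, `|G v| <= M) ->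
  (forall v v', `|G v - G v'| <= Lip * \sum_(i < (2 ^ n).+1 + (2 ^ n).+1) `|v i - v' i|) ->
  conv P P2 (fun eps i w => coords n (X eps w) i) (fun i w => coords n (Z w) i) G.

Variables (B : R -> nat -> Omega -> R) (C rho : R).
Hypotheses (C0 : 0 <= C) (rho0 : 0 <= rho) (rho1 : rho < 1).
Hypothesis B_bound : forall eps n, 0 < eps -> intb P (B eps n) (C * rho ^+ n).
Hypothesis B_incr : forall eps n w k, 0 < eps -> (k < 2 ^ n)%N ->
  `|ev (X eps w).1 (node T n k.+1) - ev (X eps w).1 (node T n k)| <= B eps n w /\
  `|ev (X eps w).2 (node T n k.+1) - ev (X eps w).2 (node T n k)| <= B eps n w.

Definition cvg_expectation (f : S -> R) := [/\
  forall eps, 0 < eps -> measurable_fun setT (fun w => f (X eps w)),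
  measurable_fun setT (fun w => f (Z w)) &
  \int[P]_w f (X eps w) @[eps --> 0^'+] --> \int[P2]_w f (Z w)].

(** Composed with the interpolation of the sampled values, [f] becomes a
    function of finitely many coordinates, to which [coords_conv] applies. *)
Definition smooth (f : S -> R) (n : nat) (v : nat -> R) : R :=
  f (project T0 n v, project T0 n (fun i => v ((2 ^ n).+1 + i)%N)).

Lemma ev_coords1 n z r : ev (project T0 n (coords n z)) r = interp T n (fun k => ev z.1 (node T n k)) (clamp T r).
Proof.
rewrite ev_project /interp; congr (_ / _); apply: eq_bigr => k _; by rewrite /coords ltn_ord.
Qed.

Lemma ev_coords2 n z r : ev (project T0 n (fun i => coords n z ((2 ^ n).+1 + i)%N)) r =
  interp T n (fun k => ev z.2 (node T n k)) (clamp T r).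
Proof.
rewrite ev_project /interp; congr (_ / _); apply: eq_bigr => k _.
by rewrite /coords ltnNge leq_addr /= addKn.
Qed.

Lemma ev_clamp x r : ev x (clamp T r) = ev x r.
Proof. by rewrite /ev; congr (x _); apply: val_inj => /=; apply: clampE; exact: clamp_in. Qed.

Lemma smooth_lipschitz f k n v v' : 0 <= k -> lipschitz2 T0 f k ->
  `|smooth f n v - smooth f n v'| <= k * \sum_(i < (2 ^ n).+1 + (2 ^ n).+1) `|v i - v' i|.
Proof.
move=> k0 lf; apply: lf; rewrite big_split_ord /=; split=> r /=; rewrite !ev_project.
  apply: le_trans (interp_lipschitz T0 n _ _ (clamp_in T0 r)) _.
  by rewrite lerDl; apply: sumr_ge0.
apply: le_trans (interp_lipschitz T0 n _ _ (clamp_in T0 r)) _.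
by rewrite lerDr; apply: sumr_ge0.
Qed.

Lemma smooth_cvg f k z : 0 <= k -> lipschitz2 T0 f k -> smooth f n (coords n z) @[n --> \oo] --> f z.
Proof.
move=> k0 lf; apply/cvgrPdist_le => e e0.
have k1 : 0 < k + 1 by rewrite ltr_pwDr.
have e1 : 0 < e / (k + 1) by rewrite divr_gt0.
have [m1 h1] := interp_cvg T0 (@ev_continuous _ _ T0 z.1) e1.
have [m2 h2] := interp_cvg T0 (@ev_continuous _ _ T0 z.2) e1.
exists (maxn m1 m2) => // n /=; rewrite geq_max => /andP[n1 n2].
apply: le_trans (lf _ _ (e / (k + 1)) _) _; last first.
  by rewrite mulrA ler_pdivrMr// mulrC ler_wpM2l ?(ltW e0)// lerDl.
split=> r /=; rewrite distrC.
  by rewrite ev_coords1 -(ev_clamp z.1 r); apply: h1 => //; exact: clamp_in.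
by rewrite ev_coords2 -(ev_clamp z.2 r); apply: h2 => //; exact: clamp_in.
Qed.

Lemma smooth_refine f k eps n w : 0 < eps -> 0 <= k -> lipschitz2 T0 f k ->
  `|smooth f n.+1 (coords n.+1 (X eps w)) - smooth f n (coords n (X eps w))| <= k * (2 * B eps n.+1 w).
Proof.
move=> e0 k0 lf.
have B0 : 0 <= B eps n.+1 w.
  have [h _] := @B_incr eps n.+1 w 0 e0 (expn_gt0 2 n.+1); apply: le_trans h; exact: normr_ge0.
apply: lf; split=> r /=.
  rewrite !ev_coords1; apply: interp_refine => //; first exact: clamp_in.
  by move=> j jn; have [] := @B_incr eps n.+1 w j e0 jn.
rewrite !ev_coords2; apply: interp_refine => //; first exact: clamp_in.
by move=> j jn; have [] := @B_incr eps n.+1 w j e0 jn.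
Qed.

(** Consecutive interpolations differ by at most twice the largest increment
    at the finer level, whose expectation decays geometrically, uniformly in
    [eps]. The functionals of the interpolated paths converge for each level,
    and the uniformity allows the limit over the levels. *)
Lemma lipschitz_cvg (f : S -> R) (M k : R) : 0 <= k -> (forall z, `|f z| <= M) ->
  lipschitz2 T0 f k -> cvg_expectation f.
Proof.
move=> k0 fM lf.
pose fn n z := smooth f n (coords n z).
have cv n : conv P P2 (fun eps i w => coords n (X eps w) i) (fun i w => coords n (Z w) i) (smooth f n).
  by apply: (coords_conv (M := M) k0) => [v|v v']; [exact: fM|exact: smooth_lipschitz].
have bX n eps : 0 < eps -> bmf (fun w => fn n (X eps w)) by move=> e0; exact: (conv_bmf (cv n) e0).
have bZ n : bmf (fun w => fn n (Z w)) := conv_bmf2 (cv n).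
have limX eps : 0 < eps -> bmf (fun w => f (X eps w)) /\
    \int[P]_w fn n (X eps w) @[n --> \oo] --> \int[P]_w f (X eps w).
  move=> e0; apply: (@Ex_bounded_cvg _ _ _ P (fun n w => fn n (X eps w)) _ M).
  - by move=> n; have [] := bX n _ e0.
  - by move=> n w; exact: fM.
  - by move=> w; exact: smooth_cvg lf.
have [bfZ limZ] : bmf (fun w => f (Z w)) /\ \int[P2]_w fn n (Z w) @[n --> \oo] --> \int[P2]_w f (Z w).
  apply: (@Ex_bounded_cvg _ _ _ P2 (fun n w => fn n (Z w)) _ M).
  - by move=> n; have [] := bZ n.
  - by move=> n w; exact: fM.
  - by move=> w; exact: smooth_cvg lf.
split; [by move=> eps e0; have [[]] := limX _ e0|by have [] := bfZ|].
have r1 : 0 < 1 - rho by rewrite subr_gt0.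
pose kap := 2 * k * C / (1 - rho).
have kap0 : 0 <= kap by rewrite divr_ge0 ?mulr_ge0// ltW.
have step eps n : 0 < eps -> `|\int[P]_w fn n.+1 (X eps w) - \int[P]_w fn n (X eps w)| <= kap * (rho ^+ n - rho ^+ n.+1).
  move=> e0; have b1 := bX n.+1 _ e0; have b2 := bX n _ e0; rewrite -ExB//.
  apply: le_trans (_ : _ <= k * 2 * (C * rho ^+ n.+1)) _; last first.
    have -> : kap * (rho ^+ n - rho ^+ n.+1) = k * 2 * (C * rho ^+ n) by rewrite /kap exprS; field; rewrite gt_eqF.
    by rewrite !ler_wpM2l ?mulr_ge0// exprS ler_piMl ?exprn_ge0// ltW.
  apply: (@intb_le _ _ _ P _ (fun w => k * 2 * B eps n.+1 w)).
  - by apply: measurable_funB; [have [] := b1|have [] := b2].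
  - by move=> w; rewrite -mulrA; exact: smooth_refine.
  - by apply: intbZ; [exact: mulr_ge0|exact: B_bound].
have tail eps m j : 0 < eps -> `|\int[P]_w fn (m + j)%N (X eps w) - \int[P]_w fn m (X eps w)| <= kap * (rho ^+ m - rho ^+ (m + j)%N).
  move=> e0; elim: j => [|j IH]; first by rewrite addn0 !subrr normr0 mulr0.
  rewrite addnS; have h := step eps (m + j)%N e0.
  apply: le_trans (ler_distD (\int[P]_w fn (m + j)%N (X eps w)) _ _) _.
  by apply: le_trans (lerD h IH) _; rewrite -mulrDr ler_wpM2l//; lra.
have unif eps m : 0 < eps -> `|\int[P]_w f (X eps w) - \int[P]_w fn m (X eps w)| <= kap * rho ^+ m.
  move=> e0; have [_ cX] := limX _ e0.
  have c1 : `|\int[P]_w fn n (X eps w) - \int[P]_w fn m (X eps w)| @[n --> \oo] -->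
      `|\int[P]_w f (X eps w) - \int[P]_w fn m (X eps w)|.
    by apply: cvg_norm; apply: cvgB => //; exact: cvg_cst.
  apply: (ler_cvg_to c1 (@cvg_cst _ _ _ _ _)).
  exists m => // n /= mn; rewrite -(subnKC mn); apply: le_trans (tail _ _ _ e0) _.
  by rewrite ler_wpM2l// gerBl exprn_ge0.
apply/cvgrPdist_lt => e e0.
have e4 : 0 < e / 4 by rewrite divr_gt0.
have c1 : kap * rho ^+ n @[n --> \oo] --> (kap * 0 : R) by apply: cvgMr; apply: cvg_expr; rewrite ger0_norm.
rewrite mulr0 in c1.
have [m [h1 h2]] : exists m, kap * rho ^+ m < e / 4 /\ `|\int[P2]_w f (Z w) - \int[P2]_w fn m (Z w)| < e / 4.
  have /cvgr0Pnorm_lt/(_ _ e4) a1 := c1; have /cvgrPdist_lt/(_ _ e4) a2 := limZ.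
  have [j _ hj] := filterI a1 a2; exists j; have [x1 x2] := hj j (leqnn j); split => //.
  by apply: le_lt_trans (ler_norm _) _.
have [_ _ _ cm] := cv m.
near=> eps.
have ep0 : 0 < eps by near: eps; exact: nbhs_right_gt.
have h3 : `|\int[P2]_w fn m (Z w) - \int[P]_w fn m (X eps w)| < e / 4.
  by near: eps; move/cvgrPdist_lt : cm; apply.
have := unif eps m ep0; move: h1 h2 h3; move: (kap * _) => y.
rewrite !ltr_norml !ler_norml => ? /andP[? ?] /andP[? ?] /andP[? ?]; apply/andP; split; lra.
Unshelve. all: by end_near. Qed.

(** The Lipschitz functions [inf_conv] converge to [g] from below, so the
    lower limit of the expectations of [g] is at least the expectation at the
    limit. For [f] and [- f] this gives convergence. *)
Lemma continuous_cvg_expectation (f : S -> R) (M : R) : continuous f -> (forall z, `|f z| <= M) ->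
  cvg_expectation f.
Proof.
have main (g : S -> R) : continuous g -> (forall z, `|g z| <= M) ->
    [/\ forall eps, 0 < eps -> measurable_fun setT (fun w => g (X eps w)),
      measurable_fun setT (fun w => g (Z w)) &
      forall e, 0 < e -> \forall eps \near 0^'+, \int[P2]_w g (Z w) - e <= \int[P]_w g (X eps w)].
  move=> cg gM.
  have ib n z : `|inf_conv T0 g n%:R z| <= M by exact: inf_conv_bounded.
  have il n : lipschitz2 T0 (inf_conv T0 g n%:R) n%:R.
    by apply: (inf_conv_lipschitz (M := M)).
  have lc n := lipschitz_cvg (ler0n R n) (ib n) (il n).
  have limX eps : 0 < eps -> bmf (fun w => g (X eps w)) /\
      \int[P]_w inf_conv T0 g n%:R (X eps w) @[n --> \oo] --> \int[P]_w g (X eps w).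
    move=> e0; apply: (@Ex_bounded_cvg _ _ _ P _ _ M).
    - by move=> n; have [h _ _] := lc n; exact: h.
    - by move=> n w; exact: inf_conv_bounded.
    - by move=> w; exact: inf_conv_cvg.
  have [bZ limZ] : bmf (fun w => g (Z w)) /\
      \int[P2]_w inf_conv T0 g n%:R (Z w) @[n --> \oo] --> \int[P2]_w g (Z w).
    apply: (@Ex_bounded_cvg _ _ _ P2 _ _ M).
    - by move=> n; have [_ h _] := lc n.
    - by move=> n w; exact: inf_conv_bounded.
    - by move=> w; exact: inf_conv_cvg.
  split; [by move=> eps e0; have [[]] := limX _ e0|by have [] := bZ|].
  move=> e e0; have e2 : 0 < e / 2 by rewrite divr_gt0.
  have /cvgrPdist_lt/(_ _ e2)[n _ /(_ n (leqnn n))] := limZ.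
  rewrite /= ltr_norml => /andP[_ h1].
  have [mX _ cn] := lc n.
  near=> eps.
  have ep0 : 0 < eps by near: eps; exact: nbhs_right_gt.
  have : `|\int[P2]_w inf_conv T0 g n%:R (Z w) - \int[P]_w inf_conv T0 g n%:R (X eps w)| < e / 2.
    by near: eps; move/cvgrPdist_lt : cn; apply.
  rewrite ltr_norml => /andP[_ h2].
  have h3 : \int[P]_w inf_conv T0 g n%:R (X eps w) <= \int[P]_w g (X eps w).
    apply: le_Ex.
    - by split; [exact: mX|exists M => w; exact: inf_conv_bounded].
    - by have [] := limX _ ep0.
    - by move=> w; exact: inf_conv_le.
  lra.
move=> cf fM.
have [mX mZ low] := main f cf fM.
have [|z|_ _ up] := main (fun z => - f z); first by move=> z; apply: cvgN; exact: cf.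
  by rewrite normrN.
split => //; apply/cvgrPdist_le => e e0.
near=> eps.
have ep0 : 0 < eps by near: eps; exact: nbhs_right_gt.
have h1 : \int[P2]_w f (Z w) - e <= \int[P]_w f (X eps w) by near: eps; exact: low.
have h2 : \int[P2]_w (- f (Z w)) - e <= \int[P]_w (- f (X eps w)) by near: eps; exact: up.
have bX : bmf (fun w => f (X eps w)) by split; [exact: mX|exists M => w].
have bZ : bmf (fun w => f (Z w)) by split => //; exists M => w.
have n1 : \int[P2]_w (- f (Z w)) = - \int[P2]_w f (Z w).
  by rewrite -[RHS]mulN1r -(ExZ P2 (- 1) bZ); apply: eq_Rintegral => w _; rewrite mulN1r.
have n2 : \int[P]_w (- f (X eps w)) = - \int[P]_w f (X eps w).
  by rewrite -[RHS]mulN1r -(ExZ P (- 1) bX); apply: eq_Rintegral => w _; rewrite mulN1r.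
rewrite n1 n2 in h2; rewrite ler_norml; apply/andP; split; lra.
Unshelve. all: by end_near. Qed.

End Portmanteau.

(** * Uniform bound on the increments *)

Lemma sin_neq0 (R : realType) (theta : R) :
  (0 < theta < pi) \/ (pi < theta < 2 * pi) -> sin theta != 0.
Proof.
move=> [h|/andP[h1 h2]]; first by rewrite gt_eqF// sin_gt0_pi.
have -> : theta = (theta - pi) + pi by rewrite subrK.
rewrite sinDpi oppr_eq0 gt_eqF// sin_gt0_pi// subr_gt0 h1 /=; lra.
Qed.

Lemma cos_neq1 (R : realType) (theta : R) : sin theta != 0 -> cos theta != 1.
Proof. by apply: contra => /eqP c1; rewrite -norm_cos_eq1 c1 normr1. Qed.

Lemma cos_double_neq1 (R : realType) (theta : R) : sin theta != 0 -> cos (theta *+ 2) != 1.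
Proof.
apply: contra => /eqP; rewrite cos_mulr2n cos2sin2 => h.
by rewrite -sqrf_eq0; apply/eqP; lra.
Qed.

Section Tightness.
Context (R : realType) d (Omega : measurableType d) (P : probability Omega R).
Variable N : R -> {RV P >-> nat}.
Hypothesis hN : standard_poisson_process N.
Variables (theta H T : R).
Hypothesis ct1 : cos theta != 1.
Hypotheses (H02 : 0 < H < 2) (T0 : 0 < T).
Notation mu := (@lebesgue_measure R).
Notation halfline := (`[(0 : R), +oo[%classic).
Notation K := (laplace_kernel H).
Let a := H / 2.

Variables (phi : R) (X : R -> Omega -> contT T).
Hypothesis hX : forall eps t, 0 < eps -> measurable_fun setT (fun w => ev T0 (X eps w) t) /\
  L2_cvg P setT +oo (fun r => poisson_int N theta phi (K (clamp T t)) eps r) (fun w => ev T0 (X eps w) t).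

Lemma kernel_diff_integrable s t : 0 <= s <= T -> 0 <= t <= T ->
  mu.-integrable halfline (EFin \o (fun r => (K t r - K s r) ^+ 2)).
Proof.
move=> hs ht.
have i : mu.-integrable halfline (EFin \o (fun r => 2 * K t r ^+ 2 + 2 * K s r ^+ 2)).
  apply: integrable_add; first exact: measurable_itv.
    by apply: integrable_scale; [exact: measurable_itv|exact: (kernel_sqr_integrable H02 T0)].
  by apply: integrable_scale; [exact: measurable_itv|exact: (kernel_sqr_integrable H02 T0)].
apply: integrable_bounded_by i => //.
  by apply: measurable_funTS; apply: measurable_funX; apply: measurable_funB; exact: measurable_kernel.
move=> r _; rewrite ger0_norm ?sqr_ge0//.
by have := sqr_ge0 (K t r + K s r); nra.
Qed.

Lemma path_sqm eps t : 0 < eps ->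
  sqm P (fun w => ev T0 (X eps w) t) (32 / gap theta * \int[mu]_(r in halfline) (K (clamp T t) r ^+ 2)).
Proof.
move=> e0; have [mX cX] := @hX eps t e0.
apply: (poisson_L2 hN ct1 e0 _ _ mX cX); first exact: measurable_kernel.
  by apply: (kernel_sqr_integrable H02 T0); exact: clamp_in.
exact: nearW.
Qed.

Lemma path_incr_sqm eps s t : 0 < eps ->
  sqm P (fun w => ev T0 (X eps w) t - ev T0 (X eps w) s)
    (32 / gap theta * \int[mu]_(r in halfline) ((K (clamp T t) r - K (clamp T s) r) ^+ 2)).
Proof.
move=> e0; have [mt ct] := @hX eps t e0; have [ms cs] := @hX eps s e0.
have iK u := kernel_sqr_integrable H02 T0 (clamp_in T0 u).
have mp u : \forall r \near +oo, measurable_fun setT (poisson_int N theta phi (K (clamp T u)) eps r).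
  near=> r; have r0 : 0 < r by near: r; apply: nbhs_pinfty_gt; exact: num_real.
  have i2 : mu.-integrable `[0, r] (EFin \o (fun x => K (clamp T u) x ^+ 2)).
    by apply: integrableS (iK u) => //; exact: segment_halfline.
  by have [[]] := poisson_int_L2 hN ct1 phi e0 r0 (integrable_segment r (measurable_kernel H (clamp T u)) (iK u)) i2.
have cB : L2_cvg P setT +oo (fun r w => poisson_int N theta phi (K (clamp T t)) eps r w -
    poisson_int N theta phi (K (clamp T s)) eps r w) (fun w => ev T0 (X eps w) t - ev T0 (X eps w) s).
  exact: (L2_cvgB _ (mp t) (mp s) mt ms ct cs).
apply: (poisson_L2 (f := fun r => K (clamp T t) r - K (clamp T s) r) hN ct1 e0 _ _ _ cB).
- by apply: measurable_funB; exact: measurable_kernel.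
- by apply: kernel_diff_integrable; exact: clamp_in.
- exact: measurable_funB.
- apply: nearW => r; apply/funext => w.
  by apply: poisson_intB => //; apply: integrable_segment => //; exact: measurable_kernel.
Unshelve. all: by end_near. Qed.

(** [decay ^+ (2 * n)] is the order of [mesh T n `^ (H / 2)], hence of the
    sum of the squared increments over the grid of level [n]. *)
Definition decay : R := 2 `^ (- (a / 2)).

Lemma decay_ge0 : 0 <= decay. Proof. exact: powR_ge0. Qed.

Lemma decay_gt0 : 0 < decay. Proof. by apply: powR_gt0. Qed.

Lemma decay_lt1 : decay < 1.
Proof.
have a0 : 0 < a / 2 by have /andP[h1 _] := H02; rewrite /a !divr_gt0.
by rewrite /decay /powR gt_eqF// expR_lt1 mulNr oppr_lt0 mulr_gt0// ln_gt0// ltr1n.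
Qed.

Lemma mesh_powR n : mesh T n `^ a = T `^ a * decay ^+ n ^+ 2.
Proof.
rewrite /mesh powRM ?(ltW T0)//; congr (_ * _).
rewrite -powR_invn// -powRrM /decay -exprM -powR_mulrn ?powR_ge0// -powRrM.
by congr (_ `^ _); rewrite natrM; field.
Qed.

Definition incr_const : R := 32 / gap theta * (T `^ a * kernel_const H T).

Lemma kernel_const_ge0 : 0 <= kernel_const H T.
Proof. by apply: Rintegral_ge0 => r; rewrite /= in_itv/= andbT => r0; exact: majorant_ge0. Qed.

Lemma incr_const_ge0 : 0 <= incr_const.
Proof.
by rewrite /incr_const mulr_ge0 ?divr_ge0 ?mulr_ge0 ?powR_ge0 ?kernel_const_ge0// ltW// gap_gt0.
Qed.

Definition incr eps n k w : R := ev T0 (X eps w) (node T n k.+1) - ev T0 (X eps w) (node T n k).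

(** [abs_le_sqr] with [eta = decay ^+ n], the order of the square root of the
    mean of the sum of squares. *)
Definition incr_bound eps n w : R :=
  decay ^+ n + (decay ^+ n)^-1 * \sum_(k < 2 ^ n) incr eps n k w ^+ 2.

Lemma incr_le eps n k w : (k < 2 ^ n)%N -> `|incr eps n k w| <= incr_bound eps n w.
Proof.
move=> kn; have d0 : 0 < decay ^+ n by rewrite exprn_gt0// decay_gt0.
apply: le_trans (abs_le_sqr _ d0) _; rewrite lerD2l ler_wpM2l ?invr_ge0 ?(ltW d0)//.
rewrite (bigD1 (Ordinal kn))//= lerDl; apply: sumr_ge0 => i _; exact: sqr_ge0.
Qed.

(** The squared increments are bounded through those of the kernels, whose
    sum is controlled by [kernel_increments_integral]. *)
Lemma incr_bound_int eps n : 0 < eps -> intb P (incr_bound eps n) ((1 + incr_const) * decay ^+ n).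
Proof.
move=> e0; have d0 : 0 < decay ^+ n by rewrite exprn_gt0// decay_gt0.
pose I k := \int[mu]_(r in halfline) ((K (clamp T (node T n k.+1)) r - K (clamp T (node T n k)) r) ^+ 2).
have sumI : \sum_(k < 2 ^ n) I k <= mesh T n `^ a * kernel_const H T.
  have cn k : clamp T (node T n k) = node T n k by apply: clampE; exact: node_in.
  have := @kernel_increments_integral R H T H02 T0 (mesh T n) (node T n) (2 ^ n) (mesh_gt0 T0 n)
    (node0 T0 n) (@node_homo _ _ T0 n) _ (fun k _ => node_step T0 n k).
  have -> : node T n (2 ^ n) <= T by have /andP[] := node_in T0 n (2 ^ n).
  move=> /(_ isT); rewrite -lee_fin; apply: le_trans.
  rewrite -sumEFin le_eqVlt; apply/orP; left; apply/eqP; apply: eq_bigr => k _.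
  rewrite /I !cn /Rintegral fineK//; apply: integrable_fin_num => //.
  by apply: kernel_diff_integrable; exact: node_in.
have [i le] : intb P (incr_bound eps n) (decay ^+ n + (decay ^+ n)^-1 * \sum_(k < 2 ^ n) (32 / gap theta * I k)).
  apply: intbD; first exact: intb_cst.
  apply: intbZ; first by rewrite invr_ge0 ltW.
  apply: (@intb_sum _ _ _ P (2 ^ n) (fun k w => incr eps n k w ^+ 2) (fun k => 32 / gap theta * I k)) => k _.
  by apply: intb_sqm; exact: path_incr_sqm.
split => //; apply: le_trans le _; rewrite -mulr_sumr.
have -> : (1 + incr_const) * decay ^+ n = decay ^+ n + incr_const * decay ^+ n by ring.
rewrite lerD2l.
rewrite ler_pdivrMl//.
apply: (@le_trans _ _ (32 / gap theta * (mesh T n `^ a * kernel_const H T))).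
  by rewrite ler_wpM2l// divr_ge0// ltW// gap_gt0.
by rewrite mesh_powR le_eqVlt; apply/orP; left; apply/eqP; rewrite /incr_const expr2; ring.
Qed.

End Tightness.

(** * Convergence in law *)

Section Borel.
Context (R : realType) (T : R).
Hypothesis T0 : 0 < T.

Lemma random_element_open d (Omega : measurableType d) (Z : Omega -> contT T) :
  (forall U : set (contT T), open U -> measurable (Z @^-1` U)) -> random_element Z.
Proof.
move=> h A bA.
have sub : borel (S := contT T) `<=` image_set_system setT Z (@measurable _ Omega).
  apply: smallest_sub.
    apply: sigma_algebra_image; exact: sigma_algebra_measurable.
  by move=> U oU; rewrite /image_set_system /= setTI; exact: h.
by have := sub _ bA; rewrite /image_set_system /= setTI.
Qed.

(** An open set of paths is a superlevel set of a Lipschitz function, which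
    is measurable along a random path by [lipschitz_cvg]. Pairs of paths are
    used to fit that lemma. *)
Lemma open_inf_conv (U : set (contT T)) : open U ->
  [set z : contT T * contT T | U z.1] = [set z | 0 < inf_conv T0 (fun z => \1_U z.1 : R) 1 z].
Proof.
move=> oU.
have fM (z : contT T * contT T) : `|\1_U z.1 : R| <= 1.
  by rewrite indicE; case: (_ \in _); rewrite ?normr1 ?normr0.
apply/seteqP; split => z /=.
  move=> Uz.
  have /(nbhs_close1 T0)[e e0 he] := open_nbhs_nbhs (conj oU Uz).
  apply: (@lt_le_trans _ _ (Num.min 1 e)); first by rewrite lt_min ltr01.
  apply: (le_inf_conv fM) => // y c [zy _]; have c0 : 0 <= c by apply: le_trans (zy 0); exact: normr_ge0.
  rewrite mul1r; have [ce|ec] := lerP c e.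
    have Uy : U y.1 by apply: he => r; apply: le_trans ce.
    by rewrite indicE mem_set// ge_min lerDl c0.
  by rewrite ge_min; apply/orP; right; rewrite (le_trans (ltW ec))// lerDr indicE.
move=> h; have := lt_le_trans h (inf_conv_le T0 fM z ler01).
by rewrite indicE; case: (boolP (z.1 \in U)); rewrite ?inE// ltxx.
Qed.

End Borel.

Theorem theorem3p5 (R : realType) (T H theta : R)
    (hT : 0 < T) (hH : 0 < H < 2)
    (htheta : (0 < theta < pi) \/ (pi < theta < 2 * pi))
    (d : measure_display) (Omega : measurableType d) (P : probability Omega R)
    (N : R -> {RV P >-> nat}) (hN : standard_poisson_process N)
    (X Xt : R -> Omega -> contT T)
    (hX : forall eps, 0 < eps -> poisson_version cos H theta N eps (X eps))
    (hXt : forall eps, 0 < eps -> poisson_version sin H theta N eps (Xt eps))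
    (d' : measure_display) (Omega' : measurableType d')
    (Q : probability Omega' R)
    (W : R -> {RV Q >-> R}) (hW : standard_brownian_motion W)
    (XH : Omega' -> contT T) (hXH : wiener_version H W XH) :
  exists (d'' : measure_display) (Omega'' : measurableType d'')
      (P'' : probability Omega'' R) (Z Zt : Omega'' -> contT T),
    [/\ random_element Z /\ random_element Zt,
        independent_elements P'' Z Zt,
        same_law P'' Z Q XH, same_law P'' Zt Q XH &
        cvg_in_law 0^'+ P (fun eps omega => (X eps omega, Xt eps omega))
          P'' (fun omega => (Z omega, Zt omega))].
Proof.
have st := sin_neq0 htheta; have ct1 := cos_neq1 st; have ct2 := cos_double_neq1 st.
(* The two coordinates of the square of the given space carry two independent
   copies of the limit. *)
pose QQ : probability (Omega' * Omega')%type R := (Q \x Q)%E.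
pose Z (z : Omega' * Omega') := XH z.1; pose Zt (z : Omega' * Omega') := XH z.2.
pose XX eps w := (X eps w, Xt eps w); pose ZZ z := (Z z, Zt z).
have evX eps t : 0 < eps -> measurable_fun setT (fun w => ev hT (X eps w) t) /\
    L2_cvg P setT +oo (truncated_integral cos H theta N eps (clamp T t)) (fun w => ev hT (X eps w) t).
  by move=> e0; exact: (hX eps e0 (pt hT t)).
have evXt eps t : 0 < eps -> measurable_fun setT (fun w => ev hT (Xt eps w) t) /\
    L2_cvg P setT +oo (truncated_integral sin H theta N eps (clamp T t)) (fun w => ev hT (Xt eps w) t).
  by move=> e0; exact: (hXt eps e0 (pt hT t)).
have evZ t : wiener_integral W (laplace_kernel H (clamp T t)) (fun w => ev hT (XH w) t) := hXH (pt hT t).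
have pX eps t : 0 < eps -> measurable_fun setT (fun w => ev hT (X eps w) t) /\
    L2_cvg P setT +oo (fun r => poisson_int N theta 0 (laplace_kernel H (clamp T t)) eps r) (fun w => ev hT (X eps w) t).
  by move=> e0; rewrite -truncated_cosE; exact: evX.
have pXt eps t : 0 < eps -> measurable_fun setT (fun w => ev hT (Xt eps w) t) /\
    L2_cvg P setT +oo (fun r => poisson_int N theta (- (pi / 2)) (laplace_kernel H (clamp T t)) eps r) (fun w => ev hT (Xt eps w) t).
  by move=> e0; rewrite -truncated_sinE; exact: evXt.
have mZ t : measurable_fun setT (fun w => ev hT (XH w) t) by have [] := evZ t.
(* Lipschitz functions of the sampled paths: second moments from [path_sqm],
   characteristic functions from [fdd_cos]. *)
have cc n (G : (nat -> R) -> R) M Lip : 0 <= Lip -> (forall v, `|G v| <= M) ->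
    (forall v v', `|G v - G v'| <= Lip * \sum_(i < (2 ^ n).+1 + (2 ^ n).+1) `|v i - v' i|) ->
    conv P QQ (fun eps i w => coords hT n (XX eps w) i) (fun i w => coords hT n (ZZ w) i) G.
  move=> L0 GM GL; set p := (2 ^ n).+1 in GL *.
  pose nd i := clamp T (node T n i).
  pose m2 i := 32 / gap theta * \int[@lebesgue_measure R]_(r in `[(0 : R), +oo[%classic)
     (laplace_kernel H (clamp T (node T n (if (i < p)%N then i else i - p)%N)) r ^+ 2).
  apply: (@lipschitz_conv _ _ _ P _ _ QQ (p + p) _ _ m2 _ _ _ M Lip) => //.
  - move=> eps i e0; rewrite /m2 /coords -/p; case: ifP => _.
      exact: (path_sqm hN ct1 hH pX).
    exact: (path_sqm hN ct1 hH pXt).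
  - move=> i; rewrite (_ : (fun w => _) = if (i < p)%N then fun w => ev hT (XH w.1) (node T n i)
        else fun w => ev hT (XH w.2) (node T n (i - p))); last first.
      by apply/funext => w; rewrite /coords -/p; case: ifP.
    case: ifP => _.
      by apply: (@measurableT_comp _ _ _ _ _ _ (fun w => ev hT (XH w) (node T n i))) => //; exact: measurable_fst.
    by apply: (@measurableT_comp _ _ _ _ _ _ (fun w => ev hT (XH w) (node T n (i - p)))) => //; exact: measurable_snd.
  - move=> c phi.
    have split_sum (x y : nat -> R) : \sum_(i < p + p) c i * (if (i < p)%N then x i else y (i - p)%N) =
        \sum_(i < p) (c i * x i + c (p + i)%N * y i).
      rewrite big_split_ord big_split /=; congr (_ + _); apply: eq_bigr => i _; first by rewrite ltn_ord.
      by rewrite ltnNge leq_addr /= addKn.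
    have f1 (b : set_system R) (u : R -> R) (u' : R -> R) l : u =1 u' -> u' x @[x --> b] --> l -> u x @[x --> b] --> l.
      by move=> /funext ->.
    have := @fdd_cos _ _ _ P N hN theta H T ct1 ct2 hH hT _ _ Q W hW p nd (fun i => clamp_in hT (node T n i))
      (fun eps i w => ev hT (X eps w) (node T n i)) (fun eps i w => ev hT (Xt eps w) (node T n i))
      (fun i w => ev hT (XH w) (node T n i)) (fun eps i e0 => evX eps _ e0) (fun eps i e0 => evXt eps _ e0)
      (fun i => evZ _) c (fun i => c (p + i)%N) phi.
    rewrite -[X in _ --> X -> _](_ : \int[QQ]_w cos (\sum_(i < p + p) c i * coords hT n (ZZ w) i + phi) = _); last first.
      by apply: eq_Rintegral => w _; rewrite /coords -/p (split_sum (fun i => ev hT (XH w.1) (node T n i)) (fun i => ev hT (XH w.2) (node T n i))).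
    apply: f1 => eps; apply: eq_Rintegral => w _.
    by rewrite /coords -/p (split_sum (fun i => ev hT (X eps w) (node T n i)) (fun i => ev hT (Xt eps w) (node T n i))).
pose B eps n w := incr_bound H hT X eps n w + incr_bound H hT Xt eps n w.
have C0 : 0 <= 2 * (1 + incr_const theta H T) by rewrite mulr_ge0// addr_ge0// incr_const_ge0.
have Bb eps n : 0 < eps -> intb P (B eps n) (2 * (1 + incr_const theta H T) * decay H ^+ n).
  move=> e0; rewrite -mulrA mulr_natl mulr2n.
  by apply: intbD; [exact: (incr_bound_int hN ct1 hH pX)|exact: (incr_bound_int hN ct1 hH pXt)].
have Bi eps n w k : 0 < eps -> (k < 2 ^ n)%N ->
    `|ev hT (XX eps w).1 (node T n k.+1) - ev hT (XX eps w).1 (node T n k)| <= B eps n w /\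
    `|ev hT (XX eps w).2 (node T n k.+1) - ev hT (XX eps w).2 (node T n k)| <= B eps n w.
  move=> e0 kn.
  have h1 := incr_le H hT X eps w kn; have h2 := incr_le H hT Xt eps w kn.
  have b1 := le_trans (normr_ge0 _) h1; have b2 := le_trans (normr_ge0 _) h2.
  by split; [apply: le_trans h1 _; rewrite lerDl|apply: le_trans h2 _; rewrite lerDr].
have d1 := decay_lt1 hH.
have lc := lipschitz_cvg cc C0 (decay_ge0 H) d1 Bb Bi.
have cce := continuous_cvg_expectation cc C0 (decay_ge0 H) d1 Bb Bi.
(* The marginals of [XH] are measurable; open sets are reached through
   [open_inf_conv]. *)
have rXH : random_element XH.
  apply: random_element_open => U oU.
  have fM (z : contT T * contT T) : `|\1_U z.1 : R| <= 1.
    by rewrite indicE; case: (_ \in _); rewrite ?normr1 ?normr0.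
  pose g := inf_conv hT (fun z => \1_U z.1 : R) 1.
  have gM z : `|g z| <= 1 by exact: inf_conv_bounded.
  have gl : lipschitz2 hT g 1 by exact: (inf_conv_lipschitz (M := 1)).
  have [_ mg _] := lc _ _ _ ler01 gM gl.
  have mdiag : measurable_fun setT (fun w : Omega' => (w, w)) by exact: measurable_fun_pair.
  have := measurableT_comp mg mdiag.
  move=> /(_ measurableT `]0, +oo[%classic (measurable_itv _)); rewrite setTI.
  congr measurable; apply/seteqP; split => w /=; rewrite in_itv/= andbT.
    by have := open_inf_conv hT oU => /seteqP[_ h2] h3; exact: (h2 (XH w, XH w)).
  by have := open_inf_conv hT oU => /seteqP[h1 _] h3; exact: (h1 (XH w, XH w)).
exists _, (Omega' * Omega')%type, QQ, Z, Zt; split.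
- split=> A bA.
    have := @measurable_fst _ _ Omega' Omega' measurableT _ (rXH _ bA); by rewrite setTI.
  have := @measurable_snd _ _ Omega' Omega' measurableT _ (rXH _ bA); by rewrite setTI.
- move=> A A' bA bA'; have mA := rXH _ bA; have mA' := rXH _ bA'.
  have := product_independent Q mA mA'.
  by rewrite -(product_fst Q mA) -(product_snd Q mA').
- by move=> A bA; exact: (product_fst Q (rXH _ bA)).
- by move=> A bA; exact: (product_snd Q (rXH _ bA)).
- move=> f cf [M fM]; have [mX mZZ cE] := cce f M cf fM.
  have EE d0 (O : measurableType d0) (p : probability O R) (g : O -> R) : measurable_fun setT g ->
      (forall w, `|g w| <= M) -> ('E_p[g])%E = (\int[p]_w g w)%:E.
    move=> mg gM; rewrite unlock /Rintegral fineK//.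
    by apply: integrable_fin_num => //; apply: (bmf_integrable p); split => //; exists M.
  rewrite EE//; last by move=> w; exact: fM.
  have cE' : (\int[P]_w f (XX eps w))%:E @[eps --> 0^'+] --> (\int[QQ]_w f (ZZ w))%:E.
    by apply: cvg_EFin => //; exact: nearW.
  apply: cvg_trans cE'; apply: near_eq_cvg; near=> eps.
  have e0 : 0 < eps by near: eps; exact: nbhs_right_gt.
  by rewrite (EE _ _ P (fun w => f (XX eps w)) (mX eps e0) (fun w => fM _)).
Unshelve. all: by end_near. Qed.
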